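(* For any $\alpha>0$ the following statements hold. (i) For all $i=0,1,\ldots$ and $\delta\in\{0,1\}$, $$V_\alpha(i,\delta)\le (1-\delta)s_1+\frac{hi}{\mu+\alpha}+\frac{h\lambda}{\alpha(\mu+\alpha)}+\frac{c}{\alpha}.$$ (ii) For all $i=0,1,\ldots$ and all $\delta\in\{0,1\}$, the value function $V_\alpha(i,\delta)$ satisfies the discount-optimality equation $$V_\alpha(i,\delta)=\min_{a\in\{0,1\}}\left\{C_\alpha((i,\delta),a)+\frac{q(i-1|i,a)}{\alpha+q(i,a)}V_\alpha(i-1,a)+\frac{q(i+1|i,a)}{\alpha+q(i,a)}V_\alpha(i+1,a)\right\}$$ $$=\min\left\{(1-\delta)s_1+\frac{hi+c}{\alpha+\lambda+i\mu}+\frac{\lambda}{\alpha+\lambda+i\mu}V_\alpha(i+1,1)+\frac{i\mu}{\alpha+\lambda+i\mu}V_\alpha(i-1,1),\ \ \delta s_0+\frac{hi}{\alpha+\lambda}+\frac{\lambda}{\alpha+\lambda}V_\alpha(i+1,0)\right\}.$$ (iii) There exists a stationary discount-optimal policy, and a stationary policy $\phi$ is discount-optimal if and only if for all $i=0,1,\ldots$ and all $\delta\in\{0,1\}$, writing $a=\phi(i,\delta)$, $$V_\alpha(i,\delta)=C_\alpha((i,\delta),a)+\frac{q(i-1|i,a)}{\alpha+q(i,a)}V_\alpha(i-1,a)+\frac{q(i+1|i,a)}{\alpha+q(i,a)}V_\alpha(i+1,a),$$ that is, $\phi(i,\delta)$ attains the minimum in the discount-optimality equation of (ii).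
   Context: Model. Consider an $M/M/\infty$ queue: Poisson arrivals with rate $\lambda>0$, infinitely many independent identical servers, exponential service times with rate $\mu>0$. The entire service capacity can be switched on or off: when it is off nobody is served, when it is on every customer in the system is in service. Costs: holding cost $h>0$ per customer per unit time; running cost $c>0$ per unit time while the system is on (0 while off); start-up cost $s_1\ge 0$ each time the system is switched on; shut-down cost $s_0\ge 0$ each time it is switched off; $s_0+s_1>0$. This is a continuous-time Markov decision process with state space $Z=\mathbb{N}\times\{0,1\}$, $\mathbb{N}=\{0,1,\ldots\}$. In state $(i,\delta)$, $i$ is the number of customers in the system and $\delta$ is the status (1 = on, 0 = off) of the system at the last jump epoch, i.e. prior to the current decision; jump epochs are arrival and departure epochs. In every state the available actions are $A=\{0,1\}$ (0: system off, 1: system on). Under action $a$ the process moves from $(i,\delta)$ to $(j,a)$, $j\ne i$, with rate $q(j|i,a)$, where $q(j|i,a)=\lambda$ if $j=i+1$, $q(j|i,a)=i\mu$ if $i>0,\ a=1,\ j=i-1$, and $q(j|i,a)=0$ otherwise. A general policy may be time-dependent and history-dependent (actions are a predictable function of time and history). A stationary policy is a function $\phi:Z\to A$: at each jump epoch (and at time 0), in state $z$, action $\phi(z)$ is chosen and kept until the next jump. Discounted costs. For a policy $\pi$ and initial state $z=(i,\delta)$, let $x_t$ be the number of customers at time $t$, $a(t)$ the action at time $t$ (left-continuous, $a(0)=\delta$), $0\le t_1<t_2<\cdots$ the times at which the system is switched on or off, and $N(t)$ the number of switchings up to time $t$. The cumulative cost is $C(t)=\int_0^t (h x_s+c\,a(s))\,ds+\sum_{n=1}^{N(t)}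 s_{a(t_n+)}|a(t_n+)-a(t_n)|$. For $\alpha>0$, $V_\alpha^\pi(z)=E^\pi_z\int_0^\infty e^{-\alpha t}dC(t)$, with $V_\alpha^\pi(z)=\infty$ if $N(t)=\infty$ with positive probability for some $t<\infty$. Put $V_\alpha(z)=\inf_\pi V_\alpha^\pi(z)$, the infimum over all policies. A policy $\pi$ is discount-optimal (for discount rate $\alpha$) if $V_\alpha^\pi(z)=V_\alpha(z)$ for all $z\in Z$. Further notation: $q(i,a)=\sum_{j\ne i}q(j|i,a)$, i.e. $q(i,0)=\lambda$, $q(i,1)=\lambda+i\mu$; $C_\alpha((i,\delta),a)=|a-\delta|s_a+\frac{hi+ac}{\alpha+q(i,a)}$; convention $V_\alpha(-1,\delta)=0$. *)

(* Defs.v *)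
From HB Require Import structures.
From mathcomp Require Import all_boot all_order all_algebra.
From mathcomp Require Import all_classical all_reals all_analysis.
Import Order.TTheory GRing.Theory Num.Theory.
Import numFieldNormedType.Exports.

Set Implicit Arguments.
Unset Strict Implicit.
Unset Printing Implicit Defensive.

Local Open Scope classical_set_scope.
Local Open Scope ring_scope.

Record queue (R : realType) := Queue {
  arrival_rate : R ;
  service_rate : R ;
  holding_cost : R ;
  running_cost : R ;
  shutdown_cost : R ;
  startup_cost : R }.

(* [(i, d)]: [i] customers, and the system was on ([d = true]) or off at the
   last jump epoch, before the current decision. *)
Notation state := (nat * bool)%type.

(* The initial state, followed by the first [n] pairs
   (sojourn time, state right after the jump). *)
Notation history R n := (state * n.-tuple (R * state)%type)%type.

Section rates.
Context {R : realType} (M : queue R).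

Definition switch_cost (a : bool) : R :=
  if a then startup_cost M else shutdown_cost M.

(* [rate j i a] is q(j|i,a).  The target [j] is an integer so that [i - 1]
   keeps its meaning when [i = 0]. *)
Definition rate (j : int) (i : nat) (a : bool) : R :=
  if j == i%:Z + 1 then arrival_rate M
  else if [&& (0 < i)%N, a & j == i%:Z - 1] then i%:R * service_rate M
  else 0.

Definition total_rate (i : nat) (a : bool) : R :=
  if a then arrival_rate M + i%:R * service_rate M else arrival_rate M.

End rates.

Section policies.
Context {R : realType}.

(* [pi n h s] is the action in force [s > 0] units of time after the [n]-th
   jump if the next jump has not occurred before.  Values at [s <= 0] play no
   role. *)
Definition decision_rule := forall n, history R n -> R -> bool.

(* Left-continuity in the elapsed time makes the action process left-continuous,
   so that switchings are well defined. *)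
Definition policy (pi : decision_rule) : Prop :=
  (forall n, measurable_fun [set: history R n * R] (fun p => pi n p.1 p.2)) /\
  (forall n (h : history R n) (t : R), 0 < t ->
     \forall s \near t^'-, pi n h s = pi n h t).

Definition current_state n (h : history R n) : state :=
  last h.1 [seq x.2 | x <- h.2].

Definition stationary (phi : state -> bool) : decision_rule :=
  fun n h _ => phi (current_state h).

(* A trajectory lists the pairs (length of the [n]-th sojourn, state right after
   the jump that ends it), [n = 0, 1, ...]. *)
Definition cylinders : set_system (nat -> R * state) :=
  [set C | exists n (B : set (R * state)),
     measurable B /\ C = [set w | B (w n)]].

End policies.
Arguments decision_rule : clear implicits.
Arguments cylinders : clear implicits.

Notation path R := (g_sigma_algebraType (cylinders R)).

Section controlled_process.
Context {R : realType} (M : queue R) (pi : decision_rule R) (z : state).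
Local Notation leb := (@lebesgue_measure R).

Definition history_of (w : path R) (n : nat) : history R n :=
  (z, [tuple w i | i < n]).

Definition jump_time (w : path R) (n : nat) : R := \sum_(k < n) (w k).1.

(* Given the history [h] up to the [n]-th jump, the probability that the next
   sojourn time is in [B] and that the jump then leads to [y]: the action in
   force when the jump occurs becomes the status component of [y]. *)
Definition jump_law n (h : history R n) (B : set R) (y : state) : \bar R :=
  let i := (current_state h).1 in
  (\int[leb]_(t in B `&` `]0%R, +oo[)
     ((pi h t == y.2)%:R * rate M y.1 i (pi h t) *
      expR (- \int[leb]_(s in `[0%R, t]) total_rate M i (pi h s))%R)%:E)%E.

Definition is_path_law (P : probability (path R) R) : Prop :=
  forall n (A : set (history R n)) (B : set R) (y : state),
    measurable A -> measurable B ->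
    P [set w | A (history_of w n) /\ B (w n).1 /\ (w n).2 = y] =
    (\int[P]_(w in [set w | A (history_of w n)])
       jump_law (history_of w n) B y)%E.

(* The law of the controlled process: it exists by the Ionescu-Tulcea theorem
   and is unique because it is determined on finite-dimensional cylinders; the
   [else] branch is a dummy value. *)
Definition path_law : probability (path R) R :=
  if pselect (exists P, is_path_law P) is left e then projT1 (cid e)
  else \d_(point : path R).

Definition customers (w : path R) (t : R) : nat :=
  xget 0%N [set k | exists n,
    jump_time w n <= t < jump_time w n.+1 /\
    k = (current_state (history_of w n)).1].

Definition action (w : path R) (t : R) : bool :=
  if t <= 0 then z.2
  else `[< exists n, jump_time w n < t <= jump_time w n.+1 /\
             pi (history_of w n) (t - jump_time w n) >].

(* The epochs [t] with a(t+) <> a(t); there, a(t+) = ~~ a(t).  If the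
   left-continuous function a has no right limit at some point, then infinitely
   many such epochs accumulate at it. *)
Definition switch_epochs (w : path R) : set R :=
  [set t | 0 <= t /\ \forall s \near t^'+, action w s = ~~ action w t].

Definition discounted_cost (alpha : R) (w : path R) : \bar R :=
  (\int[leb]_(t in `[0%R, +oo[)
     (expR (- alpha * t) *
      (holding_cost M * (customers w t)%:R +
       running_cost M * (action w t)%:R))%:E +
   \esum_(t in switch_epochs w)
     (expR (- alpha * t) * switch_cost M (~~ action w t))%:E)%E.

Definition policy_value (alpha : R) : \bar R :=
  if `[< exists t : R, ~ {ae path_law, forall w,
           finite_set (switch_epochs w `&` `[0, t])} >]
  then +oo%E
  else (\int[path_law]_w discounted_cost alpha w)%E.

End controlled_process.

Section optimality.
Context {R : realType} (M : queue R) (alpha : R).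

Definition value (z : state) : \bar R :=
  ereal_inf [set policy_value M pi z alpha | pi in policy].

Definition discount_optimal (pi : decision_rule R) : Prop :=
  policy pi /\ forall z, policy_value M pi z alpha = value z.

(* [value] with the convention that it is zero at [-1] customers. *)
Definition value_int (j : int) (d : bool) : \bar R :=
  if j is Posz n then value (n, d) else 0%E.

Definition stage_cost (z : state) (a : bool) : R :=
  `|a%:R - z.2%:R| * switch_cost M a +
  (holding_cost M * z.1%:R + a%:R * running_cost M) /
    (alpha + total_rate M z.1 a).

Definition bellman (z : state) (a : bool) : \bar R :=
  let i := z.1 in let q := total_rate M i a in
  ((stage_cost z a)%:E +
   (rate M (i%:Z - 1) i a / (alpha + q))%:E * value_int (i%:Z - 1) a +
   (rate M (i%:Z + 1) i a / (alpha + q))%:E * value_int (i%:Z + 1) a)%E.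

End optimality.

(* Main.v *)
From HB Require Import structures.
From mathcomp Require Import all_boot all_order all_algebra.
From mathcomp Require Import all_classical all_reals all_analysis measurable_realfun.
From mathcomp Require Import ring lra zify.
Require Import Defs.
Import Order.TTheory GRing.Theory Num.Theory.
Import numFieldNormedType.Exports HBNNSimple.

(** Let W be the least nonnegative function on states with T W <= W, where T is
    the Bellman operator: T v is the minimum over the two actions of a stage cost
    plus a discounted mean of v.  By monotonicity W = T W (Knaster-Tarski), and
    the cost of never switching off, a fixed point of the operator restricted to
    the action on, bounds W; this is the bound (i).  Everything reduces to the
    fact that the value function is W ([value_least_supersolution]).

    Lower bound ([policy_value_ge]).  The fixed point equation says two things:
    W (i, a) exceeds W (i, 1 - a) by at most the cost of switching
    ([least_supersolution_switch]), and W (i, a) is at most the discounted cost of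
    keeping a until the next jump, including the value reached there
    ([least_supersolution_rate]).  A general policy may switch in the middle of a
    sojourn.  On a path, while the number i of customers is constant,
    exp (- alpha t) W (i, a(t)) is a potential whose downward jumps are paid by
    the switching costs and which otherwise decreases at rate alpha
    exp (- alpha t) W (i, a(t)) ([switching_bound]).  Summed over the first N
    sojourns and averaged, this bounds W z by the expected cost plus the mean of
    exp (- alpha t_N) W at the N-th jump time t_N ([verification_bound]).  Every
    term is computed under the kernel of the next jump: for a running reward of
    rate rho, the mean over a sojourn is the integral of rho weighted by discount
    and survival probability ([jump_mean_running]), and the weight is normalised
    so that the rate (alpha + q) k yields k ([dwell_mean_balanced]).

    The remainder vanishes because the square of a shifted number of customers is
    a Lyapunov function: its discounted mean decreases from jump to jump by a
    multiple of the discounted mean of the level itself ([jump_value_drift]), and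
    W grows at most linearly.  The same fact excludes explosion
    ([ae_nonexplosive]).

    Upper bound.  A stationary policy switches only at jump epochs, so its value
    is the sum of the expected discounted stage costs
    ([stationary_policy_value]).  This sum telescopes against any v with
    T_phi v <= v or v <= T_phi v ([stationary_value_le], [stationary_value_ge]);
    with v = W this gives an optimal stationary policy, and the equivalence
    between optimality and W = T_phi W.

    The expectations refer to the path law, whose existence comes from the
    Ionescu-Tulcea theorem ([ionescu_tulcea]), proved here for kernels that depend
    on the past.  The next jump has a hazard rate that is merely bounded and
    measurable; that its density integrates to 1 - survival is
    [integral_density_fin]. *)

Set Implicit Arguments.
Unset Strict Implicit.
Unset Printing Implicit Defensive.

Local Open Scope classical_set_scope.
Local Open Scope ring_scope.

Local Open Scope ereal_scope.

(** * Positive functionals and lower integrals *)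

Section functional.
Context d (Y : measurableType d) (R : realType).

Definition nnmeas (f : Y -> \bar R) : Prop :=
  (forall x, 0 <= f x) /\ measurable_fun [set: Y] f.

Lemma nnmeas_indic (A : set Y) : measurable A -> nnmeas (EFin \o \1_A).
Proof.
by move=> mA; split=> [x|]; [rewrite lee_fin|exact/measurable_EFinP].
Qed.

Lemma nnmeasD (f g : Y -> \bar R) : nnmeas f -> nnmeas g ->
  nnmeas (fun x => f x + g x).
Proof.
by move=> [f0 mf] [g0 mg]; split=> [x|]; [rewrite adde_ge0|exact: emeasurable_funD].
Qed.

Lemma nnmeasZ (r : R) (f : Y -> \bar R) : (0 <= r)%R -> nnmeas f ->
  nnmeas (fun x => r%:E * f x).
Proof.
move=> r0 [f0 mf]; split=> [x|]; first by rewrite mule_ge0// lee_fin.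
exact: measurable_funeM.
Qed.

(** The two sides agree on simple functions by linearity, and both commute with
    increasing limits. *)
Lemma functional_integral (mu : {measure set Y -> \bar R})
    (Psi : (Y -> \bar R) -> \bar R) :
  (forall f g, nnmeas f -> nnmeas g ->
     Psi (fun x => f x + g x) = Psi f + Psi g) ->
  (forall (r : R) f, (0 <= r)%R -> nnmeas f ->
     Psi (fun x => r%:E * f x) = r%:E * Psi f) ->
  (forall f_ : nat -> Y -> \bar R, (forall n, nnmeas (f_ n)) ->
     (forall x, nondecreasing_seq (f_ ^~ x)) ->
     Psi (fun x => limn (f_ ^~ x)) = limn (fun n => Psi (f_ n))) ->
  (forall A, measurable A -> Psi (EFin \o \1_A) = mu A) ->
  forall f, nnmeas f -> Psi f = \int[mu]_x f x.
Proof.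
move=> PD PZ Plim PI.
have PN (g : {nnsfun Y >-> R}) : Psi (EFin \o g) = \int[mu]_x (g x)%:E.
  rewrite integralT_nnsfun sintegralE fsbig_finite//=.
  have -> : EFin \o g = fun x => \sum_(y <- finmap.enum_fset (fset_set (range g)))
      (y%:E * (\1_(g @^-1` [set y]) x)%:E).
    by apply/funext => x /=; rewrite fimfunE fsbig_finite//= sumEFin.
  have : {in finmap.enum_fset (fset_set (range g)), forall y, (0 <= y)%R}.
    by move=> y; rewrite in_fset_set// inE => -[x _ <-].
  elim: (finmap.enum_fset _) => [|y s IH] s0.
    rewrite big_nil; under [X in Psi X]eq_fun do rewrite big_nil.
    have := PZ 0%R (EFin \o \1_set0) (lexx _) (nnmeas_indic measurable0).
    by under eq_fun do rewrite mul0e; rewrite mul0e.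
  under [X in Psi X]eq_fun do rewrite big_cons.
  have y0 : (0 <= y)%R by apply: s0; rewrite mem_head.
  have s0' : {in s, forall y, (0 <= y)%R}.
    by move=> z zs; apply: s0; rewrite inE zs orbT.
  have my z : measurable (g @^-1` [set z]) by [].
  rewrite big_cons -IH//.
  rewrite PD//.
  - by rewrite (PZ y (EFin \o \1_(g @^-1` [set y])))// ?PI//; exact: nnmeas_indic.
  - exact: (nnmeasZ y0 (nnmeas_indic (my y))).
  - split=> [x|].
      rewrite big_seq sume_ge0// => z zs.
      by rewrite mule_ge0// lee_fin// s0'.
    apply: emeasurable_sum => z.
    by apply: measurable_funeM; exact: (nnmeas_indic (my z)).2.
move=> f [f0 mf].
pose f_ := nnsfun_approx measurableT mf.
have -> : f = fun x => limn (fun n => (f_ n x)%:E).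
  apply/funext => x; apply/esym/cvg_lim => //.
  by apply: cvg_nnsfun_approx.
have nd x : nondecreasing_seq (fun n => (f_ n x)%:E).
  by move=> m n mn; rewrite lee_fin; exact/lefP/nd_nnsfun_approx.
rewrite (Plim (fun n x => (f_ n x)%:E))//.
  rewrite monotone_convergence//.
  - by congr (limn _); apply/funext => n; rewrite -PN.
  - by move=> n; exact/measurable_EFinP.
  - by move=> n x _; rewrite lee_fin.
by move=> n; split=> [x|]; [rewrite lee_fin|exact/measurable_EFinP].
Qed.

End functional.

(** The integral of a nonnegative function is the supremum of the integrals of the
    simple functions below it, so it is monotone on all functions.  The
    discounted cost of a path is handled in this way, without studying its
    measurability in the path. *)
Lemma le_integral_lower d (T : measurableType d) (R : realType)
    (mu : {measure set T -> \bar R}) (f g : T -> \bar R) :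
  (forall x, 0 <= f x) -> (forall x, f x <= g x) ->
  \int[mu]_x f x <= \int[mu]_x g x.
Proof.
move=> f0 fg; have g0 x : 0 <= g x by exact: le_trans (fg x).
rewrite !ge0_integralTE//; apply: le_ereal_sup => _ [h hf <-].
by exists h => // x; apply: le_trans (fg x).
Qed.

Lemma nondecreasing_le_lime (R : realType) (u : nat -> \bar R) n :
  nondecreasing_seq u -> u n <= limn u.
Proof.
move=> ndu; rewrite (cvg_lim _ (ereal_nondecreasing_cvgn ndu))//.
by apply: ereal_sup_ubound; exists n.
Qed.

Lemma indic_setU (T : Type) (R : nzRingType) (A B : set T) x : A `&` B = set0 ->
  \1_(A `|` B) x = (\1_A x + \1_B x)%R :> R.
Proof.
move=> AB0; rewrite !indicE in_setU.
have [xA|_] := boolP (x \in A); have [xB|_] := boolP (x \in B);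
  rewrite /= ?addr0 ?add0r//.
have : (A `&` B) x by split; [move: xA|move: xB]; rewrite inE.
by rewrite AB0.
Qed.

Section functional_measure.
Context d (Y : measurableType d) (R : realType).

(** The integral against a measure, presented by its properties on functions.
    These are stable under mixtures, sums and sections, so that a kernel written
    as an integral of point evaluations is a measure without further work. *)
Record positive_functional (Psi : (Y -> \bar R) -> \bar R) : Prop := {
  functional_ge0 : forall f, (forall x, 0 <= f x) -> 0 <= Psi f ;
  functional_le : forall f g, nnmeas f -> nnmeas g ->
    (forall x, f x <= g x) -> Psi f <= Psi g ;
  functionalD : forall f g, nnmeas f -> nnmeas g ->
    Psi (fun x => f x + g x) = Psi f + Psi g ;
  functionalZ : forall (r : R) f, (0 <= r)%R -> nnmeas f ->
    Psi (fun x => r%:E * f x) = r%:E * Psi f ;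
  functional_lim : forall f_ : nat -> Y -> \bar R, (forall n, nnmeas (f_ n)) ->
    (forall x, nondecreasing_seq (f_ ^~ x)) ->
    Psi (fun x => limn (f_ ^~ x)) = limn (fun n => Psi (f_ n)) }.

Variables (Psi : (Y -> \bar R) -> \bar R) (HPsi : positive_functional Psi).

Lemma functional0 : Psi (EFin \o \1_set0) = 0.
Proof.
have := functionalZ HPsi (lexx 0%R) (@nnmeas_indic _ Y R _ measurable0).
under [X in Psi X]eq_fun do rewrite mul0e.
rewrite mul0e => <-; congr Psi; apply/funext => x /=.
by rewrite indic0.
Qed.

(** The proof is an argument so that the measure structure can be inferred from
    the term. *)
Definition functional_measure (_ : positive_functional Psi) (A : set Y) : \bar R :=
  Psi (EFin \o \1_A).

Let functional_measure0 : functional_measure HPsi set0 = 0.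
Proof. exact: functional0. Qed.

Let functional_measure_ge0 A : 0 <= functional_measure HPsi A.
Proof. by apply: (functional_ge0 HPsi) => x; rewrite lee_fin. Qed.

Let functional_measure_sigma_additive : semi_sigma_additive (functional_measure HPsi).
Proof.
move=> F mF tF mUF.
pose s n (x : Y) : \bar R := \sum_(0 <= i < n) (\1_(F i) x)%:E.
have ms n : nnmeas (s n).
  split=> [x|]; first by apply: sume_ge0 => i _; rewrite lee_fin.
  by apply: emeasurable_sum => i; exact: (@nnmeas_indic _ Y R _ (mF i)).2.
have sE n : s n = EFin \o \1_(\big[setU/set0]_(i < n) F i).
  elim: n => [|n IH]; apply/funext => x; rewrite /s.
    by rewrite big_nil big_ord0 /= indic0.
  rewrite big_nat_recr//= -/(s n x) IH big_ord_recr /= indic_setU ?EFinD//.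
  rewrite -bigcup_mkord; apply/seteqP; split => // w [[i /= ilt Ai] An].
  have /trivIsetP/(_ i n Logic.I Logic.I) := tF.
  by rewrite (ltn_eqF ilt) => /(_ isT) AA; have : (F i `&` F n) w by []; rewrite AA.
have nds x : nondecreasing_seq (s ^~ x).
  by apply/nondecreasing_seqP => n; rewrite /s big_nat_recr//= leeDl// lee_fin.
have Ps n : Psi (s n) = \sum_(0 <= i < n) functional_measure HPsi (F i).
  elim: n => [|n IH].
    rewrite sE big_ord0 big_nil; exact: functional0.
  rewrite big_nat_recr//= -IH -(functionalD HPsi)//; last exact: nnmeas_indic.
  by congr Psi; apply/funext => x; rewrite /s big_nat_recr.
rewrite -(_ : (fun n => Psi (s n)) = (fun n => _))//; last by apply/funext => n; rewrite Ps.
have -> : functional_measure HPsi (\bigcup_n F n) = limn (fun n => Psi (s n)).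
  rewrite -(functional_lim HPsi)//; congr Psi; apply/funext => x /=.
  apply/esym/cvg_lim => //; rewrite indicE.
  have [/set_mem [m _ Fm]|] := boolP (x \in _).
    apply: cvg_near_cst; exists m.+1 => // n /= mn.
    rewrite sE /= indicE mem_set// -bigcup_mkord; by exists m.
  move=> /negP nx; apply: cvg_near_cst; apply: nearW => n.
  rewrite sE /= indicE memNset// -bigcup_mkord => -[i _ Fi]; apply: nx.
  by rewrite inE; exists i.
apply: ereal_nondecreasing_is_cvgn => m n mn.
by apply: (functional_le HPsi) => // x; exact: nds.
Qed.

HB.instance Definition _ := isMeasure.Build _ _ _ (functional_measure HPsi)
  functional_measure0 functional_measure_ge0 functional_measure_sigma_additive.

Lemma integral_functional_measure f : nnmeas f ->
  Psi f = \int[functional_measure HPsi]_x f x.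
Proof.
apply: functional_integral => //.
- exact: functionalD HPsi.
- exact: functionalZ HPsi.
- exact: functional_lim HPsi.
Qed.

End functional_measure.

Section functional_closure.
Context d (Y : measurableType d) (R : realType).

Lemma nnmeas_lim (f_ : nat -> Y -> \bar R) : (forall j, nnmeas (f_ j)) ->
  (forall x, nondecreasing_seq (f_ ^~ x)) -> nnmeas (fun x => limn (f_ ^~ x)).
Proof.
move=> mf ndf; split=> [x|].
  apply: lime_ge; first exact: ereal_nondecreasing_is_cvgn.
  by apply: nearW => j; exact: (mf j).1.
apply: (emeasurable_fun_cvg f_) => [j|x _]; first exact: (mf j).2.
exact: ereal_nondecreasing_is_cvgn.
Qed.

Lemma positive_functional_integral d' (S : measurableType d')
    (mu : {measure set S -> \bar R}) (D : set S)
    (Phi : S -> (Y -> \bar R) -> \bar R) : measurable D ->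
  (forall s, positive_functional (Phi s)) ->
  (forall f, nnmeas f -> measurable_fun [set: S] (Phi ^~ f)) ->
  positive_functional (fun f => \int[mu]_(s in D) Phi s f).
Proof.
move=> mD pPhi mPhi.
have P0 s f : nnmeas f -> 0 <= Phi s f.
  by move=> [f0 _]; apply: (functional_ge0 (pPhi s)).
have mP f : nnmeas f -> measurable_fun D (Phi ^~ f).
  by move=> /mPhi; exact: measurable_funTS.
split.
- by move=> f f0; apply: integral_ge0 => s _; exact: (functional_ge0 (pPhi s) f0).
- move=> f g nf ng fg; apply: ge0_le_integral => //.
  + by move=> s _; exact: P0.
  + exact: mP.
  + exact: mP.
  + by move=> s _; exact: (functional_le (pPhi s) nf ng fg).
- move=> f g nf ng; rewrite -ge0_integralD//.
  + by apply: eq_integral => s _; exact: (functionalD (pPhi s) nf ng).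
  + by move=> s _; exact: P0.
  + exact: mP.
  + by move=> s _; exact: P0.
  + exact: mP.
- move=> r f r0 nf; rewrite -ge0_integralZl_EFin//.
  + by apply: eq_integral => s _; exact: (functionalZ (pPhi s) r0 nf).
  + by move=> s _; exact: P0.
  + exact: mP.
- move=> f_ nf ndf; rewrite -monotone_convergence//.
  + by apply: eq_integral => s _; exact: (functional_lim (pPhi s) nf ndf).
  + by move=> n; exact: mP.
  + by move=> n s _; exact: P0.
  + move=> s _ m n mn; apply: (functional_le (pPhi s)) => // x; exact: ndf.
Qed.

Lemma positive_functional_eval (r : R) (y : Y) : (0 <= r)%R ->
  positive_functional (fun f : Y -> \bar R => r%:E * f y).
Proof.
move=> r0; split.
- by move=> f f0; rewrite mule_ge0// lee_fin.
- by move=> f g _ _ fg; rewrite lee_wpmul2l// lee_fin.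
- by move=> f g [f0 _] [g0 _]; rewrite ge0_muleDr.
- by move=> s f s0 nf; rewrite muleCA.
- move=> f_ nf ndf; rewrite limeMl//; exact: ereal_nondecreasing_is_cvgn.
Qed.

Lemma positive_functionalD (Psi Phi : (Y -> \bar R) -> \bar R) :
  positive_functional Psi -> positive_functional Phi ->
  positive_functional (fun f => Psi f + Phi f).
Proof.
move=> pP pF; split.
- by move=> f f0; rewrite adde_ge0// ?(functional_ge0 pP)// (functional_ge0 pF).
- by move=> f g nf ng fg; rewrite leeD// ?(functional_le pP)// (functional_le pF).
- by move=> f g nf ng; rewrite (functionalD pP)// (functionalD pF)// addeACA.
- move=> r f r0 nf; rewrite (functionalZ pP)// (functionalZ pF)// ge0_muleDr//.
    exact: (functional_ge0 pP nf.1).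
  exact: (functional_ge0 pF nf.1).
- move=> f_ nf ndf; rewrite (functional_lim pP)// (functional_lim pF)//.
  have nd (Q : (Y -> \bar R) -> \bar R) : positive_functional Q ->
      nondecreasing_seq (fun n => Q (f_ n)).
    by move=> pQ m n mn; apply: (functional_le pQ) => // x; exact: ndf.
  rewrite limeD//; try exact/ereal_nondecreasing_is_cvgn/nd.
  apply: ge0_adde_def; rewrite inE; apply: lime_ge;
    try exact/ereal_nondecreasing_is_cvgn/nd.
    by apply: nearW => n; exact: (functional_ge0 pP (nf n).1).
  by apply: nearW => n; exact: (functional_ge0 pF (nf n).1).
Qed.

Lemma positive_functional_section d' (S : measurableType d') (s : S)
    (Psi : (Y -> \bar R) -> \bar R) : positive_functional Psi ->
  positive_functional (fun f : S * Y -> \bar R => Psi (fun y => f (s, y))).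
Proof.
move=> pP.
have sec (f : S * Y -> \bar R) : nnmeas f -> nnmeas (fun y => f (s, y)).
  by move=> [f0 mf]; split => //; exact: measurableT_comp mf (pair1_measurable s).
split.
- by move=> f f0; exact: (functional_ge0 pP (fun y => f0 (s, y))).
- by move=> f g /sec nf /sec ng fg; exact: (functional_le pP nf ng (fun y => fg (s, y))).
- by move=> f g /sec nf /sec ng; exact: (functionalD pP nf ng).
- by move=> r f r0 /sec nf; exact: (functionalZ pP r0 nf).
- move=> f_ nf ndf; apply: (functional_lim pP (f_ := fun n y => f_ n (s, y))) => // n.
  exact: sec.
Qed.

End functional_closure.

(** The positive part of g - h, set to 0 on the exceptional null set, is measurable
    and lies below f; this transfers the inequality to f, which is arbitrary. *)
Lemma le_lower_integralD d (T : measurableType d) (R : realType)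
    (mu : {measure set T -> \bar R}) (f g h : T -> \bar R) :
  (forall x, 0 <= f x) -> nnmeas g -> nnmeas h ->
  {ae mu, forall x, g x <= f x + h x} ->
  \int[mu]_x g x <= \int[mu]_x f x + \int[mu]_x h x.
Proof.
move=> f0 [g0 mg] [h0 mh] [N [mN N0 gfN]].
pose k := (fun x => maxe (g x - h x) 0) \_ (~` N).
have k0 x : 0 <= k x by rewrite /k patchE; case: ifP => // _; rewrite le_max lexx orbT.
have mk : measurable_fun [set: T] k.
  apply: (measurable_restrictT _ _).1; first exact: measurableC.
  apply: measurable_funTS; apply: measurable_maxe; last exact: measurable_cst.
  exact: emeasurable_funB.
have kf x : k x <= f x.
  rewrite /k patchE; case: ifPn => // /set_mem nNx.
  have gf : g x <= f x + h x.
    by apply: contrapT => gf; apply: nNx; exact: gfN.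
  rewrite ge_max f0 andbT; move: gf (h0 x).
  case: (h x) => [r| |] // gf _; first by rewrite leeBlDr.
  by rewrite addeNy leNye.
apply: (@le_trans _ _ (\int[mu]_x (k x + h x))); last first.
  rewrite ge0_integralD//; apply: leeD2r; exact: le_integral_lower.
apply: ae_ge0_le_integral => //.
- by move=> x _; rewrite adde_ge0.
- exact: emeasurable_funD.
exists N; split => // x /= gk; apply: contrapT => nNx; apply: gk => _.
rewrite /k patchE mem_set//; move: (h0 x).
case: (h x) => [r| |] // _; last by rewrite addey ?leey// -ltNye; apply: lt_le_trans (ltNyr 0%R) _; rewrite le_max lexx orbT.
by rewrite -leeBlDr// le_max lexx.
Qed.

(** From above, f is bounded by the function that equals g off the exceptional
    set and +oo on it, which is measurable with the same integral as g. *)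
Lemma ge0_ae_integral_eq d (T : measurableType d) (R : realType)
    (mu : {measure set T -> \bar R}) (f g : T -> \bar R) :
  (forall x, 0 <= f x) -> nnmeas g ->
  {ae mu, forall x, f x = g x} -> \int[mu]_x f x = \int[mu]_x g x.
Proof.
move=> f0 [g0 mg] fg; apply/eqP; rewrite eq_le; apply/andP; split; last first.
  have n0 : @nnmeas _ T R (fun _ => 0) by split => //; exact: measurable_cst.
  have := @le_lower_integralD _ T R mu f g _ f0 (conj g0 mg) n0.
  rewrite integral0 adde0; apply.
  by apply: filterS fg => x ->; rewrite adde0.
have [N [mN N0 fgN]] := fg.
pose u : T -> \bar R := cst +oo \_ N.
have u0 x : 0 <= u x by rewrite /u patchE; case: ifP => // _; rewrite leey.
have mu' : measurable_fun [set: T] u.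
  by apply: (measurable_restrictT _ _).1 => //; exact: measurable_cst.
have mgu : measurable_fun [set: T] (fun x => g x + u x) by exact: emeasurable_funD.
apply: (@le_trans _ _ (\int[mu]_x (g x + u x))).
  apply: le_integral_lower => // x; rewrite /u patchE; case: ifPn => [_|/negP xN].
    by rewrite addey ?leey// -ltNye; exact: lt_le_trans (ltNyr 0%R) (g0 x).
  by have [->|h] := pselect (f x = g x); [rewrite adde0|case: xN; apply/mem_set/fgN].
rewrite (@ge0_ae_eq_integral _ _ _ mu setT (fun x => g x + u x) g)//.
  by move=> x _; rewrite adde_ge0.
exists N; split => // x nx; apply: contrapT => xN; apply: nx => _.
by rewrite /u patchE memNset// adde0.
Qed.

(** * Iterated kernels on a sequence space *)

Section sequence_space.
Context d (X : measurableType d).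

Definition coordinate_sets : set_system (nat -> X) :=
  [set C | exists n (B : set X), measurable B /\ C = [set w | B (w n)]].

Local Notation seqT := (g_sigma_algebraType coordinate_sets).

Lemma measurable_coordinate n : measurable_fun [set: seqT] (fun w : seqT => w n).
Proof.
by move=> _ B mB; rewrite setTI; apply: sub_sigma_algebra; exists n, B.
Qed.

Lemma measurable_seqP d' (S : measurableType d') (g : S -> seqT) :
  (forall n, measurable_fun [set: S] (fun s => g s n)) ->
  measurable_fun [set: S] g.
Proof.
move=> mg.
apply: (@measurability _ _ S seqT setT g coordinate_sets) => //.
by move=> _ [C [n [B [mB ->]]] <-]; exact: mg.
Qed.

Definition upd (w : seqT) n (x : X) : seqT := fun k => if k == n then x else w k.

Lemma measurable_upd n :
  measurable_fun [set: seqT * X] (fun p : seqT * X => upd p.1 n p.2).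
Proof.
apply: measurable_seqP => k; rewrite /upd; case: eqP => _.
  exact: measurable_snd.
apply: (measurableT_comp (measurable_coordinate k)); exact: measurable_fst.
Qed.

Definition agree n (w w' : seqT) := forall k, (k < n)%N -> w k = w' k.

Lemma agreeS n m w w' : (n <= m)%N -> agree m w w' -> agree n w w'.
Proof. by move=> nm ww' k kn; rewrite ww'// (leq_trans kn). Qed.

Lemma agree_upd n w w' x : agree n w w' -> agree n.+1 (upd w n x) (upd w' n x).
Proof.
move=> ww' k; rewrite ltnS leq_eqVlt /upd; case: eqP => //= _; exact: ww'.
Qed.

Lemma upd_agree n w x : agree n w (upd w n x).
Proof. by move=> k kn; rewrite /upd ltn_eqF. Qed.

Definition determined {Y} n (F : seqT -> Y) :=
  forall w w', agree n w w' -> F w = F w'.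

Lemma determinedS {Y} n m (F : seqT -> Y) : (n <= m)%N ->
  determined n F -> determined m F.
Proof. by move=> nm dF w w' /(agreeS nm); exact: dF. Qed.

End sequence_space.

Arguments coordinate_sets {d} X.
Notation seq_space X := (g_sigma_algebraType (coordinate_sets X)).

Section expectation.
Context d (X : measurableType d) (R : realType).
Local Notation seqT := (seq_space X).
Variable k : nat -> R.-pker seqT ~> X.
Implicit Types (F G : seqT -> \bar R).
Hypothesis knon : forall n w w', agree n w w' ->
  forall U, measurable U -> k n w U = k n w' U.

Definition step n (F : seqT -> \bar R) (w : seqT) : \bar R :=
  \int[k n w]_x F (upd w n x).

(** The coordinates n, ..., n + m - 1 are drawn one after the other from the
    kernels; the earlier ones are those of w. *)
Fixpoint expect n m (F : seqT -> \bar R) : seqT -> \bar R :=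
  if m is m'.+1 then step n (expect n.+1 m' F) else F.

Lemma measurable_updr (w : seqT) n :
  measurable_fun [set: X] (fun x : X => upd w n x).
Proof.
exact: (measurableT_comp (@measurable_upd _ X n) (pair1_measurable w)).
Qed.

Lemma nnmeas_upd F n w : nnmeas F -> nnmeas (fun x => F (upd w n x)).
Proof.
move=> [F0 mF]; split => //.
exact: measurableT_comp mF (measurable_updr w n).
Qed.

Lemma nnmeas_step n F : nnmeas F -> nnmeas (step n F).
Proof.
move=> [F0 mF]; split=> [w|]; first exact: integral_ge0.
apply: (@measurable_fun_integral_finite_kernel _ _ _ _ _
  (fun p : seqT * X => F (upd p.1 n p.2)) (k n)) => //.
apply: measurableT_comp => //; exact: measurable_upd.
Qed.

Lemma step_ext n F G w : F =1 G -> step n F w = step n G w.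
Proof. by move=> /funext ->. Qed.

Lemma step_determined n F : determined n.+1 F -> determined n (step n F).
Proof.
move=> dF w w' ww'; rewrite /step.
rewrite (eq_measure_integral (k n w')); last by move=> A mA _; exact: knon.
by apply: eq_integral => x _; apply: dF; exact: agree_upd.
Qed.

Lemma step_id n F : determined n F -> nnmeas F -> step n F = F.
Proof.
move=> dF [F0 mF]; apply/funext => w; rewrite /step.
transitivity (\int[k n w]_x (cst (F w) x)).
  by apply: eq_integral => x _; rewrite /cst; apply/esym/dF/upd_agree.
by rewrite integral_cst//= prob_kernel mule1.
Qed.

Lemma stepD n F G w : nnmeas F -> nnmeas G ->
  step n (fun w => F w + G w) w = step n F w + step n G w.
Proof.
move=> /(nnmeas_upd n w)[F0 mF] /(nnmeas_upd n w)[G0 mG].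
by rewrite /step ge0_integralD.
Qed.

Lemma stepZ n (r : R) F w : (0 <= r)%R -> nnmeas F ->
  step n (fun w => r%:E * F w) w = r%:E * step n F w.
Proof.
move=> r0 /(nnmeas_upd n w)[F0 mF].
by rewrite /step ge0_integralZl_EFin.
Qed.

Lemma le_step n F G w : nnmeas F -> nnmeas G -> (forall w, F w <= G w) ->
  step n F w <= step n G w.
Proof.
move=> /(nnmeas_upd n w)[F0 mF] /(nnmeas_upd n w)[G0 mG] FG.
by rewrite /step ge0_le_integral.
Qed.

Lemma step_lim n (F_ : nat -> seqT -> \bar R) w : (forall j, nnmeas (F_ j)) ->
  (forall w, nondecreasing_seq (F_ ^~ w)) ->
  step n (fun w => limn (F_ ^~ w)) w = limn (fun j => step n (F_ j) w).
Proof.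
move=> mF ndF; rewrite /step -monotone_convergence//.
- by move=> j; exact: (nnmeas_upd n w (mF j)).2.
- by move=> j x _; exact: (mF j).1.
Qed.

Lemma nnmeas_expect n m F : nnmeas F -> nnmeas (expect n m F).
Proof. by move=> mF; elim: m n => //= m IH n; exact: nnmeas_step. Qed.

Lemma expect_id n m F : determined n F -> nnmeas F -> expect n m F = F.
Proof.
move=> dF mF; elim: m n dF => //= m IH n dF; rewrite IH ?step_id//.
exact: determinedS dF.
Qed.

Lemma expect_add n m p F : expect n (m + p) F = expect n m (expect (n + m) p F).
Proof. by elim: m n => [|m IH] n; rewrite ?addn0//= IH addnS -addSn. Qed.

Lemma expectD n m F G w : nnmeas F -> nnmeas G ->
  expect n m (fun w => F w + G w) w = expect n m F w + expect n m G w.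
Proof.
move=> mF mG; elim: m n w => //= m IH n w.
rewrite -stepD; [|exact: nnmeas_expect..].
by apply: step_ext => v; exact: IH.
Qed.

Lemma expectZ n m (r : R) F w : (0 <= r)%R -> nnmeas F ->
  expect n m (fun w => r%:E * F w) w = r%:E * expect n m F w.
Proof.
move=> r0 mF; elim: m n w => //= m IH n w.
rewrite -stepZ//; last exact: nnmeas_expect.
by apply: step_ext => v; exact: IH.
Qed.

Lemma le_expect n m F G w : nnmeas F -> nnmeas G -> (forall w, F w <= G w) ->
  expect n m F w <= expect n m G w.
Proof.
move=> mF mG FG; elim: m n w => //= m IH n w.
by apply: le_step => //; exact: nnmeas_expect.
Qed.

Lemma expect_lim n m (F_ : nat -> seqT -> \bar R) w : (forall j, nnmeas (F_ j)) ->
  (forall w, nondecreasing_seq (F_ ^~ w)) ->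
  expect n m (fun w => limn (F_ ^~ w)) w = limn (fun j => expect n m (F_ j) w).
Proof.
move=> mF ndF; elim: m n w => //= m IH n w.
rewrite -step_lim; first by apply: step_ext => v; exact: IH.
- by move=> j; exact: nnmeas_expect.
- by move=> v i j ij; apply: le_expect => // u; exact: ndF.
Qed.

End expectation.

(** * Cylinders and the continuity of their probability *)

Section cylinder_content.
Context d (X : measurableType d) (R : realType).
Local Notation seqT := (seq_space X).
Variable k : nat -> R.-pker seqT ~> X.
Implicit Types (F G : seqT -> \bar R) (C D : set seqT).
Hypothesis knon : forall n w w', agree n w w' ->
  forall U, measurable U -> k n w U = k n w' U.

(** The sequence in m is constant as soon as C is determined by n + m
    coordinates; the limit spares the choice of such an m. *)
Definition cond_prob n C (w : seqT) : \bar R :=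
  limn (fun m => expect k n m (EFin \o \1_C) w).

Lemma determined_indic n C : determined n C ->
  determined n (EFin \o \1_C : seqT -> \bar R).
Proof.
move=> dC w w' ww' /=; rewrite !indicE; congr (_%:R%:E).
by rewrite -!topredE /= /mem /= /in_set /= (dC w w').
Qed.

Lemma cond_probE n m C : measurable C -> determined (n + m)%N C ->
  cond_prob n C = expect k n m (EFin \o \1_C).
Proof.
move=> mC /determined_indic dC; apply/funext => w; apply: lim_near_cst => //.
near=> j; have mj : (m <= j)%N by near: j; exists m.
rewrite -(subnKC mj) expect_add (@expect_id _ _ _ _ (n + m)) //.
exact: nnmeas_indic.
Unshelve. all: by end_near. Qed.

Lemma cond_prob_step n p C : measurable C -> determined p C ->
  cond_prob n C = step k n (cond_prob n.+1 C).
Proof.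
move=> mC dC; rewrite (@cond_probE n p.+1)//=; last first.
  by apply: determinedS dC; rewrite addnS; apply: leq_trans (leqnSn _); exact: leq_addl.
by rewrite (@cond_probE n.+1 p)//; apply: determinedS dC; exact: leq_addl.
Qed.

Lemma cond_prob_id n C : measurable C -> determined n C ->
  cond_prob n C = EFin \o \1_C.
Proof. by move=> mC dC; rewrite (@cond_probE n 0)// addn0. Qed.

Lemma nnmeas_cond_prob n p C : measurable C -> determined p C ->
  nnmeas (cond_prob n C).
Proof.
move=> mC dC; rewrite (@cond_probE n p)//; last first.
  by apply: determinedS dC; exact: leq_addl.
by apply: nnmeas_expect; exact: nnmeas_indic.
Qed.

Definition cylinder C := measurable C /\ exists n, determined n C.

Lemma cylinder0 : cylinder set0.
Proof. by split => //; exists 0%N. Qed.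

Lemma cylinderC C : cylinder C -> cylinder (~` C).
Proof.
move=> [mC [n dC]]; split; first exact: measurableC.
by exists n => w w' ww'; rewrite /setC /= (dC w w').
Qed.

Lemma cylinderU C D : cylinder C -> cylinder D -> cylinder (C `|` D).
Proof.
move=> [mC [n dC]] [mD [m dD]]; split; first exact: measurableU.
exists (maxn n m) => w w' ww'; rewrite /setU /mkset.
by rewrite (dC w w') ?(dD w w')//; apply: agreeS ww'; rewrite ?leq_maxl ?leq_maxr.
Qed.

Lemma cond_probU n C D : cylinder C -> cylinder D -> C `&` D = set0 ->
  forall w, cond_prob n (C `|` D) w = cond_prob n C w + cond_prob n D w.
Proof.
move=> cC cD CD0 w; have [mU [p dU]] := cylinderU cC cD.
move: cC cD => [mC [n1 dC]] [mD [m1 dD]].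
have le1 q : (q <= p + n1 + m1)%N -> (q <= n + (p + n1 + m1))%N.
  by move=> h; rewrite (leq_trans h)// leq_addl.
rewrite !(@cond_probE n (p + n1 + m1)%N)//; first last.
- by apply: determinedS dU; apply: le1; rewrite -addnA leq_addr.
- by apply: determinedS dC; apply: le1; rewrite addnAC leq_addl.
- by apply: determinedS dD; apply: le1; rewrite leq_addl.
rewrite -expectD; [|exact: nnmeas_indic..].
by congr (expect _ _ _ _ _); apply/funext => v /=; rewrite indic_setU// EFinD.
Qed.

Lemma cond_probT n w : cond_prob n [set: seqT] w = 1.
Proof. by rewrite (@cond_probE n 0)//= indicT. Qed.

Lemma le_cond_prob n C D w : cylinder C -> cylinder D -> C `<=` D ->
  cond_prob n C w <= cond_prob n D w.
Proof.
move=> cC cD CD; have cDC : cylinder (D `\` C).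
  by rewrite setDE -[X in cylinder X]setCK setCI setCK; apply: cylinderC; apply: cylinderU => //; exact: cylinderC.
rewrite -(setDUK CD) cond_probU//; last exact: setDIK.
have [mDC [p dDC]] := cDC.
by rewrite leeDl// (nnmeas_cond_prob n mDC dDC).1.
Qed.

Lemma cond_prob_le1 n C w : cylinder C -> cond_prob n C w <= 1.
Proof.
move=> cC; rewrite -(cond_probT n w); apply: le_cond_prob => //.
by split => //; exists 0%N.
Qed.

Section continuity.
Variable D : nat -> set seqT.
Hypotheses (cD : forall j, cylinder (D j)) (ndD : forall i j, (i <= j)%N -> D i `<=` D j).
Hypothesis DT : \bigcup_j D j = [set: seqT].

Let G n w := limn (fun j => cond_prob n (D j) w).

Let ndG n w : nondecreasing_seq (fun j => cond_prob n (D j) w).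
Proof. by move=> i j ij; apply: le_cond_prob => //; exact: ndD. Qed.

Let mcp n j : nnmeas (cond_prob n (D j)).
Proof. by have [mD [p dD]] := cD j; exact: nnmeas_cond_prob dD. Qed.

Let G_step n w : G n w = step k n (G n.+1) w.
Proof.
rewrite /G step_lim//; congr (limn _); apply/funext => j.
by have [mD [p dD]] := cD j; rewrite -(cond_prob_step _ _ dD).
Qed.

Let mG n : nnmeas (G n).
Proof. exact: nnmeas_lim. Qed.

(** As the mean of G n.+1 is G n < 1, some continuation keeps it below 1. *)
Let G_continue n w : G n w < 1 -> exists x, G n.+1 (upd w n x) < 1.
Proof.
move=> Gw; apply: contrapT => /forallNP h.
move: Gw; apply/negP; rewrite -leNgt G_step /step.
have -> : 1 = \int[k n w]_x (cst 1 x) by rewrite integral_cst//= prob_kernel mule1.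
have [G0 mG'] := nnmeas_upd n w (mG n.+1).
by apply: ge0_le_integral => // x _; rewrite leNgt; apply/negP/h.
Qed.

(** Otherwise [G_continue] builds, coordinate after coordinate, a sequence along
    which the limit of conditional probabilities stays below 1.  This sequence
    belongs to some D j, whose conditional probability is 1 from the coordinate
    that determines D j onwards. *)
Lemma cond_prob_continuity w : limn (fun j => cond_prob 0 (D j) w) = 1.
Proof.
apply/eqP; rewrite eq_le; apply/andP; split.
  apply: lime_le; first exact: ereal_nondecreasing_is_cvgn.
  by apply: nearW => j; exact: cond_prob_le1.
rewrite leNgt; apply/negP => G1.
pose nxt n v := xget point [set x | G n.+1 (upd v n x) < 1].
pose W := fix W n : seqT := if n is n'.+1 then upd (W n') n' (nxt n' (W n')) else w.
have GW n : G n (W n) < 1.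
  elim: n => [//|n /G_continue[x Gx]] /=.
  by rewrite /nxt; case: xgetP => [y -> //|/(_ x)].
pose winf : seqT := fun j => W j.+1 j.
have WE n i : (i < n)%N -> W n i = winf i.
  elim: n => // n IH; rewrite ltnS leq_eqVlt => /orP[/eqP ->//|ni].
  by rewrite /= {1}/upd ltn_eqF// IH.
have [j _ Dj] : (\bigcup_j D j) winf by rewrite DT.
have [mD [p dD]] := cD j.
have := GW p; apply/negP; rewrite -leNgt.
apply: (@le_trans _ _ (cond_prob p (D j) (W p))).
  rewrite cond_prob_id//= indicE mem_set//.
  by rewrite (dD _ winf)// => i; exact: WE.
exact: (@nondecreasing_le_lime _ (fun j => cond_prob p (D j) (W p))).
Qed.

End continuity.
End cylinder_content.

(** * The Ionescu-Tulcea theorem *)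

Definition cylinder_display : measure_display -> measure_display.
Proof. exact. Qed.

Section cylinder_algebra.
Context d (X : measurableType d).

(** A copy of the sequence space that carries the algebra of cylinders, as the
    original one carries the generated sigma-algebra. *)
Definition cylinder_space : Type := nat -> X.
HB.instance Definition _ := Pointed.on cylinder_space.

HB.instance Definition _ := @isAlgebraOfSets.Build (cylinder_display d)
  cylinder_space (@cylinder d X) (@cylinder0 d X) (@cylinderU d X) (@cylinderC d X).

Lemma cylinder_generates (C : set (seq_space X)) :
  measurable C -> <<s @cylinder d X >> C.
Proof.
apply: smallest_sub; first exact: smallest_sigma_algebra.
move=> _ [n [B [mB ->]]]; apply: sub_sigma_algebra; split.
  by apply: sub_sigma_algebra; exists n, B.
by exists n.+1 => w w' ww'; rewrite /mkset ww'.
Qed.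

End cylinder_algebra.

Section ionescu_tulcea.
Context d (X : measurableType d) (R : realType).
Local Notation seqT := (seq_space X).
Variable k : nat -> R.-pker seqT ~> X.
Hypothesis knon : forall n w w', agree n w w' ->
  forall U, measurable U -> k n w U = k n w' U.
Variable w0 : seqT.

Definition cylinder_content (C : set (cylinder_space X)) : \bar R :=
  if pselect (cylinder C) then cond_prob k 0 C w0 else 0.

Lemma cylinder_contentE C : cylinder C -> cylinder_content C = cond_prob k 0 C w0.
Proof. by rewrite /cylinder_content; case: pselect. Qed.

Let content0 : cylinder_content set0 = 0.
Proof.
rewrite cylinder_contentE; last exact: cylinder0.
have cT : cylinder [set: seqT] by split => //; exists 0%N.
have := @cond_probU _ X R k 0 set0 setT (cylinder0 X) cT (set0I _) w0.
rewrite set0U !cond_probT => h.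
by rewrite -[LHS](@addeK _ 1)// -h subee.
Qed.

Let content_ge0 C : 0 <= cylinder_content C.
Proof.
rewrite /cylinder_content; case: pselect => // -[mC [n dC]].
exact: (nnmeas_cond_prob k 0 mC dC).1.
Qed.

Lemma cylinder_bigU (A : nat -> set (seq_space X)) n :
  (forall i, cylinder (A i)) -> cylinder (\big[setU/set0]_(i < n) A i).
Proof.
move=> cA; elim: n => [|n IH]; first by rewrite big_ord0; exact: cylinder0.
by rewrite big_ord_recr; exact: cylinderU.
Qed.

Let contentU C D : cylinder C -> cylinder D -> C `&` D = set0 ->
  cylinder_content (C `|` D) = cylinder_content C + cylinder_content D.
Proof.
move=> cC cD CD; rewrite !cylinder_contentE//; last exact: cylinderU.
exact: cond_probU.
Qed.

(** The complement of the union, joined with the partial unions, increases to the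
    whole space, so its probability increases to 1. *)
Let content_sigma_additive : semi_sigma_additive cylinder_content.
Proof.
move=> A mA tA mUA.
pose C := \bigcup_n A n.
pose B n := ~` C `|` \big[setU/set0]_(i < n) A i.
have cB n : cylinder (B n).
  by apply: cylinderU; [exact: cylinderC|exact: cylinder_bigU].
have BT : \bigcup_j B j = [set: seqT].
  apply/seteqP; split => // w _.
  have [[n _ An]|nC] := pselect (C w); last by exists 0%N => //; left.
  exists n.+1 => //; right.
  by rewrite -bigcup_mkord; exists n => //=.
have ndB i j : (i <= j)%N -> B i `<=` B j.
  move=> ij w [|]; [by left|rewrite -bigcup_mkord => -[m /= mi Am]; right].
  by rewrite -bigcup_mkord; exists m => //=; exact: leq_trans ij.
have := cond_prob_continuity k cB ndB BT w0.
have BE n : cond_prob k 0 (B n) w0 =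
    cylinder_content (~` C) + \sum_(0 <= i < n) cylinder_content (A i).
  rewrite -cylinder_contentE// contentU//; first last.
  - rewrite -bigcup_mkord; apply/seteqP; split => // w [nC [i /= _ Ai]].
    by apply: nC; exists i.
  - exact: cylinder_bigU.
  - exact: cylinderC.
  congr (_ + _); rewrite big_mkord.
  elim: n => [|n IH]; first by rewrite !big_ord0.
  rewrite !big_ord_recr/= -IH; apply: contentU; [exact: cylinder_bigU|exact: mA|].
  rewrite -bigcup_mkord; apply/seteqP; split => // w [[i /= ilt Ai] An].
  have /trivIsetP/(_ i n Logic.I Logic.I) := tA.
  by rewrite (ltn_eqF ilt) => /(_ isT) AA; have : (A i `&` A n) w by []; rewrite AA.
under eq_fun do rewrite BE.
have cC := cylinderC mUA.
have fin : cylinder_content (~` C) \is a fin_num.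
  rewrite ge0_fin_numE// cylinder_contentE//.
  by apply: le_lt_trans (cond_prob_le1 k 0 w0 cC) _; rewrite ltry.
have cvS : cvgn (fun n => \sum_(0 <= i < n) cylinder_content (A i)).
  exact: is_cvg_nneseries.
rewrite limeD//; first last.
- by rewrite lim_cst// fin_num_adde_defr.
- exact: is_cvg_cst.
rewrite lim_cst// => S1.
have : cylinder_content (~` C) + cylinder_content C = 1.
  by rewrite -contentU// ?setUCl ?setICl// cylinder_contentE ?cond_probT//; split => //; exists 0%N.
move=> CC1; have -> : cylinder_content C =
    limn (fun n => \sum_(0 <= i < n) cylinder_content (A i)).
  by rewrite -[LHS](@addeK _ (cylinder_content (~` C)))// [X in X - _]addeC CC1 -S1 [X in X - _]addeC addeK.
exact: cvS.
Qed.

HB.instance Definition _ := isMeasure.Build _ _ _ cylinder_content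
  content0 content_ge0 content_sigma_additive.

Let ext := measure_extension cylinder_content.

(** The Caratheodory extension of the content, seen as a measure on the
    sigma-algebra generated by the coordinates. *)
Definition path_measure (C : set seqT) : \bar R := ext C.

Let path_measure0 : path_measure set0 = 0.
Proof. exact: measure0. Qed.

Let path_measure_ge0 C : 0 <= path_measure C.
Proof. exact: measure_ge0. Qed.

Let path_measure_sigma_additive : semi_sigma_additive path_measure.
Proof.
move=> F mF tF mUF; apply: (@measure_semi_sigma_additive _ _ _ ext) => //.
- by move=> i; apply: cylinder_generates; exact: mF.
- by apply: cylinder_generates; exact: mUF.
Qed.

HB.instance Definition _ := isMeasure.Build _ _ _ path_measure
  path_measure0 path_measure_ge0 path_measure_sigma_additive.

Lemma path_measure_cylinder C : cylinder C -> path_measure C = cond_prob k 0 C w0.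
Proof.
move=> cC; rewrite -cylinder_contentE//.
exact: (@measurable_mu_extE _ _ _ cylinder_content).
Qed.

Let path_measureT : path_measure [set: seqT] = 1.
Proof.
rewrite path_measure_cylinder ?cond_probT//.
by split => //; exists 0%N.
Qed.

HB.instance Definition _ := Measure_isProbability.Build _ _ _ path_measure path_measureT.

(** Both sides define measures on the values of F; these agree because the inverse
    images under F are cylinders. *)
Lemma integral_path_measure n F : nnmeas F -> determined n F ->
  \int[path_measure]_w F w = expect k 0 n F w0.
Proof.
move=> [F0 mF] dF; apply/esym.
pose mu := pushforward path_measure F.
have dh (h : \bar R -> \bar R) : determined n (h \o F).
  by move=> w w' ww' /=; rewrite (dF w w').
have mh (h : \bar R -> \bar R) : nnmeas h -> nnmeas (h \o F).
  by move=> [h0 mh]; split => [w|] /=; [exact: h0|exact: measurableT_comp].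
(* F is written h \o F with h nonnegative, a test function on \bar R *)
pose h (x : \bar R) := maxe x 0.
have hF : h \o F = F by apply/funext => w /=; rewrite /h max_l.
have hh : nnmeas h.
  split=> [x|]; first by rewrite /h le_max lexx orbT.
  exact: measurable_maxe.
have := @functional_integral _ _ R mu (fun g => expect k 0 n (g \o F) w0).
move=> /(_ mF _ _ _ _ h hh); rewrite hF => ->.
- rewrite (ge0_integral_pushforward (phi := F))//; first by rewrite preimage_setT hF.
  + exact: hh.2.
  + by move=> x _; exact: hh.1.
- by move=> f g /mh mf /mh mg; exact: expectD.
- by move=> r f r0 /mh mf; exact: expectZ.
- move=> f_ mf ndf; apply: (@expect_lim _ _ _ k 0 n (fun j => f_ j \o F)) => [j|w].
    exact: mh.
  exact: ndf.
- move=> A mA; transitivity (path_measure (F @^-1` A)) => //.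
  rewrite path_measure_cylinder.
    rewrite (@cond_probE _ _ _ _ 0 n)//.
      by rewrite -[X in measurable X]setTI; exact: mF.
    by move=> w w' ww' /=; rewrite /preimage /mkset (dF w w').
  split; first by rewrite -[X in measurable X]setTI; exact: mF.
  by exists n => w w' ww'; rewrite /preimage /mkset (dF w w').
Qed.

Theorem ionescu_tulcea : exists P : probability seqT R,
  forall n F, nnmeas F -> determined n.+1 F ->
    \int[P]_w F w = \int[P]_w \int[k n w]_x F (upd w n x).
Proof.
exists path_measure => n F mF dF.
rewrite (integral_path_measure mF dF) -(addn1 n) expect_add add0n.
rewrite -integral_path_measure//; first exact: nnmeas_expect.
exact: step_determined.
Qed.

End ionescu_tulcea.

Local Close Scope ereal_scope.

(** * Waiting times with a bounded hazard rate *)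

Section bounded_integrals.
Context {R : realType}.
Local Notation leb := (@lebesgue_measure R).
Implicit Types f : R -> R.

Lemma integrable_bounded_itv f (M a b : R) (b0 b1 : bool) :
  measurable_fun [set: R] f -> (forall x, `|f x| <= M) ->
  leb.-integrable [set` Interval (BSide b0 a) (BSide b1 b)] (EFin \o f).
Proof.
move=> mf fM; apply: measurable_bounded_integrable => //.
- rewrite /= lebesgue_measure_itv/=; case: ifPn => _; last exact: ltry.
  by rewrite -EFinB ltry.
- exact: measurable_funTS.
- exists M; split; first exact: num_real.
  by move=> y My x _; apply: le_trans (ltW My); exact: fM.
Qed.

Lemma Rintegral_itv_cst (c s t : R) : s <= t ->
  \int[leb]_(x in `]s, t]) c = c * (t - s).
Proof.
move=> st; rewrite Rintegral_cst//= lebesgue_measure_itv/= lte_fin.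
move: st; rewrite le_eqVlt => /predU1P[->|->]; last by rewrite -EFinB.
by rewrite ltxx subrr.
Qed.

(** Cutting the interval into 2 ^ n equal parts divides the quadratic bound by
    2 ^ n.  It stands in for the uniqueness of primitives when the integrand is
    only measurable. *)
Lemma quadratic_cst (F : R -> R) (K : R) :
  (forall s t, 0 <= s -> s <= t -> `|F t - F s| <= K * (t - s) ^+ 2) ->
  forall t, 0 <= t -> F t = F 0.
Proof.
move=> hF t t0.
have halve n : forall s t, 0 <= s -> s <= t ->
    `|F t - F s| <= K * (t - s) ^+ 2 / 2 ^+ n.
  elim: n => [|n IH] s {t0}t s0 st; first by rewrite expr0 divr1 hF.
  have sm : s <= (s + t) / 2 by lra.
  have mt : (s + t) / 2 <= t by lra.
  have := IH _ _ s0 sm; have := IH _ _ (le_trans s0 sm) mt => h1 h2.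
  rewrite (_ : F t - F s = (F t - F ((s + t) / 2)) + (F ((s + t) / 2) - F s)); last by ring.
  apply: le_trans (ler_normD _ _) _; apply: le_trans (lerD h1 h2) _.
  rewrite le_eqVlt; apply/orP; left; apply/eqP; rewrite (exprS 2 n) invfM.
  by set e := (2 ^+ n)^-1; move: e => e; field.
apply/eqP; rewrite -subr_eq0 -normr_le0.
set C := K * (t - 0) ^+ 2.
have lim0 : (fun n => C / 2 ^+ n) @ \oo --> C * 0.
  apply: cvgMr; under eq_fun do rewrite -exprVn; apply: cvg_expr.
  by rewrite ger0_norm; lra.
rewrite -[leRHS](mulr0 C); apply: (ler_cvg_to (cvg_cst _) lim0).
by apply: nearW => n; exact: halve.
Qed.

End bounded_integrals.

Section survival.
Context {R : realType}.
Local Notation leb := (@lebesgue_measure R).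
Variables (q : R -> R) (l Q : R).
Hypotheses (mq : measurable_fun [set: R] q) (l0 : 0 < l).
Hypotheses (lq : forall t, l <= q t) (qQ : forall t, q t <= Q).

(** q is the hazard rate of a waiting time, so that survival t is the probability
    that it exceeds t. *)
Definition hazard (t : R) : R := \int[leb]_(s in `[0, t]) q s.
Definition survival (t : R) : R := expR (- hazard t).

Let q_ge0 t : 0 <= q t. Proof. exact: le_trans (ltW l0) (lq t). Qed.
Let Q_ge0 : 0 <= Q. Proof. exact: le_trans (q_ge0 0) (qQ 0). Qed.

Let iq (b0 b1 : bool) a b : leb.-integrable [set` Interval (BSide b0 a) (BSide b1 b)] (EFin \o q).
Proof.
by apply: (@integrable_bounded_itv _ _ Q) => // x; rewrite ger0_norm.
Qed.

Lemma hazardB s t : 0 <= s -> s <= t ->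
  hazard t - hazard s = \int[leb]_(x in `]s, t]) q x.
Proof. by move=> s0 st; rewrite /hazard Rintegral_itvB//= bnd_simp. Qed.

Lemma hazardB_ge s t : 0 <= s -> s <= t -> l * (t - s) <= hazard t - hazard s.
Proof.
move=> s0 st; rewrite hazardB// -Rintegral_itv_cst//.
apply: le_Rintegral => //; apply: (@integrable_bounded_itv _ _ `|l|) => // x.
Qed.

Lemma hazardB_le s t : 0 <= s -> s <= t -> hazard t - hazard s <= Q * (t - s).
Proof.
move=> s0 st; rewrite hazardB// -Rintegral_itv_cst//.
apply: le_Rintegral => //; apply: (@integrable_bounded_itv _ _ `|Q|) => // x.
Qed.

Lemma hazard_le0 t : t <= 0 -> hazard t = 0.
Proof.
rewrite /hazard le_eqVlt => /predU1P[->|t0].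
  by rewrite set_itv1 Rintegral_set1.
by rewrite set_itv_ge ?Rintegral_set0// bnd_simp -ltNge.
Qed.

Lemma survival_gt0 t : 0 < survival t. Proof. exact: expR_gt0. Qed.

Lemma survival_le s t : s <= t -> survival t <= survival s.
Proof.
move=> st; rewrite ler_expR lerN2.
have [s0|s0] := leP 0 s.
  rewrite -subr_ge0; apply: le_trans (hazardB_ge s0 st).
  by rewrite mulr_ge0 ?subr_ge0// ltW.
rewrite (hazard_le0 (ltW s0)); exact: Rintegral_ge0.
Qed.

Lemma survival_le1 t : survival t <= 1.
Proof. by rewrite /survival -expR0 ler_expR oppr_le0; exact: Rintegral_ge0. Qed.

Lemma measurable_survival : measurable_fun [set: R] survival.
Proof. apply: nonincreasing_measurable; first exact: measurableT.
move=> s t; exact: survival_le. Qed.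

Lemma survivalB_le s t : 0 <= s -> s <= t ->
  survival s - survival t <= survival s * (hazard t - hazard s).
Proof.
move=> s0 st; have := expR_ge1Dx (- (hazard t - hazard s)).
have -> : survival t = survival s * expR (- (hazard t - hazard s)).
  by rewrite /survival -expRD; congr expR; ring.
have := survival_gt0 s; nra.
Qed.

Lemma survivalB_ge s t : 0 <= s -> s <= t ->
  survival t * (hazard t - hazard s) <= survival s - survival t.
Proof.
move=> s0 st; have := expR_ge1Dx (hazard t - hazard s).
have -> : survival s = survival t * expR (hazard t - hazard s).
  by rewrite /survival -expRD; congr expR; ring.
have := survival_gt0 t; nra.
Qed.

Let mqG : measurable_fun [set: R] (fun t => q t * survival t).
Proof. by apply: measurable_funM => //; exact: measurable_survival. Qed.

Let qG_ge0 t : 0 <= q t * survival t.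
Proof. by rewrite mulr_ge0// ltW// survival_gt0. Qed.

Let iqG (b0 b1 : bool) a b :
  leb.-integrable [set` Interval (BSide b0 a) (BSide b1 b)] (EFin \o (fun t => q t * survival t)).
Proof.
apply: (@integrable_bounded_itv _ _ Q) => // x; rewrite ger0_norm//.
rewrite -[leRHS]mulr1 ler_pM// ?survival_le1// ltW//; exact: survival_gt0.
Qed.

Let iqc (c : R) (b0 b1 : bool) a b :
  leb.-integrable [set` Interval (BSide b0 a) (BSide b1 b)] (EFin \o (fun t => q t * c)).
Proof.
apply: (@integrable_bounded_itv _ _ (Q * `|c|)).
  by apply: measurable_funM => //; exact: measurable_cst.
by move=> x; rewrite normrM ger0_norm// ler_wpM2r.
Qed.

(** The sum F of the integral and of the survival function is constant by
    [quadratic_cst]: on an interval of length d, survival decreases by at most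
    Q d, and bounding it by its values at the end points in the integral and in
    1 + x <= exp x leaves an error of order (Q d) ^ 2. *)
Lemma integral_density_fin t : 0 <= t ->
  \int[leb]_(x in `[0, t]) (q x * survival x) = 1 - survival t.
Proof.
have squeeze (I a b y Y : R) : I <= y * a -> y * b <= I -> a - b <= a * y ->
    b * y <= a - b -> y * (a - b) <= Y -> (- Y <= I - (a - b)) && (I - (a - b) <= Y).
  by move=> h1 h2 h3 h4 h5; apply/andP; split; lra.
move=> t0.
pose F t := \int[leb]_(x in `[0, t]) (q x * survival x) + survival t.
suff FE : F t = F 0.
  have F0 : F 0 = 1.
    by rewrite /F set_itv1 Rintegral_set1 add0r /survival (hazard_le0 (lexx 0)) oppr0 expR0.
  by move: FE; rewrite F0 /F => <-; rewrite addrK.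
apply: (@quadratic_cst _ F (Q ^+ 2)) t0 => {}s {}t s0 st.
set x := hazard t - hazard s.
have x0 : 0 <= x by apply: le_trans (hazardB_ge s0 st); rewrite mulr_ge0 ?subr_ge0// ltW.
have xQ : x <= Q * (t - s) by exact: hazardB_le.
have FB : F t - F s = \int[leb]_(x in `]s, t]) (q x * survival x) - (survival s - survival t).
  have <- := @Rintegral_itvB _ _ (BLeft 0) (BRight t) s (iqG _ _ _ _) s0 st.
  have alg (a b u v : R) : a + u - (b + v) = (a - b) - (v - u) by ring.
  exact: alg.
have up : \int[leb]_(x in `]s, t]) (q x * survival x) <= x * survival s.
  rewrite /x (hazardB s0 st) -RintegralZr; [|exact: measurable_itv|exact: iq].
  apply: le_Rintegral; [exact: measurable_itv|exact: iqG|exact: iqc|] => y.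
  rewrite /= in_itv /= => /andP[sy _].
  apply: ler_wpM2l; first exact: q_ge0.
  exact: survival_le (ltW sy).
have lo : x * survival t <= \int[leb]_(x in `]s, t]) (q x * survival x).
  rewrite /x (hazardB s0 st) -RintegralZr; [|exact: measurable_itv|exact: iq].
  apply: le_Rintegral; [exact: measurable_itv|exact: iqc|exact: iqG|] => y.
  rewrite /= in_itv /= => /andP[_ yt].
  apply: ler_wpM2l; first exact: q_ge0.
  exact: survival_le.
have B1 := survivalB_le s0 st; have B2 := survivalB_ge s0 st.
rewrite -/x in B1 B2.
have x2 : x ^+ 2 <= Q ^+ 2 * (t - s) ^+ 2.
  by rewrite -exprMn lerXn2r// ?nnegrE//; exact: le_trans xQ.
apply: le_trans x2; rewrite FB ler_norml.
have G1 := survival_le1 s; have G0 := survival_gt0 s.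
have d : x * (survival s - survival t) <= x ^+ 2.
  rewrite expr2 ler_wpM2l//; apply: le_trans B1 _.
  by rewrite -[leRHS]mul1r ler_wpM2r.
exact: (squeeze _ _ _ _ _ up lo B1 B2 d).
Qed.

Local Open Scope ereal_scope.

Lemma integral_density_itv s t : (0 <= s)%R -> (s <= t)%R ->
  \int[leb]_(x in `]s, t]) (q x * survival x)%:E = (survival s - survival t)%:E.
Proof.
move=> s0 st; have t0 := le_trans s0 st.
have /fineK <- : \int[leb]_(x in `]s, t]) (q x * survival x)%:E \is a fin_num.
  by apply: integrable_fin_num; [exact: measurable_itv|exact: iqG].
congr (_%:E).
transitivity (\int[leb]_(x in `]s, t]) (q x * survival x))%R; first by [].
have <- := @Rintegral_itvB _ _ (BLeft 0%R) (BRight t) s (iqG _ _ _ _) s0 st.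
rewrite (integral_density_fin s0) (integral_density_fin t0).
have alg (a b : R) : (1 - b - (1 - a) = a - b)%R by ring.
exact: alg.
Qed.

Lemma survival_le_exp t : (0 <= t)%R -> (survival t <= expR (- (l * t)))%R.
Proof.
move=> t0; rewrite /survival ler_expR lerN2.
by have := hazardB_ge (lexx 0) t0; rewrite (hazard_le0 (lexx 0)) !subr0.
Qed.

(** The lower bound l on the hazard rate makes survival at most exp (- l t), hence
    at most (1 + l) ^- n at integer times. *)
Lemma survival_cvg0 (s : R) : (0 <= s)%R -> (survival (s + n%:R))%R @[n --> \oo] --> (0 : R)%R.
Proof.
move=> s0; have l1 : (0 < 1 + l)%R by rewrite ltr_pwDl// ltW.
have lim0 : (fun n => ((1 + l)^-1 ^+ n)%R) @ \oo --> (0 : R)%R.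
  apply: cvg_expr; rewrite ger0_norm ?invr_ge0 ?ltW// invf_lt1// ltrDl//.
apply: (@squeeze_cvgr _ _ _ _ (fun=> 0%R) (fun n => ((1 + l)^-1 ^+ n)%R)) => //; last exact: cvg_cst.
apply: nearW => n; apply/andP; split; first exact: ltW (survival_gt0 _).
apply: (@le_trans _ _ (survival n%:R)); first by apply: survival_le; rewrite lerDr.
apply: le_trans (survival_le_exp (ler0n _ n)) _.
rewrite expRN exprVn lef_pV2 ?posrE ?expR_gt0 ?exprn_gt0//.
rewrite -[leLHS]/((1 + l) ^+ n)%R mulrC expRM_natl.
by apply: lerXn2r; rewrite ?nnegrE ?expR_ge0 ?(ltW l1)//; exact: expR_ge1Dx.
Qed.

Lemma integral_density s : (0 <= s)%R ->
  \int[leb]_(x in `]s, +oo[) (q x * survival x)%:E = (survival s)%:E.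
Proof.
move=> s0.
have -> : `]s, +oo[%classic = \bigcup_n `]s, (s + n%:R)%R]%classic :> set R.
  apply/seteqP; split=> [x|x [n _]] /=; rewrite !in_itv/= ?andbT.
    move=> sx; exists (Num.truncn (x - s)).+1 => //=.
    rewrite in_itv/= sx/= -lerBlDl ltW//.
    by have := truncnS_gt (x - s).
  by move=> /andP[].
have h : \int[leb]_(x in `]s, (s + n%:R)%R]) (q x * survival x)%:E @[n --> \oo] --> (survival s)%:E.
  under eq_fun do rewrite integral_density_itv ?lerDl//.
  apply: cvg_EFin; first by apply: nearW.
  rewrite -[X in _ --> X](subr0 (survival s)).
  by apply: cvgB; [exact: cvg_cst|exact: survival_cvg0 s0].
apply/esym; rewrite -(cvg_lim _ h)//; apply/cvg_lim => //.
have := @ge0_nondecreasing_set_cvg_integral _ (measurableTypeR R) _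
  (fun n : nat => `]s, (s + n%:R)%R]%classic) (fun x => (q x * survival x)%:E) leb.
apply.
- move=> n m nm; apply/subsetPset/subset_itvl; by rewrite bnd_simp lerD2l ler_nat.
- by move=> n; exact: measurable_itv.
- by move=> n; apply/measurable_EFinP; apply: measurable_funTS; exact: mqG.
- by move=> n x _; rewrite lee_fin; exact: qG_ge0.
Qed.

End survival.

(** * The jump kernel of the controlled queue *)

Section measurability.
Context {R : realType}.

Lemma measurable_integral_lebesgue d (S : measurableType d) (f : S * R -> \bar R) :
  measurable_fun [set: S * R] f -> (forall x, 0 <= f x)%E ->
  measurable_fun [set: S] (fun s => \int[@lebesgue_measure R]_t f (s, t))%E.
Proof.
exact: (@measurable_fun_fubini_tonelli_F _ _ S (measurableTypeR R) R (@lebesgue_measure R) f).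
Qed.

Lemma measurable_discrete d (T : measurableType d) (f : T -> nat) (A : set T) :
  injective f -> (forall x : T, measurable [set x]) -> measurable A.
Proof.
move=> fI m1; have -> : A = \bigcup_n (A `&` f @^-1` [set n]).
  by apply/seteqP; split => [x Ax|x [n _ []]//]; exists (f x).
apply: bigcup_measurable => n _.
have [[x [Ax fx]]|nA] := pselect (exists x, A x /\ f x = n).
  rewrite (_ : _ `&` _ = [set x])//; apply/seteqP; split => [y /= [_ fy]|y ->//].
  by apply: fI; rewrite fy fx.
rewrite (_ : _ `&` _ = set0)//; apply/seteqP; split => // y [Ay fy].
by apply: nA; exists y.
Qed.

Lemma measurable_state1 (y : state) : measurable [set y].
Proof.
case: y => n d; have -> : [set (n, d)] = [set n] `*` [set d].
  by apply/seteqP; split => [[m e] [-> ->]|[m e] [/= -> ->]].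
exact: measurableX.
Qed.

Lemma measurable_state_set (A : set state) : measurable A.
Proof.
apply: (@measurable_discrete _ _ (fun y : state => pickle y)); last exact: measurable_state1.
exact: (pcan_inj pickleK).
Qed.

Lemma measurable_state2_fun d (U : measurableType d) (f : state * state -> U) :
  measurable_fun [set: state * state] f.
Proof.
move=> _ B _; apply: (@measurable_discrete _ _ (fun y : state * state => pickle y)).
  exact: (pcan_inj pickleK).
move=> [y1 y2]; have -> : [set (y1, y2)] = [set y1] `*` [set y2].
  by apply/seteqP; split => [[m e] [-> ->]|[m e] [/= -> ->]].
by apply: measurableX; exact: measurable_state1.
Qed.

Lemma measurable_state_fun d (U : measurableType d) (D : set state) (f : state -> U) :
  measurable_fun D f.
Proof. by move=> _ B _; exact: measurable_state_set. Qed.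

Lemma measurable_bool_fun d (U : measurableType d) (D : set bool) (f : bool -> U) :
  measurable_fun D f.
Proof. by []. Qed.

Lemma current_state_last n (h : history R n.+1) : current_state h = (tnth h.2 ord_max).2.
Proof.
case: h => z t; rewrite /current_state /=.
by rewrite -nth_last size_map size_tuple (nth_map (0, z)) ?size_tuple// (tnth_nth (0, z)).
Qed.

Lemma measurable_current_state n :
  measurable_fun [set: history R n] (@current_state R n).
Proof.
case: n => [|n].
  rewrite (_ : @current_state R 0 = fst); first exact: measurable_fst.
  by apply/funext => -[z t]; rewrite /current_state /= (tuple0 t).
have -> : @current_state R n.+1 = fun h => (tnth h.2 ord_max).2.
  by apply/funext => h; exact: current_state_last.
apply: measurableT_comp; first exact: measurable_snd.
apply: (measurableT_comp (measurable_tnth _)); exact: measurable_snd.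
Qed.

Lemma measurable_history_of z n :
  measurable_fun [set: path R] (fun w : path R => history_of z w n).
Proof.
apply/measurable_fun_pairP; split; first exact: measurable_cst.
apply/measurable_fun_tnthP => i.
rewrite (_ : _ \o _ = fun w : path R => w i); first exact: measurable_coordinate.
by apply/funext => w /=; rewrite tnth_mktuple.
Qed.

End measurability.

Section jump_kernel.
Context {R : realType} (M : queue R) (pi : decision_rule R).
Local Notation leb := (@lebesgue_measure R).
Hypotheses (lambda_gt0 : 0 < arrival_rate M) (mu_ge0 : 0 <= service_rate M).
Hypothesis mpi : forall n, measurable_fun [set: history R n * R] (fun p => pi p.1 p.2).

Definition exit_rate n (h : history R n) (t : R) : R :=
  total_rate M (current_state h).1 (pi h t).

Lemma total_rate_ge i a : arrival_rate M <= total_rate M i a.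
Proof. by case: a => //=; rewrite lerDl mulr_ge0. Qed.

Lemma total_rate_le i a : total_rate M i a <= total_rate M i true.
Proof. by case: a => //=; rewrite lerDl mulr_ge0. Qed.

Lemma rate_ge0 j i a : 0 <= rate M j i a.
Proof. by rewrite /rate; case: ifP => _; [exact: ltW|case: ifP => // _; rewrite mulr_ge0]. Qed.

Lemma rate_up i a : rate M (i%:Z + 1) i a = arrival_rate M.
Proof. by rewrite /rate eqxx. Qed.

Lemma rate_down i a : rate M (i%:Z - 1) i a = a%:R * i%:R * service_rate M.
Proof.
rewrite /rate eqxx andbT ifF; last by apply/negbTE; clear; lia.
by case: i => [|i]; case: a; rewrite /= ?mul0r ?mulr0 ?mul0r// mul1r.
Qed.

Lemma rate_sum i a : rate M (i%:Z + 1) i a + rate M (i%:Z - 1) i a = total_rate M i a.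
Proof. by rewrite rate_up rate_down; case: a; rewrite /= ?mul1r ?mul0r ?addr0. Qed.

Lemma measurable_of_state_action n (f : state -> bool -> R) :
  measurable_fun [set: history R n * R]
    (fun p : history R n * R => f (current_state p.1) (pi p.1 p.2)).
Proof.
have mf : measurable_fun [set: state * bool] (fun q : state * bool => f q.1 q.2).
  have -> : (fun q : state * bool => f q.1 q.2) =
      fun q => (if q.2 then f q.1 true else f q.1 false).
    by apply/funext => -[s []].
  apply: measurable_fun_ifT; first exact: measurable_snd.
    exact: (measurableT_comp (@measurable_state_fun _ R setT (f ^~ true)) measurable_fst).
  exact: (measurableT_comp (@measurable_state_fun _ R setT (f ^~ false)) measurable_fst).
have mg : measurable_fun [set: history R n * R]
    (fun p : history R n * R => (current_state p.1, pi p.1 p.2)).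
  apply: measurable_fun_pair; last exact: mpi.
  exact: (measurableT_comp (@measurable_current_state R n) measurable_fst).
exact: (measurableT_comp mf mg).
Qed.

Lemma measurable_exit_rate n (h : history R n) : measurable_fun [set: R] (exit_rate h).
Proof.
exact: (measurableT_comp (@measurable_of_state_action n (fun s a => total_rate M s.1 a))
  (pair1_measurable h)).
Qed.

Lemma measurable_jump_survival n : measurable_fun [set: history R n * R]
  (fun p : history R n * R => survival (exit_rate p.1) p.2).
Proof.
apply: measurableT_comp => //; apply: measurableT_comp => //.
pose f (x : (history R n * R) * R) : \bar R :=
  (if (0 <= x.2) && (x.2 <= x.1.2) then exit_rate x.1.1 x.2 else 0)%:E.
have m2 : measurable_fun [set: (history R n * R) * R] (fun x => x.2).
  exact: measurable_snd.
have m12 : measurable_fun [set: (history R n * R) * R] (fun x => x.1.2).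
  exact: (measurableT_comp measurable_snd measurable_fst).
have m11 : measurable_fun [set: (history R n * R) * R] (fun x => x.1.1).
  exact: (measurableT_comp measurable_fst measurable_fst).
have mf : measurable_fun [set: (history R n * R) * R] f.
  apply/measurable_EFinP; apply: measurable_fun_ifT; last exact: measurable_cst.
    apply: measurable_and; last exact: measurable_fun_ler.
    by apply: measurable_fun_ler => //; exact: measurable_cst.
  exact: (measurableT_comp (@measurable_of_state_action n (fun s a => total_rate M s.1 a))
    (measurable_fun_pair m11 m2)).
have f0 x : (0 <= f x)%E.
  rewrite lee_fin; case: ifP => // _.
  exact: le_trans (ltW lambda_gt0) (total_rate_ge _ _).
have := measurableT_comp (@fine_measurable R setT measurableT)
  (measurable_integral_lebesgue mf f0).
apply: eq_measurable_fun => -[h t] _ /=.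
rewrite /hazard /Rintegral integral_mkcond; congr fine; apply: eq_integral => s _.
rewrite /f /= patchE mem_setE in_itv /=; case: ifP => //.
Qed.

(** The boolean [up] tells an arrival from a departure. *)
Definition jump_rate (up : bool) n (h : history R n) (t : R) : R :=
  let i := (current_state h).1 in
  rate M (if up then i%:Z + 1 else i%:Z - 1) i (pi h t).

Definition jump_weight up n (h : history R n) (t : R) : R :=
  survival (exit_rate h) t * jump_rate up h t.

Definition jump_outcome (up : bool) n (h : history R n) (t : R) : R * state :=
  let i := (current_state h).1 in (t, (if up then i.+1 else i.-1, pi h t)).

Lemma jump_weight_ge0 up n (h : history R n) t : 0 <= jump_weight up h t.
Proof. by rewrite mulr_ge0 ?rate_ge0// ltW// survival_gt0. Qed.

Lemma measurable_jump_weight up n : measurable_fun [set: history R n * R]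
  (fun p : history R n * R => jump_weight up p.1 p.2).
Proof.
apply: measurable_funM; first exact: measurable_jump_survival.
exact: (@measurable_of_state_action n
  (fun s a => rate M (if up then s.1%:Z + 1 else s.1%:Z - 1) s.1 a)).
Qed.

Lemma measurable_jump_outcome up n : measurable_fun [set: history R n * R]
  (fun p : history R n * R => jump_outcome up p.1 p.2).
Proof.
apply: measurable_fun_pair; first exact: measurable_snd.
apply: measurable_fun_pair; last exact: mpi.
exact: (measurableT_comp (@measurable_state_fun _ _ setT
  (fun s : state => if up then s.1.+1 else s.1.-1))
  (measurableT_comp (@measurable_current_state R n) measurable_fst)).
Qed.

Local Open Scope ereal_scope.

(** Mean of f over the pair (sojourn time, state after the jump), given the history
    h and restricted to jumps in one direction. *)
Definition jump_part up n (h : history R n) (f : R * state -> \bar R) : \bar R :=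
  \int[leb]_(t in `]0%R, +oo[) ((jump_weight up h t)%:E * f (jump_outcome up h t)).

Definition jump_mean n (h : history R n) (f : R * state -> \bar R) : \bar R :=
  jump_part true h f + jump_part false h f.

Lemma measurable_jump_integrand up n (h : history R n) f : nnmeas f ->
  measurable_fun [set: R] (fun t => (jump_weight up h t)%:E * f (jump_outcome up h t)).
Proof.
move=> [f0 mf]; apply: emeasurable_funM.
  apply/measurable_EFinP.
  have := measurableT_comp (@measurable_jump_weight up n) (pair1_measurable h).
  exact.
apply: (measurableT_comp mf).
have := measurableT_comp (@measurable_jump_outcome up n) (pair1_measurable h).
exact.
Qed.

Lemma jump_part_functional up n (h : history R n) :
  positive_functional (jump_part up h).
Proof.
apply: (@positive_functional_integral _ _ R _ (measurableTypeR R) leb).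
- exact: measurable_itv.
- move=> t; apply: positive_functional_eval; exact: jump_weight_ge0.
- move=> f nf; exact: measurable_jump_integrand.
Qed.

Lemma jump_mean_functional n (h : history R n) : positive_functional (jump_mean h).
Proof. by apply: positive_functionalD; exact: jump_part_functional. Qed.

Lemma measurable_jump_part up n (f : history R n * (R * state) -> \bar R) : nnmeas f ->
  measurable_fun [set: history R n] (fun h => jump_part up h (fun x => f (h, x))).
Proof.
move=> [f0 mf].
pose g (p : history R n * R) : \bar R := if (0 < p.2)%R then
  (jump_weight up p.1 p.2)%:E * f (p.1, jump_outcome up p.1 p.2) else 0.
have mg : measurable_fun [set: history R n * R] g.
  apply: measurable_fun_ifT; last exact: measurable_cst.
    by apply: measurable_fun_ltr; [exact: measurable_cst|exact: measurable_snd].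
  apply: emeasurable_funM.
    by apply/measurable_EFinP; exact: measurable_jump_weight.
  apply: (measurableT_comp mf).
  by apply: measurable_fun_pair; [exact: measurable_fst|exact: measurable_jump_outcome].
have g0 p : 0 <= g p.
  by rewrite /g; case: ifP => // _; rewrite mule_ge0// lee_fin jump_weight_ge0.
have := measurable_integral_lebesgue mg g0.
apply: eq_measurable_fun => h _; rewrite /jump_part [RHS]integral_mkcond.
by apply: eq_integral => t _; rewrite patchE mem_setE in_itv/= andbT.
Qed.

Lemma measurable_jump_mean n (f : history R n * (R * state) -> \bar R) : nnmeas f ->
  measurable_fun [set: history R n] (fun h => jump_mean h (fun x => f (h, x))).
Proof. by move=> nf; apply: emeasurable_funD; exact: measurable_jump_part. Qed.

Lemma jump_meanE n (h : history R n) f : nnmeas f ->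
  jump_mean h f = \int[leb]_(t in `]0%R, +oo[)
    ((jump_weight true h t)%:E * f (jump_outcome true h t) +
     (jump_weight false h t)%:E * f (jump_outcome false h t)).
Proof.
move=> nf; rewrite /jump_mean /jump_part ge0_integralD//.
- by move=> t _; rewrite mule_ge0 ?nf.1// lee_fin jump_weight_ge0.
- by apply: measurable_funTS; exact: measurable_jump_integrand.
- by move=> t _; rewrite mule_ge0 ?nf.1// lee_fin jump_weight_ge0.
- by apply: measurable_funTS; exact: measurable_jump_integrand.
Qed.

(** The two jump rates add up to the hazard rate, and arrivals alone ensure that
    the waiting time is almost surely finite. *)
Lemma jump_mean1 n (h : history R n) : jump_mean h (fun=> 1) = 1.
Proof.
rewrite jump_meanE; last by split => //; exact: measurable_cst.
transitivity ((survival (exit_rate h) 0)%:E); last first.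
  by rewrite /survival hazard_le0// oppr0 expR0.
have := @integral_density R (exit_rate h) (arrival_rate M)
  (total_rate M (current_state h).1 true) (measurable_exit_rate h) lambda_gt0.
move=> <-//; last 2 first.
- by move=> t; exact: total_rate_ge.
- by move=> t; exact: total_rate_le.
apply: eq_integral => t _; rewrite !mule1 -EFinD -mulrDr mulrC; congr (_ * _)%:E.
exact: rate_sum.
Qed.

End jump_kernel.

Local Open Scope ereal_scope.

(** * Existence of the path law *)

Section path_law_existence.
Context {R : realType} (M : queue R) (pi : decision_rule R) (z : state).
Local Notation leb := (@lebesgue_measure R).
Hypotheses (lambda_gt0 : (0 < arrival_rate M)%R) (mu_ge0 : (0 <= service_rate M)%R).
Hypothesis mpi : forall n, measurable_fun [set: history R n * R] (fun p => pi p.1 p.2).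

Definition path_kernel n (w : path R) : {measure set (R * state) -> \bar R} :=
  functional_measure
    (jump_mean_functional lambda_gt0 mu_ge0 mpi (history_of z w n)).

Lemma path_kernelE n w C : path_kernel n w C = jump_mean M pi (history_of z w n) (EFin \o \1_C).
Proof. by []. Qed.

Let measurable_path_kernel n U : measurable U ->
  measurable_fun [set: path R] (path_kernel n ^~ U).
Proof.
move=> mU.
have nf : nnmeas (fun p : history R n * (R * state) => (\1_U p.2)%:E : \bar R).
  split=> [p|]; first by rewrite lee_fin.
  by apply/measurable_EFinP; apply: measurableT_comp.
have := measurableT_comp (measurable_jump_mean lambda_gt0 mu_ge0 mpi nf)
  (@measurable_history_of R z n).
exact.
Qed.

HB.instance Definition _ n := @isKernel.Build _ _ (path R) (R * state)%type R
  (path_kernel n) (@measurable_path_kernel n).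

Let path_kernelT n w : path_kernel n w [set: R * state] = 1.
Proof. by rewrite path_kernelE indicT; exact: jump_mean1. Qed.

HB.instance Definition _ n := @Kernel_isProbability.Build _ _ (path R) (R * state)%type R
  (path_kernel n) (@path_kernelT n).

Lemma history_of_agree n (w w' : path R) : (forall k, (k < n)%N -> w k = w' k) ->
  history_of z w n = history_of z w' n.
Proof.
move=> ww'; congr (_, _); apply: eq_from_tnth => i.
by rewrite !tnth_mktuple ww'.
Qed.

(** The target of a jump determines its direction, so that one of the two terms of
    the mean survives, with the rate prescribed by [rate]. *)
Lemma jump_lawE n (h : history R n) B y : measurable B ->
  jump_law M pi h B y = jump_mean M pi h (EFin \o \1_(B `*` [set y])).
Proof.
move=> mB; rewrite (jump_meanE lambda_gt0 mu_ge0 mpi); last first.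
  by apply: nnmeas_indic; apply: measurableX => //; exact: measurable_state_set.
rewrite /jump_law setIC integral_mkcondr; apply: eq_integral => t _.
rewrite patchE /= !indicE /= !in_setX.
have -> (up : bool) : (jump_outcome pi up h t).1 = t by [].
case: ifP => tB; rewrite ?(andbF, andFb, mule0, adde0)//= ?mule0 ?adde0//.
rewrite -!EFinM -EFinD; congr _%:E; rewrite /jump_weight -/(exit_rate _ _ _).
set G := expR _; rewrite -[survival _ _]/G.
rewrite /jump_rate; set i := (current_state h).1; set a := pi h t.
have E j : ((j, a) \in [set y]) = (a == y.2) && (y.1 == j).
  apply/idP/idP; first by rewrite inE /= => <-; rewrite !eqxx.
  by move=> /andP[/eqP e2 /eqP e1]; rewrite inE /=; rewrite [y]surjective_pairing e1 e2.
rewrite !E; case: eqP => [_|_]; last by rewrite /= !mul0r !mulr0 addr0.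
rewrite rate_up rate_down /rate.
have -> : (y.1%:Z == i%:Z + 1)%R = (y.1 == i.+1) by clear; lia.
case: eqP => [->|_].
  by rewrite /= (_ : (i.+1 == i.-1) = false) ?mulr0 ?addr0 ?mulr1 ?mul1r 1?mulrC//; lia.
case: i {E} => [|i]; first by rewrite /= !(mulr0, mul0r) addr0.
have -> : (y.1%:Z == i.+1%:Z - 1)%R = (y.1 == i) by clear; lia.
rewrite mulr0 add0r mul1r /=.
by case: eqP => _; case: a; rewrite /= ?(mulr0, mul0r, mulr1, mul1r)// mulrC.
Qed.

(** The law provided by Ionescu-Tulcea has the right conditional probabilities on
    rectangles by [jump_lawE]. *)
Lemma path_law_exists : exists P : probability (path R) R, is_path_law M pi z P.
Proof.
have knon n (w w' : path R) : agree n w w' ->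
    forall U, measurable U -> path_kernel n w U = path_kernel n w' U.
  by move=> ww' U mU; rewrite !path_kernelE (history_of_agree ww').
have [P hP] := ionescu_tulcea knon (point : path R).
exists P => n A B y mA mB.
set C := [set w | _].
have mCA : measurable [set w : path R | A (history_of z w n)].
  by rewrite -[X in measurable X]setTI; exact: (@measurable_history_of R z n measurableT A mA).
have mC : measurable C.
  have -> : C = [set w | A (history_of z w n)] `&` [set w | (B `*` [set y]) (w n)].
    by apply/seteqP; split=> w /=.
  apply: measurableI => //; rewrite -[X in measurable X]setTI.
  apply: measurable_coordinate => //; apply: measurableX => //.
  exact: measurable_state_set.
have dC : determined n.+1 (EFin \o \1_C : seq_space (R * state)%type -> \bar R).
  move=> w w' ww' /=; rewrite !indicE; congr (_%:R%:E).
  rewrite -!topredE /= /mem /= /in_set /C /mkset (@history_of_agree n w w') ?ww'//.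
  by move=> k kn; rewrite ww'// ltnW.
have := hP n _ (@nnmeas_indic _ (path R) R _ mC) dC.
rewrite integral_indic// setIT => ->.
rewrite [RHS]integral_mkcond; apply: eq_integral => w _; rewrite patchE.
have uh x : history_of z (upd w n x) n = history_of z w n.
  by apply: history_of_agree => k kn; rewrite /upd ltn_eqF.
have ux x : upd w n x n = x by rewrite /upd eqxx.
case: ifPn => [/set_mem Aw|/negP nAw].
  rewrite jump_lawE// -path_kernelE -[in RHS](setIT (_ `*` _)) -integral_indic//; last first.
    by apply: measurableX => //; exact: measurable_state_set.
  apply: eq_integral => x _ /=; rewrite !indicE; congr (_%:R%:E).
  rewrite -!topredE /= /mem /= /in_set /C /mkset uh ux /setX /mkset /=.
  by congr asbool; apply/propext; split=> [[_ []]|[]].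
apply: integral0_eq => x _ /=; rewrite indicE memNset//.
by rewrite /C /= uh => -[Aw _]; apply: nAw; rewrite inE.
Qed.

End path_law_existence.

(** * Mean of the next jump given the history *)

Section rectangles.
Context d1 d2 (T1 : measurableType d1) (T2 : measurableType d2) (R : realType).

Lemma finite_measure_unique_prod (m1 m2 : {measure set (T1 * T2) -> \bar R}) :
  m1 setT < +oo ->
  (forall A B, measurable A -> measurable B -> m1 (A `*` B) = m2 (A `*` B)) ->
  forall C, measurable C -> m1 C = m2 C.
Proof.
move=> m1T m12 C mC.
pose G : set (set (T1 * T2)) :=
  [set A `*` B | A in measurable & B in measurable].
apply: (measure_unique G (fun=> setT)) => //.
- exact: measurable_prod_measurableType.
- move=> _ _ [A1 mA1 [B1 mB1 <-]] [A2 mA2 [B2 mB2 <-]].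
  exists (A1 `&` A2); first exact: measurableI.
  by exists (B1 `&` B2); [exact: measurableI|rewrite setXI].
- by move=> _; exists setT => //; exists setT => //; rewrite setXTT.
- by apply/seteqP; split => // x _; exists 0%N.
- by move=> _ [A mA [B mB <-]]; exact: m12.
Qed.

Variables (m : {measure set (T1 * T2) -> \bar R}) (A : set T1) (mA : measurable A).

(** The proof that A is measurable is an argument so that the measure structure can
    be inferred from the term. *)
Definition slice_measure (_ : measurable A) (E : set T2) : \bar R := m (A `*` E).

Let slice0 : slice_measure mA set0 = 0.
Proof. by rewrite /slice_measure setX0 measure0. Qed.

Let slice_ge0 E : 0 <= slice_measure mA E.
Proof. exact: measure_ge0. Qed.

Let slice_sigma_additive : semi_sigma_additive (slice_measure mA).
Proof.
move=> F mF tF mUF; rewrite /slice_measure.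
have -> : A `*` \bigcup_n F n = \bigcup_n (A `*` F n).
  by apply/seteqP; split => [[x y] [/= Ax [n _ Fy]]|[x y] [n _ [/= Ax Fy]]];
    [exists n|split => //; exists n].
apply: measure_semi_sigma_additive.
- by move=> n; exact: measurableX.
- apply/trivIsetP => i j _ _ ij; move/trivIsetP: tF => /(_ i j Logic.I Logic.I ij) FF.
  by rewrite -setXI FF setX0.
- by apply: bigcupT_measurable => n; exact: measurableX.
Qed.

HB.instance Definition _ := isMeasure.Build _ _ _ (slice_measure mA)
  slice0 slice_ge0 slice_sigma_additive.

End rectangles.

Section path_law_mean.
Context {R : realType} (M : queue R) (pi : decision_rule R) (z : state).
Local Notation leb := (@lebesgue_measure R).
Hypotheses (lambda_gt0 : (0 < arrival_rate M)%R) (mu_ge0 : (0 <= service_rate M)%R).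
Hypothesis mpi : forall n, measurable_fun [set: history R n * R] (fun p => pi p.1 p.2).
Variable P : probability (path R) R.
Hypothesis lawP : is_path_law M pi z P.

Let jm n := @jump_mean_functional R M pi lambda_gt0 mu_ge0 mpi n.

Definition next_mean n (f : history R n * (R * state) -> \bar R) : \bar R :=
  \int[P]_w jump_mean M pi (history_of z w n) (fun x => f (history_of z w n, x)).

Lemma next_mean_functional n : positive_functional (@next_mean n).
Proof.
apply: (@positive_functional_integral _ _ R _ (path R) P setT
  (fun w f => jump_mean M pi (history_of z w n) (fun x => f (history_of z w n, x)))) => //.
- move=> w; apply: positive_functional_section; exact: jm.
- move=> f nf.
  have := measurableT_comp (measurable_jump_mean lambda_gt0 mu_ge0 mpi nf) (@measurable_history_of R z n).
  exact.
Qed.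

Lemma measurable_next n :
  measurable_fun [set: path R] (fun w : path R => (history_of z w n, w n)).
Proof.
apply: measurable_fun_pair; first exact: measurable_history_of.
exact: measurable_coordinate.
Qed.

Definition next_law n (C : set (history R n * (R * state))) : \bar R :=
  P [set w | C (history_of z w n, w n)].

Let next_law0 n : @next_law n set0 = 0. Proof. exact: measure0. Qed.
Let next_law_ge0 n C : 0 <= @next_law n C. Proof. exact: measure_ge0. Qed.
Let next_law_sigma_additive n : semi_sigma_additive (@next_law n).
Proof.
have h := @measure_semi_sigma_additive _ _ _ (pushforward P (fun w : path R => (history_of z w n, w n))).
exact: (h (@measurable_next n)).
Qed.

HB.instance Definition _ n := isMeasure.Build _ _ _ (@next_law n)
  (@next_law0 n) (@next_law_ge0 n) (@next_law_sigma_additive n).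

(** The path law fixes the joint law of history and next jump on the sets
    A `*` (B `*` [set y]).  Countable unions over y, then uniqueness on products
    applied twice, extend this to all measurable sets. *)
Lemma next_law_unique n C : measurable C ->
  next_law C = functional_measure (next_mean_functional n) C.
Proof.
set nu := functional_measure _.
have rect A B y : measurable A -> measurable B ->
    next_law (A `*` (B `*` [set y])) = nu (A `*` (B `*` [set y])).
  move=> mA mB; rewrite /next_law.
  transitivity (P [set w | A (history_of z w n) /\ B (w n).1 /\ (w n).2 = y]).
    by [].
  rewrite lawP// [LHS]integral_mkcond; apply: eq_integral => w _.
  rewrite patchE; case: ifPn => [/set_mem Aw|/negP nAw].
    rewrite (jump_lawE lambda_gt0 mu_ge0 mpi)//; congr (jump_mean _ _ _ _).
    apply/funext => x; rewrite /= !indicE.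
    suff -> : ((history_of z w n, x) \in A `*` (B `*` [set y])) = (x \in B `*` [set y]) by [].
    by apply/idP/idP => /set_mem; [case=> _ xB|move=> xB]; apply/mem_set.
  have -> : (fun x => (EFin \o \1_(A `*` (B `*` [set y]))) (history_of z w n, x)) =
      EFin \o \1_set0 :> (_ -> \bar R).
    apply/funext => x /=; rewrite indic0 indicE in_setX /= memNset//.
    by move=> Aw; apply: nAw; rewrite inE.
  by rewrite (functional0 (jm _)).
have rectD A B (D : set state) : measurable A -> measurable B ->
    next_law (A `*` (B `*` D)) = nu (A `*` (B `*` D)).
  move=> mA mB.
  pose F k := A `*` (B `*` [set y | D y /\ pickle y = k]).
  have -> : A `*` (B `*` D) = \bigcup_k F k.
    apply/seteqP; split => [[h [t y]] [/= Ah [/= Bt Dy]]|[h [t y]] [k _ [/= Ah [/= Bt [Dy _]]]]] //.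
    by exists (pickle y).
  have mF k : measurable (F k).
    by apply: measurableX => //; apply: measurableX => //; exact: measurable_state_set.
  have tF : trivIset setT F.
    apply/trivIsetP => i j _ _ /eqP ij; apply/seteqP; split => // -[h [t y]].
    by move=> [[_ [/= _ [_ yi]]] [_ [/= _ [_ yj]]]]; apply: ij; rewrite -yi -yj.
  have mUF : measurable (\bigcup_k F k) by exact: bigcupT_measurable.
  apply: (etrans (measure_semi_bigcup (@next_law n) mF tF mUF)).
  apply: (etrans _ (esym (measure_semi_bigcup nu mF tF mUF))).
  apply: eq_eseriesr => k _.
  have [[y [Dy yk]]|nD] := pselect (exists y, D y /\ pickle y = k).
    have -> : F k = A `*` (B `*` [set y]); last exact: rect.
    rewrite /F; congr (_ `*` (_ `*` _)); apply/seteqP; split => [x [Dx xk]|_ ->//].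
    by apply: (pcan_inj pickleK); rewrite xk yk.
  have -> : F k = set0; last by rewrite !measure0.
  by apply/seteqP; split => // -[h [t y]] [_ [/= _ Dy]]; apply: nD; exists y.
have nT : @next_law n setT < +oo.
  by rewrite (_ : next_law setT = 1) ?ltry//; exact: probability_setT.
move=> mC; apply: finite_measure_unique_prod => // A E mA mE.
have := @finite_measure_unique_prod _ _ R state R (slice_measure (@next_law n) mA) (slice_measure nu mA).
apply => //.
- apply: le_lt_trans nT; apply: (@le_measure _ _ _ (@next_law n)); rewrite ?inE//.
  exact: measurableX.
- by move=> B D mB _; exact: rectD.
Qed.

(** Later expectations under the path law are all computed from this identity. *)
Lemma is_path_law_mean n (f : history R n * (R * state) -> \bar R) : nnmeas f ->
  \int[P]_w f (history_of z w n, w n) = next_mean f.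
Proof.
move=> nf; rewrite (integral_functional_measure (next_mean_functional n) nf).
rewrite -(@eq_measure_integral _ _ _ setT (functional_measure (next_mean_functional n)) (@next_law n)); last first.
  by move=> C mC _; exact: next_law_unique.
have := @ge0_integral_pushforward _ _ _ _ R _ (@measurable_next n) P setT f measurableT nf.2.
by move=> ->; [rewrite preimage_setT|move=> y _; exact: nf.1].
Qed.

End path_law_mean.

(** * Discounted rewards of one sojourn *)

Section exponential_integral.
Context {R : realType}.
Local Notation leb := (@lebesgue_measure R).

Lemma lebesgue_tonelli (f : R * R -> \bar R) :
  measurable_fun [set: R * R] f -> (forall x, 0 <= f x) ->
  \int[leb]_x \int[leb]_y f (x, y) = \int[leb]_y \int[leb]_x f (x, y).
Proof. exact: (@fubini_tonelli _ _ (measurableTypeR R) (measurableTypeR R) R leb leb f). Qed.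

Lemma survival_cst (a t : R) : (0 <= t)%R -> survival (fun=> a) t = expR (- (a * t)).
Proof.
move=> t0; rewrite /survival /hazard Rintegral_cst//= lebesgue_measure_itv/= lte_fin.
move: t0; rewrite le_eqVlt => /predU1P[<-|->]; last by rewrite -EFinB /= subr0.
by rewrite ltxx /= mulr0.
Qed.

Lemma integral_exp_itvoc (a s t : R) : (0 < a)%R -> (0 <= s)%R -> (s <= t)%R ->
  \int[leb]_(x in `]s, t]) (a * expR (- (a * x)))%:E = (expR (- (a * s)) - expR (- (a * t)))%:E.
Proof.
move=> a0 s0 st; rewrite -(survival_cst _ s0) -(survival_cst _ (le_trans s0 st)).
rewrite -(@integral_density_itv _ _ a a)//.
apply: eq_integral => x /set_mem; rewrite /= in_itv/= => /andP[sx _].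
by rewrite survival_cst// (le_trans s0 (ltW sx)).
Qed.

End exponential_integral.

Section dwell.
Context {R : realType} (M : queue R) (pi : decision_rule R) (alpha : R).
Local Notation leb := (@lebesgue_measure R).
Hypotheses (lambda_gt0 : (0 < arrival_rate M)%R) (mu_ge0 : (0 <= service_rate M)%R).
Hypothesis alpha_gt0 : (0 < alpha)%R.
Hypothesis mpi : forall n, measurable_fun [set: history R n * R] (fun p => pi p.1 p.2).

Definition discount (t : R) : R := expR (- alpha * t).

Lemma discount_ge0 t : (0 <= discount t)%R. Proof. exact: expR_ge0. Qed.

Lemma measurable_discount : measurable_fun [set: R] discount.
Proof. by apply: measurableT_comp => //; exact: measurable_funM. Qed.

Definition running n (r : nat -> bool -> R) (h : history R n) (t : R) : \bar R :=
  \int[leb]_(s in `]0%R, t[) (discount s * r (current_state h).1 (pi h s))%:E.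

(** Expected discounted reward earned at rate rho during the sojourn: the sojourn
    lasts at time t with probability survival t ([jump_mean_running]). *)
Definition dwell_mean n (rho : nat -> bool -> R) (h : history R n) : \bar R :=
  \int[leb]_(t in `]0%R, +oo[)
    (discount t * survival (exit_rate M pi h) t * rho (current_state h).1 (pi h t))%:E.

Lemma measurable_running_integrand n r : measurable_fun [set: history R n * R]
  (fun p : history R n * R => (discount p.2 * r (current_state p.1).1 (pi p.1 p.2))%R).
Proof.
apply: measurable_funM.
  exact: (measurableT_comp measurable_discount measurable_snd).
exact: (@measurable_of_state_action _ _ mpi n (fun s a => r s.1 a)).
Qed.

Lemma running_ge0 n r (h : history R n) t : (forall i a, (0 <= r i a)%R) -> 0 <= running r h t.
Proof.
by move=> r0; apply: integral_ge0 => s _; rewrite lee_fin mulr_ge0 ?discount_ge0.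
Qed.

Lemma nnmeas_running n r : (forall i a, (0 <= r i a)%R) ->
  nnmeas (fun p : history R n * R => running r p.1 p.2).
Proof.
move=> r0; split=> [p|]; first exact: running_ge0.
pose f (x : (history R n * R) * R) : \bar R :=
  (if (0 < x.2) && (x.2 < x.1.2) then discount x.2 * r (current_state x.1.1).1 (pi x.1.1 x.2) else 0)%R%:E.
have m2 : measurable_fun [set: (history R n * R) * R] (fun x => x.2).
  exact: measurable_snd.
have m12 : measurable_fun [set: (history R n * R) * R] (fun x => x.1.2).
  exact: (measurableT_comp measurable_snd measurable_fst).
have m11 : measurable_fun [set: (history R n * R) * R] (fun x => x.1.1).
  exact: (measurableT_comp measurable_fst measurable_fst).
have mf : measurable_fun [set: (history R n * R) * R] f.
  apply/measurable_EFinP; apply: measurable_fun_ifT; last exact: measurable_cst.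
    apply: measurable_and; last exact: measurable_fun_ltr.
    by apply: measurable_fun_ltr => //; exact: measurable_cst.
  exact: (measurableT_comp (@measurable_running_integrand n r) (measurable_fun_pair m11 m2)).
have f0 x : (0 <= f x)%E.
  by rewrite lee_fin; case: ifP => // _; rewrite mulr_ge0 ?discount_ge0.
have := measurable_integral_lebesgue mf f0.
apply: eq_measurable_fun => -[h t] _ /=.
rewrite /running [RHS]integral_mkcond; apply: eq_integral => s _.
by rewrite /f /= patchE mem_setE in_itv /=; case: ifP.
Qed.

Lemma measurable_exit_survival n (h : history R n) :
  measurable_fun [set: R] (survival (exit_rate M pi h)).
Proof.
apply: (measurable_survival (measurable_exit_rate M mpi h) lambda_gt0) => t.
  exact: total_rate_ge.
exact: total_rate_le.
Qed.

Lemma measurable_dwell_integrand n (rho : nat -> bool -> R) (h : history R n) :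
  measurable_fun [set: R] (fun t => discount t * survival (exit_rate M pi h) t *
     rho (current_state h).1 (pi h t))%R.
Proof.
have m := measurableT_comp (@measurable_running_integrand n rho) (pair1_measurable h).
have ms := measurable_exit_survival h.
have := measurable_funM ms m; apply: eq_measurable_fun => t _ /=.
by rewrite mulrCA mulrA.
Qed.

Lemma dwell_integrand_ge0 n (rho : nat -> bool -> R) (h : history R n) t :
  (forall i a, (0 <= rho i a)%R) ->
  (0 <= discount t * survival (exit_rate M pi h) t * rho (current_state h).1 (pi h t))%R.
Proof. by move=> r0; rewrite !mulr_ge0 ?discount_ge0// ltW// survival_gt0. Qed.

Lemma dwell_meanD n (rho sigma : nat -> bool -> R) (h : history R n) :
  (forall i a, (0 <= rho i a)%R) -> (forall i a, (0 <= sigma i a)%R) ->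
  dwell_mean (fun i a => rho i a + sigma i a)%R h = dwell_mean rho h + dwell_mean sigma h.
Proof.
move=> r0 s0; rewrite /dwell_mean -ge0_integralD//.
- by apply: eq_integral => t _; rewrite -EFinD mulrDr.
- by move=> t _; rewrite lee_fin dwell_integrand_ge0.
- by apply/measurable_EFinP/measurable_funTS; exact: measurable_dwell_integrand.
- by move=> t _; rewrite lee_fin dwell_integrand_ge0.
- by apply/measurable_EFinP/measurable_funTS; exact: measurable_dwell_integrand.
Qed.

Lemma le_dwell_mean n (rho sigma : nat -> bool -> R) (h : history R n) :
  (forall i a, (0 <= rho i a)%R) ->
  (forall a, (rho (current_state h).1 a <= sigma (current_state h).1 a)%R) ->
  dwell_mean rho h <= dwell_mean sigma h.
Proof.
move=> r0 rs; apply: ge0_le_integral => //.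
- by move=> t _; rewrite lee_fin dwell_integrand_ge0.
- by apply/measurable_EFinP/measurable_funTS; exact: measurable_dwell_integrand.
- by apply/measurable_EFinP/measurable_funTS; exact: measurable_dwell_integrand.
- by move=> t _; rewrite lee_fin ler_wpM2l// mulr_ge0 ?discount_ge0// ltW// survival_gt0.
Qed.

Lemma nnmeas_outcome_reward n (v : nat -> state -> R) (h : history R n) :
  (forall i y, (0 <= v i y)%R) ->
  nnmeas (fun x : R * state => (discount x.1 * v (current_state h).1 x.2)%:E).
Proof.
move=> v0; split=> [x|]; first by rewrite lee_fin mulr_ge0 ?discount_ge0.
apply/measurable_EFinP; apply: measurable_funM.
  exact: (measurableT_comp measurable_discount measurable_fst).
exact: (measurableT_comp (@measurable_state_fun _ _ setT (v (current_state h).1)) measurable_snd).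
Qed.

(** Expected reward per unit of time earned at jumps, when a jump from i to the state
    y pays v i y. *)
Definition outcome_rate (v : nat -> state -> R) (i : nat) (a : bool) : R :=
  (rate M (i%:Z + 1) i a * v i (i.+1, a) + rate M (i%:Z - 1) i a * v i (i.-1, a))%R.

Lemma outcome_rate_ge0 v i a : (forall i y, (0 <= v i y)%R) -> (0 <= outcome_rate v i a)%R.
Proof. by move=> v0; rewrite addr_ge0// mulr_ge0// rate_ge0. Qed.

Lemma jump_mean_outcome n v (h : history R n) : (forall i y, (0 <= v i y)%R) ->
  jump_mean M pi h (fun x => (discount x.1 * v (current_state h).1 x.2)%:E) =
  dwell_mean (outcome_rate v) h.
Proof.
move=> v0; rewrite (jump_meanE lambda_gt0 mu_ge0 mpi); last exact: nnmeas_outcome_reward.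
apply: eq_integral => t _; rewrite -!EFinM -EFinD; congr _%:E.
rewrite /jump_weight /jump_outcome /jump_rate /outcome_rate /=.
by ring.
Qed.

(** Tonelli: the reward at time s is earned when the jump comes after s, and the
    density of the jump time integrates to survival s beyond s. *)
Lemma jump_mean_running n r (h : history R n) : (forall i a, (0 <= r i a)%R) ->
  jump_mean M pi h (fun x => running r h x.1) = dwell_mean r h.
Proof.
move=> r0.
have [run0 mrun] := nnmeas_running n r0.
have mrunh : measurable_fun [set: R] (running r h).
  by have := measurableT_comp mrun (pair1_measurable h).
rewrite (jump_meanE lambda_gt0 mu_ge0 mpi); last first.
  split=> [x|]; first exact: run0 (h, x.1).
  exact: (measurableT_comp mrunh measurable_fst).
pose q := exit_rate M pi h.
pose phi s := (discount s * r (current_state h).1 (pi h s))%R.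
have phi0 s : (0 <= phi s)%R by rewrite mulr_ge0 ?discount_ge0.
have mphi : measurable_fun [set: R] phi.
  by have := measurableT_comp (@measurable_running_integrand n r) (pair1_measurable h).
have mq : measurable_fun [set: R] q by exact: measurable_exit_rate.
have ql t : (arrival_rate M <= q t)%R by exact: total_rate_ge.
have qQ t : (q t <= total_rate M (current_state h).1 true)%R by exact: total_rate_le.
have qG0 t : (0 <= q t * survival q t)%R.
  by rewrite mulr_ge0//; [exact: le_trans (ltW lambda_gt0) (ql t)|exact/ltW/survival_gt0].
have mqG : measurable_fun [set: R] (fun t => q t * survival q t)%R.
  by apply: measurable_funM => //; exact: measurable_exit_survival.
pose f (x : R * R) : \bar R :=
  (if (0 < x.2) && (x.2 < x.1) then (q x.1 * survival q x.1) * phi x.2 else 0)%R%:E.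
have f0 x : 0 <= f x.
  by rewrite lee_fin; case: ifP => // _; exact: mulr_ge0.
have mf : measurable_fun [set: R * R] f.
  apply/measurable_EFinP; apply: measurable_fun_ifT; last exact: measurable_cst.
    apply: measurable_and.
      by apply: measurable_fun_ltr; [exact: measurable_cst|exact: measurable_snd].
    by apply: measurable_fun_ltr; [exact: measurable_snd|exact: measurable_fst].
  apply: measurable_funM.
    exact: (measurableT_comp mqG measurable_fst).
  exact: (measurableT_comp mphi measurable_snd).
transitivity (\int[leb]_x \int[leb]_y f (x, y)).
  rewrite integral_mkcond; apply: eq_integral => t _; rewrite patchE mem_setE in_itv/= andbT.
  case: ifPn => [t0|t0]; last first.
    rewrite integral0_eq// => s _; rewrite /f/= ifF//.
    by apply/negbTE/negP => /andP[s0 st]; move: t0; rewrite (lt_trans s0 st).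
  rewrite -ge0_muleDl ?lee_fin ?jump_weight_ge0// -EFinD.
  have -> : (jump_weight M pi true h t + jump_weight M pi false h t = q t * survival q t)%R.
    by rewrite -mulrDr mulrC; congr (_ * _)%R; exact: rate_sum.
  rewrite /running/= integral_mkcond -ge0_integralZl_EFin//.
  - apply: eq_integral => s _; rewrite patchE mem_setE in_itv/= /f /=.
    by case: ifP => // _; rewrite mule0.
  - by move=> s _; rewrite patchE; case: ifP => // _; rewrite lee_fin; exact: phi0.
  - by apply: (measurable_restrictT _ _).1 => //; apply/measurable_EFinP; exact: measurable_funTS.
rewrite lebesgue_tonelli// /dwell_mean [RHS]integral_mkcond.
apply: eq_integral => s _; rewrite patchE mem_setE in_itv/= andbT.
case: ifPn => [s0|s0]; last first.
  by rewrite integral0_eq// => t _; rewrite /f/= (negbTE s0).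
transitivity ((phi s)%:E * \int[leb]_(t in `]s, +oo[) (q t * survival q t)%:E).
  rewrite [in RHS]integral_mkcond -ge0_integralZl_EFin//.
  - apply: eq_integral => t _; rewrite patchE mem_setE in_itv/= andbT /f /= s0 /=.
    by case: ifP => // _; rewrite ?mule0// mulrC.
  - by move=> t _; rewrite patchE; case: ifP => // _; rewrite lee_fin; exact: qG0.
  - by apply: (measurable_restrictT _ _).1 => //; apply/measurable_EFinP; exact: measurable_funTS.
rewrite (integral_density mq lambda_gt0 ql qQ (ltW s0)) -EFinM; congr _%:E.
by rewrite /phi mulrAC.
Qed.

Lemma jump_mean_step n v r (h : history R n) :
  (forall i y, (0 <= v i y)%R) -> (forall i a, (0 <= r i a)%R) ->
  jump_mean M pi h (fun x => (discount x.1 * v (current_state h).1 x.2)%:E + running r h x.1) =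
  dwell_mean (fun i a => outcome_rate v i a + r i a)%R h.
Proof.
move=> v0 r0; rewrite dwell_meanD//; last by move=> i a; exact: outcome_rate_ge0.
rewrite -jump_mean_outcome// -jump_mean_running//.
rewrite (functionalD (jump_mean_functional lambda_gt0 mu_ge0 mpi h))//.
  exact: nnmeas_outcome_reward.
have [run0 mrun] := nnmeas_running n r0.
have mrunh : measurable_fun [set: R] (running r h).
  by have := measurableT_comp mrun (pair1_measurable h).
split=> [x|]; first exact: run0 (h, x.1).
exact: (measurableT_comp mrunh measurable_fst).
Qed.

(** A reward at rate alpha k followed by the lump sum k at the jump is worth k
    whatever the length of the sojourn, and the lump sum amounts to the rate
    q k. *)
Lemma dwell_mean_balanced n (k : nat -> R) (h : history R n) : (forall i, (0 <= k i)%R) ->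
  dwell_mean (fun i a => (alpha + total_rate M i a) * k i)%R h = (k (current_state h).1)%:E.
Proof.
move=> k0.
have -> : (fun i a => (alpha + total_rate M i a) * k i)%R =
    (fun i a => outcome_rate (fun i _ => k i) i a + alpha * k i)%R.
  apply/funext => i; apply/funext => a.
  by rewrite /outcome_rate -rate_sum; ring.
rewrite -(@jump_mean_step n (fun i _ => k i) (fun i _ => alpha * k i)%R)//; last first.
  by move=> i _; rewrite mulr_ge0// ltW.
set kh := k _.
transitivity (jump_mean M pi h (fun=> kh%:E * 1)); last first.
  have n1 : nnmeas (fun _ : R * state => 1 : \bar R).
    by split => //; exact: measurable_cst.
  rewrite (functionalZ (jump_mean_functional lambda_gt0 mu_ge0 mpi h) (k0 _) n1).
  by rewrite jump_mean1// mule1.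
have mexp : measurable_fun [set: R] (fun s : R => alpha * expR (- (alpha * s)))%R.
  apply: measurable_funM => //; apply: measurableT_comp => //.
  by apply: measurableT_comp => //; exact: measurable_funM.
rewrite /jump_mean /jump_part.
have E up t : t \in `]0%R, +oo[%classic ->
    (discount (jump_outcome pi up h t).1 * kh)%:E +
    running (fun i _ => alpha * k i)%R h (jump_outcome pi up h t).1 = kh%:E * 1.
  rewrite inE /= in_itv/= andbT => t0.
  rewrite /running -/kh.
  transitivity ((discount t * kh)%:E + kh%:E * \int[leb]_(s in `]0%R, t]) (alpha * expR (- (alpha * s)))%:E).
    congr (_ + _); rewrite -ge0_integralZl_EFin; [|exact: measurable_itv| | |exact: k0].
    - rewrite -integral_itv_bndo_bndc.
        apply: eq_integral => s _; rewrite -EFinM; congr _%:E.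
        by rewrite /discount mulNr mulrCA mulrA mulrC.
      by apply: measurable_funTS; apply: measurable_funeM; exact/measurable_EFinP.
    - by move=> s _; rewrite lee_fin mulr_ge0 ?expR_ge0// ltW.
    - by apply/measurable_EFinP; exact: measurable_funTS.
  rewrite integral_exp_itvoc// ?ltW// mulr0 oppr0 expR0 -EFinM -EFinD mule1; congr _%:E.
  by rewrite /discount mulNr; ring.
by congr (_ + _); apply: eq_integral => t t0; rewrite E.
Qed.

End dwell.

(** * Expected discounted rewards along a path *)

Section path_times.
Context {R : realType} (z : state).

Definition history_time n (h : history R n) : R := (\sum_(i < n) (tnth h.2 i).1)%R.

Lemma history_time_of (w : path R) n : history_time (history_of z w n) = jump_time w n :> R.
Proof. by apply: eq_bigr => i _; rewrite tnth_mktuple. Qed.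

Lemma current_state0 (w : path R) : current_state (history_of z w 0) = z :> state.
Proof. by rewrite /current_state (tuple0 (history_of z w 0).2). Qed.

Lemma current_stateS (w : path R) n : current_state (history_of z w n.+1) = (w n).2.
Proof.
by rewrite current_state_last tnth_mktuple.
Qed.

Lemma jump_time0 (w : path R) : jump_time w 0 = 0%R.
Proof. by rewrite /jump_time big_ord0. Qed.

Lemma jump_timeS (w : path R) n : jump_time w n.+1 = (jump_time w n + (w n).1)%R.
Proof. by rewrite /jump_time big_ord_recr. Qed.

Lemma measurable_history_time n : measurable_fun [set: history R n] (@history_time n).
Proof.
apply: measurable_sum => i.
apply: (measurableT_comp measurable_fst).
exact: (measurableT_comp (measurable_tnth i) measurable_snd).
Qed.

Lemma measurable_jump_time n : measurable_fun [set: path R] (fun w : path R => jump_time w n).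
Proof.
apply: measurable_sum => i; apply: (measurableT_comp measurable_fst).
exact: measurable_coordinate.
Qed.

Lemma measurable_of_current_state (k : state -> R) n :
  measurable_fun [set: path R] (fun w : path R => k (current_state (history_of z w n))).
Proof.
exact: (measurableT_comp (@measurable_state_fun _ _ setT k)
  (measurableT_comp (@measurable_current_state R n) (@measurable_history_of R z n))).
Qed.

End path_times.

Section expected_discounted.
Context {R : realType} (M : queue R) (pi : decision_rule R) (alpha : R) (z : state).
Hypotheses (lambda_gt0 : (0 < arrival_rate M)%R) (mu_ge0 : (0 <= service_rate M)%R).
Hypothesis alpha_gt0 : (0 < alpha)%R.
Hypothesis mpi : forall n, measurable_fun [set: history R n * R] (fun p => pi p.1 p.2).
Variable P : probability (path R) R.
Hypothesis lawP : is_path_law M pi z P.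
Local Notation disc := (discount alpha).
Local Notation hist w n := (history_of z w n).

Definition jump_value (k : state -> R) n : \bar R :=
  \int[P]_w (disc (jump_time w n) * k (current_state (hist w n)))%:E.

Definition dwell_value (rho : nat -> bool -> R) n : \bar R :=
  \int[P]_w ((disc (jump_time w n))%:E * dwell_mean M pi alpha rho (hist w n)).

Lemma nnmeas_jump_value (k : state -> R) n : (forall y, (0 <= k y)%R) ->
  nnmeas (fun w : path R => (disc (jump_time w n) * k (current_state (hist w n)))%:E).
Proof.
move=> k0; split=> [w|]; first by rewrite lee_fin mulr_ge0 ?discount_ge0.
apply/measurable_EFinP; apply: measurable_funM; last exact: measurable_of_current_state.
exact: (measurableT_comp (measurable_discount alpha) (@measurable_jump_time R n)).
Qed.

Lemma jump_value_ge0 k n : (forall y, (0 <= k y)%R) -> 0 <= jump_value k n.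
Proof. by move=> k0; apply: integral_ge0 => w _; exact: (nnmeas_jump_value n k0).1. Qed.

Lemma le_jump_value (k l : state -> R) n : (forall y, (0 <= k y)%R) ->
  (forall y, (k y <= l y)%R) -> jump_value k n <= jump_value l n.
Proof.
move=> k0 kl; apply: le_integral_lower => w; first exact: (nnmeas_jump_value n k0).1.
by rewrite lee_fin ler_wpM2l ?discount_ge0.
Qed.

Lemma jump_valueZ (c : R) (k : state -> R) n : (0 <= c)%R -> (forall y, (0 <= k y)%R) ->
  jump_value (fun y => c * k y)%R n = c%:E * jump_value k n.
Proof.
move=> c0 k0; have [nn mm] := nnmeas_jump_value n k0.
rewrite -ge0_integralZl_EFin//; apply: eq_integral => w _.
by rewrite -EFinM mulrCA.
Qed.

Lemma jump_value0 k : jump_value k 0 = (k z)%:E.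
Proof.
rewrite /jump_value (eq_integral (cst (k z)%:E)); last first.
  by move=> w _; rewrite jump_time0 current_state0 /discount mulr0 expR0 mul1r.
by rewrite integral_cst//= probability_setT mule1.
Qed.

Lemma dwell_value_balanced (k : nat -> R) n : (forall i, (0 <= k i)%R) ->
  dwell_value (fun i a => (alpha + total_rate M i a) * k i)%R n =
  jump_value (fun y => k y.1) n.
Proof.
move=> k0; apply: eq_integral => w _.
by rewrite dwell_mean_balanced.
Qed.

Lemma dwell_mean_ge0 rho n (h : history R n) : (forall i a, (0 <= rho i a)%R) ->
  0 <= dwell_mean M pi alpha rho h.
Proof. by move=> r0; apply: integral_ge0 => t _; rewrite lee_fin dwell_integrand_ge0. Qed.

Lemma le_dwell_value (rho sigma : nat -> bool -> R) n :
  (forall i a, (0 <= rho i a)%R) -> (forall i a, (rho i a <= sigma i a)%R) ->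
  dwell_value rho n <= dwell_value sigma n.
Proof.
move=> r0 rs; apply: le_integral_lower => w.
  by rewrite mule_ge0 ?dwell_mean_ge0// lee_fin discount_ge0.
by rewrite lee_wpmul2l ?lee_fin ?discount_ge0//; exact: le_dwell_mean.
Qed.

Lemma nnmeas_dwell_value rho n : (forall i a, (0 <= rho i a)%R) ->
  nnmeas (fun w : path R => (disc (jump_time w n))%:E * dwell_mean M pi alpha rho (hist w n)).
Proof.
move=> r0; split=> [w|].
  by rewrite mule_ge0 ?dwell_mean_ge0// lee_fin discount_ge0.
apply: emeasurable_funM.
  apply/measurable_EFinP.
  exact: (measurableT_comp (measurable_discount alpha) (@measurable_jump_time R n)).
have nf : nnmeas (fun p : history R n * (R * state) => running pi alpha rho p.1 p.2.1).
  have [r1 mr] := nnmeas_running alpha mpi n r0.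
  split=> [p|]; first exact: (r1 (p.1, p.2.1)).
  have mg : measurable_fun [set: history R n * (R * state)] (fun p => (p.1, p.2.1)).
    apply: measurable_fun_pair; first exact: measurable_fst.
    exact: (measurableT_comp measurable_fst measurable_snd).
  exact: (measurableT_comp mr mg).
have := measurableT_comp (measurable_jump_mean lambda_gt0 mu_ge0 mpi nf) (@measurable_history_of R z n).
apply: eq_measurable_fun => w _ /=.
by rewrite jump_mean_running.
Qed.

Lemma dwell_valueD rho sigma n : (forall i a, (0 <= rho i a)%R) -> (forall i a, (0 <= sigma i a)%R) ->
  dwell_value (fun i a => rho i a + sigma i a)%R n = dwell_value rho n + dwell_value sigma n.
Proof.
move=> r0 s0; have [rr mr] := nnmeas_dwell_value n r0; have [ss ms] := nnmeas_dwell_value n s0.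
rewrite -ge0_integralD//; apply: eq_integral => w _.
by rewrite dwell_meanD// ge0_muleDr ?dwell_mean_ge0.
Qed.

Definition sojourn_reward (v : nat -> state -> R) (r : nat -> bool -> R) n (w : path R) : \bar R :=
  (disc (jump_time w n))%:E *
  ((disc (w n).1 * v (current_state (hist w n)).1 (w n).2)%:E +
   running pi alpha r (hist w n) (w n).1).

Section sojourn.
Variables (v : nat -> state -> R) (r : nat -> bool -> R).
Hypotheses (v0 : forall i y, (0 <= v i y)%R) (r0 : forall i a, (0 <= r i a)%R).

Let G n (p : history R n * (R * state)) : \bar R :=
  (disc (history_time p.1))%:E * ((disc p.2.1 * v (current_state p.1).1 p.2.2)%:E +
     running pi alpha r p.1 p.2.1).

Let nnmeas_inner n : nnmeas (fun p : history R n * (R * state) =>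
  (disc p.2.1 * v (current_state p.1).1 p.2.2)%:E + running pi alpha r p.1 p.2.1).
Proof.
apply: nnmeasD.
  split=> [p|]; first by rewrite lee_fin mulr_ge0 ?discount_ge0.
  apply/measurable_EFinP; apply: measurable_funM.
    apply: (measurableT_comp (measurable_discount alpha)).
    exact: (measurableT_comp measurable_fst measurable_snd).
  have mg : measurable_fun [set: history R n * (R * state)]
      (fun p => (current_state p.1, p.2.2)).
    apply: measurable_fun_pair; last exact: (measurableT_comp measurable_snd measurable_snd).
    exact: (measurableT_comp (@measurable_current_state R n) measurable_fst).
  exact: (measurableT_comp (measurable_state2_fun (fun q : state * state => v q.1.1 q.2)) mg).
have [r1 mr] := nnmeas_running alpha mpi n r0.
split=> [p|]; first exact: (r1 (p.1, p.2.1)).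
have mg : measurable_fun [set: history R n * (R * state)] (fun p => (p.1, p.2.1)).
  apply: measurable_fun_pair; first exact: measurable_fst.
  exact: (measurableT_comp measurable_fst measurable_snd).
exact: (measurableT_comp mr mg).
Qed.

Let nnmeas_G n : nnmeas (@G n).
Proof.
split=> [p|].
  by rewrite mule_ge0 ?(nnmeas_inner n).1// lee_fin discount_ge0.
apply: emeasurable_funM; last exact: (nnmeas_inner n).2.
apply/measurable_EFinP; apply: (measurableT_comp (measurable_discount alpha)).
exact: (measurableT_comp (@measurable_history_time R n) measurable_fst).
Qed.

Lemma nnmeas_sojourn_reward n : nnmeas (sojourn_reward v r n).
Proof.
have [g0 mg] := nnmeas_G n.
split=> [w|].
  by have := g0 (hist w n, w n); rewrite /G /= history_time_of.
have := measurableT_comp mg (@measurable_next R z n).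
by apply: eq_measurable_fun => w _; rewrite /= /G /= history_time_of.
Qed.

(** Given the history, the mean of the reward is that of [jump_mean_step]. *)
Lemma integral_sojourn_reward n :
  \int[P]_w sojourn_reward v r n w = dwell_value (fun i a => outcome_rate M v i a + r i a)%R n.
Proof.
transitivity (\int[P]_w @G n (hist w n, w n)).
  by apply: eq_integral => w _; rewrite /G /= history_time_of.
rewrite (is_path_law_mean lambda_gt0 mu_ge0 mpi lawP (nnmeas_G n)).
apply: eq_integral => w _; rewrite /G /=.
rewrite (functionalZ (jump_mean_functional lambda_gt0 mu_ge0 mpi (hist w n)) (discount_ge0 _ _)).
  by rewrite history_time_of jump_mean_step.
have [i0 mi] := nnmeas_inner n.
by split=> [x|]; [exact: (i0 (hist w n, x))|exact: (measurableT_comp mi (pair1_measurable (hist w n)))].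
Qed.

End sojourn.
End expected_discounted.

(** * A Lyapunov function for the discounted queue *)

Section lyapunov.
Context {R : realType} (M : queue R) (alpha : R).
Hypotheses (lambda_gt0 : (0 < arrival_rate M)%R) (mu_ge0 : (0 <= service_rate M)%R).
Hypothesis alpha_gt0 : (0 < alpha)%R.

(** The constants serve [lyapunov_algebra].  An arrival raises the square of a level
    X >= 1 by 2 X + 1 <= 3 X, so with 6 lambda <= alpha X arrivals use up half of
    the discount alpha X ^+ 2.  The other half pays for the drift. *)
Definition level_shift : R := (1 + 6 * arrival_rate M / alpha)%R.
Definition level (i : nat) : R := (i%:R + level_shift)%R.
Definition drift : R := (alpha / (2 * (alpha + arrival_rate M + service_rate M)))%R.

Lemma level_shift_ge1 : (1 <= level_shift)%R.
Proof. by rewrite lerDl divr_ge0 ?mulr_ge0// ltW. Qed.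

Lemma level_ge1 i : (1 <= level i)%R.
Proof. by apply: le_trans level_shift_ge1 _; rewrite lerDr. Qed.

Lemma level_gt0 i : (0 < level i)%R.
Proof. exact: lt_le_trans ltr01 (level_ge1 i). Qed.

Lemma drift_gt0 : (0 < drift)%R.
Proof. by rewrite divr_gt0// mulr_gt0// ltr_wpDr// addr_gt0. Qed.

Lemma lyapunov_algebra (al la mu X x : R) : (0 < al)%R -> (0 < la)%R -> (0 <= mu)%R ->
  (0 <= x)%R -> (x + 1 <= X)%R -> (6 * la <= al * X)%R -> forall a : bool,
  (la * (X + 1) ^+ 2 + a%:R * x * mu * (X - 1) ^+ 2 +
    al / (2 * (al + la + mu)) * ((al + (la + a%:R * x * mu)) * X)
   <= (al + (la + a%:R * x * mu)) * X ^+ 2)%R.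
Proof.
move=> al0 la0 mu0 x0 xX laX a.
set m := (a%:R * x * mu)%R.
have m0 : (0 <= m)%R by rewrite !mulr_ge0.
have mX : (m <= mu * X)%R.
  rewrite /m; case: a {m m0}; rewrite ?mul0r ?mul1r; last by rewrite mulr_ge0//; lra.
  by rewrite mulrC ler_wpM2l//; lra.
have D0 : (0 < al + la + mu)%R by lra.
have X1 : (1 <= X)%R by lra.
have h1 : (0 <= m * (2 * X - 1))%R by rewrite mulr_ge0//; lra.
have h2 : (0 <= (al * X - 6 * la) * X)%R by rewrite mulr_ge0//; lra.
have h3 : (0 <= la * (X - 1))%R by rewrite mulr_ge0//; lra.
have h4 : (0 <= (al + la) * (X - 1))%R by rewrite mulr_ge0//; lra.
have bound : (al / (2 * (al + la + mu)) * ((al + (la + m)) * X) <= al / 2 * X ^+ 2)%R.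
  rewrite (_ : al / (2 * (al + la + mu)) = al / 2 * (al + la + mu)^-1)%R; last by field; lra.
  rewrite -[leLHS]mulrA ler_wpM2l//; first by lra.
  rewrite mulrC ler_pdivrMr//.
  rewrite (_ : X ^+ 2 * (al + la + mu) = (al + la + mu) * X * X)%R; last by ring.
  by rewrite ler_wpM2r//; lra.
have {}bound := lerD (lexx (la * (X + 1) ^+ 2 + m * (X - 1) ^+ 2)%R) bound.
apply: le_trans bound _; rewrite -subr_ge0.
rewrite (_ : _ - _ = m * (2 * X - 1) + (al * X - 6 * la) * X / 2 + la * (X - 1))%R; last by field.
by rewrite !addr_ge0// mulr_ge0// invr_ge0.
Qed.

(** Departures only lower the level, and their rate is at most proportional to it;
    this is why the drift is uniform in the action. *)
Lemma lyapunov_drift i a :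
  (outcome_rate M (fun _ y => level y.1 ^+ 2) i a +
   (alpha + total_rate M i a) * (drift * level i) <=
   (alpha + total_rate M i a) * level i ^+ 2)%R.
Proof.
rewrite /outcome_rate -rate_sum rate_up rate_down /=.
have X1 : (i%:R + 1 <= level i)%R by rewrite lerD2l level_shift_ge1.
have X6 : (6 * arrival_rate M <= alpha * level i)%R.
  rewrite /level /level_shift mulrDr mulrDr mulr1 mulrCA divff ?gt_eqF// mulr1.
  by rewrite addrA lerDr addr_ge0// ?mulr_ge0// ltW.
have := lyapunov_algebra alpha_gt0 lambda_gt0 mu_ge0 (ler0n _ i) X1 X6 a.
apply: le_trans; rewrite le_eqVlt; apply/orP; left; apply/eqP.
rewrite -/drift.
have -> : level i.+1 = (level i + 1)%R by rewrite /level -natr1; ring.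
case: i {X1 X6} => [|i]; first by rewrite /= mulr0 !mul0r; ring.
have -> : level i.+1.-1 = (level i.+1 - 1)%R by rewrite /level -natr1 /=; ring.
by ring.
Qed.

End lyapunov.

Section expected_bounds.
Context {R : realType} (M : queue R) (pi : decision_rule R) (alpha : R) (z : state).
Hypotheses (lambda_gt0 : (0 < arrival_rate M)%R) (mu_ge0 : (0 <= service_rate M)%R).
Hypothesis alpha_gt0 : (0 < alpha)%R.
Hypothesis mpi : forall n, measurable_fun [set: history R n * R] (fun p => pi p.1 p.2).
Variable P : probability (path R) R.
Hypothesis lawP : is_path_law M pi z P.
Local Notation disc := (discount alpha).
Local Notation hist w n := (history_of z w n).
Local Notation level := (level M alpha).
Local Notation jv := (@jump_value R alpha z P).
Local Notation dv := (dwell_value M pi alpha z P).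

Lemma running0 n (h : history R n) t : running pi alpha (fun _ _ => 0%R) h t = 0.
Proof. by rewrite /running; under eq_integral do rewrite mulr0; rewrite integral0. Qed.

Lemma jump_valueS (v : state -> R) n : (forall y, (0 <= v y)%R) ->
  jv v n.+1 = dv (outcome_rate M (fun _ => v)) n.
Proof.
move=> v0.
have := @integral_sojourn_reward R M pi alpha z lambda_gt0 mu_ge0 mpi P lawP
  (fun _ => v) (fun _ _ => 0%R) (fun _ => v0) (fun _ _ => lexx 0%R) n.
have -> : (fun i a => outcome_rate M (fun _ => v) i a + 0)%R = outcome_rate M (fun _ => v).
  by apply/funext => i; apply/funext => a; rewrite addr0.
move=> <-; apply: eq_integral => w _.
rewrite /sojourn_reward running0 adde0 jump_timeS current_stateS -EFinM mulrA; congr (_ * _)%:E.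
by rewrite /discount mulrDr expRD.
Qed.

(** Discounted mean of [lyapunov_drift]. *)
Lemma jump_value_drift n :
  jv (fun y => level y.1 ^+ 2)%R n.+1 + (drift M alpha)%:E * jv (fun y => level y.1) n <=
  jv (fun y => level y.1 ^+ 2)%R n.
Proof.
have l0 i : (0 <= level i)%R by exact/ltW/level_gt0.
have d0 : (0 <= drift M alpha)%R by exact/ltW/drift_gt0.
have q0 i a : (0 <= alpha + total_rate M i a)%R.
  by rewrite addr_ge0 ?(ltW alpha_gt0)// (le_trans (ltW lambda_gt0))// total_rate_ge.
have o0 i a : (0 <= outcome_rate M (fun _ y => level y.1 ^+ 2) i a)%R.
  by apply: outcome_rate_ge0 => // j y; exact: sqr_ge0.
rewrite jump_valueS; last by move=> y; exact: sqr_ge0.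
rewrite -jump_valueZ// -(@dwell_value_balanced R M pi alpha z _ _ _ _ P (fun i => drift M alpha * level i)%R)//; last first.
  by move=> i; rewrite mulr_ge0.
rewrite -dwell_valueD//; last by move=> i a; apply: mulr_ge0; [exact: q0|exact: mulr_ge0].
rewrite -(@dwell_value_balanced R M pi alpha z _ _ _ _ P (fun i => level i ^+ 2)%R)//.
  apply: le_dwell_value => // [i a|i a].
    by apply: addr_ge0; [exact: o0|apply: mulr_ge0; [exact: q0|exact: mulr_ge0]].
  exact: lyapunov_drift.
by move=> i; exact: sqr_ge0.
Qed.

Lemma jump_value_sqr_fin n : jv (fun y => level y.1 ^+ 2)%R n \is a fin_num.
Proof.
have s0 m : 0 <= jv (fun y => level y.1 ^+ 2)%R m.
  by apply: jump_value_ge0 => y; exact: sqr_ge0.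
have l0 m : 0 <= jv (fun y => level y.1) m.
  by apply: jump_value_ge0 => y; exact/ltW/level_gt0.
elim: n => [|n IH]; first by rewrite jump_value0.
rewrite ge0_fin_numE//; apply: le_lt_trans (_ : _ < +oo); last first.
  by move: IH; rewrite ge0_fin_numE//; exact.
apply: le_trans (jump_value_drift n); rewrite leeDl// mule_ge0// lee_fin.
exact/ltW/drift_gt0.
Qed.

Lemma jump_value_level_fin n : jv (fun y => level y.1) n \is a fin_num.
Proof.
rewrite ge0_fin_numE; last first.
  by apply: jump_value_ge0 => y; exact/ltW/level_gt0.
apply: le_lt_trans (_ : _ < +oo); last first.
  by have := jump_value_sqr_fin n; rewrite ge0_fin_numE; [exact|apply: jump_value_ge0 => y; exact: sqr_ge0].
apply: le_jump_value => y; first exact/ltW/level_gt0.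
rewrite expr2 -[leLHS]mulr1 ler_wpM2l//; [exact/ltW/level_gt0|exact: level_ge1].
Qed.

(** The discounted squares are nonincreasing and their decrements dominate the
    discounted levels. *)
Lemma jump_value_level_cvg0 : jv (fun y => level y.1) n @[n --> \oo] --> 0.
Proof.
pose d n := fine (jv (fun y => level y.1 ^+ 2)%R n).
pose l n := fine (jv (fun y => level y.1) n).
have dE n : jv (fun y => level y.1 ^+ 2)%R n = (d n)%:E.
  by rewrite /d fineK// jump_value_sqr_fin.
have lE n : jv (fun y => level y.1) n = (l n)%:E.
  by rewrite /l fineK// jump_value_level_fin.
have d0 n : (0 <= d n)%R.
  by rewrite -lee_fin -dE; apply: jump_value_ge0 => y; rewrite sqr_ge0.
have l0 n : (0 <= l n)%R.
  by rewrite -lee_fin -lE; apply: jump_value_ge0 => y; exact/ltW/level_gt0.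
have step n : (d n.+1 + drift M alpha * l n <= d n)%R.
  by have := jump_value_drift n; rewrite !dE lE -EFinM -EFinD lee_fin.
have dr0 : (0 < drift M alpha)%R by exact: drift_gt0.
have cd : cvgn d.
  apply: nonincreasing_is_cvgn.
    by apply/nonincreasing_seqP => n; apply: le_trans (step n); rewrite lerDl mulr_ge0// ltW.
  by exists 0%R => _ [n _ <-].
have dd : (d n - d n.+1)%R @[n --> \oo] --> (0 : R)%R.
  rewrite -(subrr (limn d)); apply: cvgB => //.
  by rewrite (cvg_shiftS d).
have dl : ((drift M alpha)^-1 * (d n - d n.+1))%R @[n --> \oo] --> (0 : R)%R.
  by rewrite -(mulr0 ((drift M alpha)^-1)%R); exact: cvgMr.
under eq_fun do rewrite lE.
apply: cvg_EFin; first exact: nearW.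
apply: (squeeze_cvgr _ (cvg_cst 0%R) dl); apply: nearW => n.
by rewrite l0/= ler_pdivlMl//; have := step n; lra.
Qed.

Lemma dwell_value_fin (rho : nat -> bool -> R) (C : R) n :
  (forall i a, (0 <= rho i a)%R) -> (forall i a, (rho i a <= C * level i)%R) ->
  dv rho n \is a fin_num.
Proof.
move=> r0 rC.
have C0 : (0 <= C)%R.
  by have := le_trans (r0 0%N true) (rC 0%N true); rewrite pmulr_lge0// level_gt0.
have l0 i : (0 <= C / alpha * level i)%R.
  by rewrite mulr_ge0 ?divr_ge0 ?(ltW alpha_gt0)//; exact/ltW/level_gt0.
rewrite ge0_fin_numE; last first.
  apply: integral_ge0 => w _; rewrite mule_ge0 ?lee_fin ?discount_ge0//.
  exact: dwell_mean_ge0.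
apply: (@le_lt_trans _ _ (dv (fun i a => (alpha + total_rate M i a) * (C / alpha * level i))%R n)).
  apply: le_dwell_value => // i a; apply: le_trans (rC i a) _.
  rewrite (_ : C * level i = alpha * (C / alpha * level i))%R; last by field; rewrite gt_eqF.
  rewrite ler_wpM2r// lerDl (le_trans (ltW lambda_gt0))// total_rate_ge//.
rewrite dwell_value_balanced// jump_valueZ ?divr_ge0 ?(ltW alpha_gt0)//; last first.
  by move=> y; exact/ltW/level_gt0.
by rewrite lte_mul_pinfty ?lee_fin ?divr_ge0 ?(ltW alpha_gt0)// -ge0_fin_numE ?jump_value_level_fin//;
  apply: jump_value_ge0 => y; exact/ltW/level_gt0.
Qed.

End expected_bounds.

(** * Expected verification inequality *)

Section verification.
Context {R : realType} (M : queue R) (pi : decision_rule R) (alpha : R) (z : state).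
Hypotheses (lambda_gt0 : (0 < arrival_rate M)%R) (mu_ge0 : (0 <= service_rate M)%R).
Hypothesis alpha_gt0 : (0 < alpha)%R.
Hypothesis mpi : forall n, measurable_fun [set: history R n * R] (fun p => pi p.1 p.2).
Variable P : probability (path R) R.
Hypothesis lawP : is_path_law M pi z P.
Local Notation disc := (discount alpha).
Local Notation hist w n := (history_of z w n).
Local Notation level := (level M alpha).
Local Notation jv := (@jump_value R alpha z P).
Local Notation dv := (dwell_value M pi alpha z P).
Local Notation reward := (sojourn_reward pi alpha z).

Lemma jump_value_fin (k : state -> R) (C : R) n : (forall y, (0 <= k y)%R) ->
  (forall y, (k y <= C * level y.1)%R) -> jv k n \is a fin_num.
Proof.
move=> k0 kC.
have l0 (y : state) : (0 <= level y.1)%R by exact/ltW/level_gt0.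
have C0 : (0 <= C)%R.
  by have := le_trans (k0 (0%N, true)) (kC (0%N, true)); rewrite pmulr_lge0// level_gt0.
rewrite ge0_fin_numE ?jump_value_ge0//.
apply: le_lt_trans (le_jump_value alpha z P n k0 kC) _.
rewrite jump_valueZ// lte_mul_pinfty ?lee_fin// -ge0_fin_numE ?jump_value_ge0//.
exact: (jump_value_level_fin lambda_gt0 mu_ge0 alpha_gt0 mpi lawP).
Qed.

Lemma jump_value_cvg0 (k : state -> R) (C : R) : (forall y, (0 <= k y)%R) ->
  (forall y, (k y <= C * level y.1)%R) -> jv k n @[n --> \oo] --> 0.
Proof.
move=> k0 kC.
have l0 (y : state) : (0 <= level y.1)%R by exact/ltW/level_gt0.
have C0 : (0 <= C)%R.
  by have := le_trans (k0 (0%N, true)) (kC (0%N, true)); rewrite pmulr_lge0// level_gt0.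
have cl : C%:E * jv (fun y => level y.1) n @[n --> \oo] --> C%:E * 0.
  by apply: cvgeMl => //; exact: (jump_value_level_cvg0 lambda_gt0 mu_ge0 alpha_gt0 mpi lawP).
rewrite mule0 in cl.
apply: (squeeze_cvge _ (cvg_cst 0) cl); apply: nearW => n.
rewrite jump_value_ge0//= -jump_valueZ//; exact: le_jump_value.
Qed.

Lemma integral_sum_sojourns (k : state -> R) v r N : (forall y, (0 <= k y)%R) ->
  (forall i y, (0 <= v i y)%R) -> (forall i a, (0 <= r i a)%R) ->
  \int[P]_w (\sum_(n < N) ((disc (jump_time w n) * k (current_state (hist w n)))%:E + reward v r n w)) =
  \sum_(n < N) (jv k n + dv (fun i a => outcome_rate M v i a + r i a)%R n).
Proof.
move=> k0 v0 r0; have jn n := nnmeas_jump_value alpha z n k0.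
have rn n := nnmeas_sojourn_reward alpha z mpi v0 r0 n.
rewrite ge0_integral_sum//.
- apply: eq_bigr => n _; rewrite ge0_integralD//.
  + by rewrite (integral_sojourn_reward alpha lambda_gt0 mu_ge0 mpi lawP v0 r0).
  + by move=> w _; exact: (jn n).1.
  + exact: (jn n).2.
  + by move=> w _; exact: (rn n).1.
  + exact: (rn n).2.
- by move=> n; exact: (nnmeasD (jn n) (rn n)).2.
- by move=> n w _; exact: (nnmeasD (jn n) (rn n)).1.
Qed.

Variables (W : state -> R) (r : nat -> bool -> R) (C Cr : R) (cost : path R -> \bar R).
Hypotheses (W0 : forall y, (0 <= W y)%R) (WC : forall y, (W y <= C * level y.1)%R).
Hypotheses (r0 : forall i a, (0 <= r i a)%R) (rC : forall i a, (r i a <= Cr * level i)%R).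
Hypothesis Wr : forall i a,
  ((alpha + total_rate M i a) * W (i, a) <= outcome_rate M (fun _ => W) i a + r i a)%R.
Hypothesis cost0 : forall w, 0 <= cost w.
Hypothesis pathwise : forall N, {ae P, forall w,
  \sum_(n < N) ((disc (jump_time w n) * W (current_state (hist w n)))%:E +
     reward (fun _ _ => 0%R) r n w) <=
  cost w + \sum_(n < N) reward (fun i y => W (i, y.2)) (fun i a => alpha * W (i, a))%R n w}.

(** By the pathwise inequality and the hypothesis on W, the mean of W at the start of
    a sojourn is at most the cost of the sojourn plus the mean of W at its end.
    Summing over N sojourns telescopes, up to the discounted value of W after N jumps, which
    tends to 0.  The cost may be any nonnegative function of the path. *)
Lemma verification_bound : (W z)%:E <= \int[P]_w cost w.
Proof.
have aW0 i a : (0 <= alpha * W (i, a))%R by rewrite mulr_ge0// ltW.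
have jf n : jv W n \is a fin_num by exact: jump_value_fin W0 WC.
have rf n : dv r n \is a fin_num.
  exact: (dwell_value_fin lambda_gt0 mu_ge0 alpha_gt0 mpi lawP _ r0 rC).
have stepE n : dv (fun i a => outcome_rate M (fun _ => W) i a + r i a)%R n = jv W n.+1 + dv r n.
  rewrite dwell_valueD//; last by move=> i a; exact: outcome_rate_ge0.
  by rewrite (jump_valueS alpha lambda_gt0 mu_ge0 mpi lawP).
have bound N : (W z)%:E <= \int[P]_w cost w + jv W N.
  have jn n := nnmeas_jump_value alpha z n W0.
  have rn0 n := nnmeas_sojourn_reward alpha z mpi (fun _ _ => lexx (0%R : R)) r0 n.
  have rnW n := nnmeas_sojourn_reward alpha z mpi (fun i (y : state) => W0 (i, y.2)) aW0 n.
  have := le_lower_integralD (mu := P) cost0 _ _ (pathwise N).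
  rewrite integral_sum_sojourns// ge0_integral_sum//; last 2 first.
  - by move=> n; exact: (rnW n).2.
  - by move=> n w _; exact: (rnW n).1.
  have G0 n : dv (fun i a => outcome_rate M (fun _ _ => 0) i a + r i a)%R n = dv r n.
    congr (dwell_value _ _ _ _ _ _ _); apply/funext => i; apply/funext => a.
    by rewrite /outcome_rate !mulr0 !add0r.
  under eq_bigr do rewrite G0.
  have Bn n : \int[P]_w reward (fun i y => W (i, y.2)) (fun i a => alpha * W (i, a))%R n w <=
      jv W n.+1 + dv r n.
    rewrite (integral_sojourn_reward alpha lambda_gt0 mu_ge0 mpi lawP _ aW0) -?stepE//.
    apply: le_dwell_value => // i a.
      by rewrite addr_ge0//; apply: outcome_rate_ge0.
    apply: le_trans (Wr i a); rewrite /outcome_rate /= -mulrDl rate_sum.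
    by rewrite mulrDl addrC.
  have nG : nnmeas (fun w : path R => \sum_(n < N) ((disc (jump_time w n) *
      W (current_state (hist w n)))%:E + reward (fun _ _ => 0%R) r n w)).
    split=> [w|]; first by apply: sume_ge0 => n _; exact: (nnmeasD (jn n) (rn0 n)).1.
    by apply: emeasurable_sum => n; exact: (nnmeasD (jn n) (rn0 n)).2.
  have nB : nnmeas (fun w : path R => \sum_(n < N)
      reward (fun i y => W (i, y.2)) (fun i a => alpha * W (i, a))%R n w).
    split=> [w|]; first by apply: sume_ge0 => n _; exact: (rnW n).1.
    by apply: emeasurable_sum => n; exact: (rnW n).2.
  move=> /(_ nG nB) le1.
  have {}le1 := le_trans le1 (leeD (lexx (\int[P]_w cost w)) (lee_sum _ (fun (n : 'I_N) _ => Bn n))).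
  have {}le1 : \sum_(n < N) jv W n + \sum_(n < N) dv r n <=
      \int[P]_w cost w + (\sum_(n < N) jv W n.+1 + \sum_(n < N) dv r n).
    by rewrite -!big_split.
  have Sfin : \sum_(n < N) dv r n \is a fin_num by apply/sum_fin_numP => n _ _; exact: rf.
  have Afin : \sum_(n < N) jv W n.+1 \is a fin_num by apply/sum_fin_numP => n _ _; exact: jf.
  have tele : \sum_(n < N) jv W n + jv W N = (W z)%:E + \sum_(n < N) jv W n.+1.
    rewrite -(jump_value0 alpha z P W).
    have := big_ord_recr N (fun n : 'I_N.+1 => jv W n); move=> /= <-.
    by rewrite big_ord_recl.
  have := leeD le1 (lexx (jv W N)); move: Sfin Afin tele.
  move: (\sum_(n < N) dv r n) (\sum_(n < N) jv W n.+1) (\sum_(n < N) jv W n).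
  move=> S A A1 Sfin Afin tele.
  have -> : A1 + S + jv W N = (W z)%:E + (A + S) by rewrite addeAC tele addeA.
  rewrite [X in _ <= X]addeAC leeD2rE//.
  by rewrite fin_numD Afin Sfin.
case: (ltP (\int[P]_w cost w) +oo) => [cfin|]; last by rewrite leye_eq => /eqP ->; rewrite leey.
have c0 : 0 <= \int[P]_w cost w by exact: integral_ge0.
have cv : \int[P]_w cost w + jv W N @[N --> \oo] --> \int[P]_w cost w + 0.
  apply: cvgeD; [|exact: cvg_cst|exact: (jump_value_cvg0 W0 WC)].
  by rewrite fin_num_adde_defl.
rewrite -[leRHS]adde0; apply: (lee_cvg_to (cvg_cst _) cv).
by apply: nearW => N; exact: bound.
Qed.

End verification.

(** * Switchings of a left-continuous action *)

Section shift.
Context {R : realType}.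
Local Notation leb := (@lebesgue_measure R).

Lemma measurable_shift (c : R) : measurable_fun [set: R] (fun x : R => x + c)%R.
Proof. by apply: measurable_funD. Qed.

Lemma lebesgue_shift (c : R) (A : set R) : measurable A ->
  leb ((fun x => x + c)%R @^-1` A) = leb A.
Proof.
move=> mA.
have mc : measurable_fun [set: measurableTypeR R] (fun x : R => x + c : measurableTypeR R)%R.
  exact: measurable_shift.
have := @lebesgue_measure_unique R (pushforward leb (fun x : R => x + c : measurableTypeR R)%R).
move=> /(_ mc) h; apply/esym; apply: h => // _ [[a b] _ <-].
transitivity (leb `](a - c)%R, (b - c)%R]%classic).
  rewrite !lebesgue_measure_itv /= !lte_fin ltrD2r; case: ifP => // _.
  by rewrite -!EFinB; congr _%:E; ring.
congr (leb _); apply/seteqP; split => x /=; rewrite !in_itv /=.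
  by rewrite ltrBlDr lerBrDr.
by rewrite ltrBlDr lerBrDr.
Qed.

Lemma integral_shift (c u v : R) (f : R -> \bar R) :
  measurable_fun `]u, v[ f -> (forall x, 0 <= f x) ->
  \int[leb]_(x in `]u, v[) f x = \int[leb]_(x in `](u - c)%R, (v - c)%R[) f (x + c)%R.
Proof.
move=> mf f0.
have mc : measurable_fun [set: measurableTypeR R] (fun x : R => x + c : measurableTypeR R)%R.
  exact: measurable_shift.
have := @ge0_integral_pushforward _ _ (measurableTypeR R) (measurableTypeR R) R
  (fun x => x + c)%R mc leb `]u, v[%classic f (measurable_itv _) mf (fun y _ => f0 y).
have -> : (fun x => x + c)%R @^-1` `]u, v[ = `](u - c)%R, (v - c)%R[%classic.
  by apply/seteqP; split => x /=; rewrite !in_itv /= ltrBlDr ltrBrDr.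
move=> <-; apply: eq_measure_integral => A mA _; apply/esym; exact: lebesgue_shift.
Qed.

End shift.

Section switching.
Context {R : realType}.
Local Notation leb := (@lebesgue_measure R).
Variable a : R -> bool.

Definition switches : set R :=
  [set t | (0 <= t)%R /\ \forall s \near t^'+, a s = ~~ a t].

(** Going back from v, the action keeps its value until u or until an epoch at which
    it changes; left-continuity makes the infimum of the times after which it is
    constant such an epoch. *)
Lemma last_switch (u v : R) : (u <= v)%R ->
  (forall t, (u < t <= v)%R -> \forall s \near t^'-, a s = a t) ->
  exists r, [/\ (u <= r <= v)%R, forall t, (r < t <= v)%R -> a t = a v &
    (r = u /\ a u = a v) \/ ((r < v)%R /\ a r = ~~ a v)].
Proof.
move=> uv lc.
pose E := [set s | (u <= s <= v)%R /\ forall t, (s < t <= v)%R -> a t = a v].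
have Ev : E v.
  split; first by rewrite uv lexx.
  by move=> t /andP[vt tv]; move: (lt_le_trans vt tv); rewrite ltxx.
have lE : lbound E u by move=> s [/andP[]].
have hE : has_inf E by split; [exists v|exists u].
pose r := inf E.
have ur : (u <= r)%R by apply: lb_le_inf => //; exists v.
have rv : (r <= v)%R by apply: ge_inf => //; exists u.
have ra t : (r < t <= v)%R -> a t = a v.
  move=> /andP[rt tv].
  have [s [_ Es] st] := inf_lt hE.1 rt.
  by apply: Es; rewrite st tv.
exists r; split => //; first by rewrite ur rv.
have [arv|arv] := eqVneq (a r) (a v); last first.
  right; split; last by move: arv; case: (a r); case: (a v).
  by rewrite lt_neqAle rv andbT; apply: contraNneq arv => rvE; rewrite [in X in X == _]rvE.
left; have [urE|ru] := eqVneq u r; first by rewrite {1}urE; split => //; rewrite [in LHS]urE.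
have ur' : (u < r)%R by rewrite lt_neqAle ru ur.
have := lc r; rewrite ur' rv => /(_ isT) nr.
have : \forall s \near r^'-, (u < s)%R by exact: nbhs_left_gt.
have := nr => /filterI/[apply] near_r.
exfalso; move: near_r; rewrite !near_simpl => -[e /= e0 he].
pose s := (r - e / 2)%R.
have sr : (s < r)%R by rewrite /s; lra.
have us : (u < s)%R.
  have hb : (`|r - s| < e)%R by rewrite ger0_norm /s; lra.
  exact: (he s hb sr).2.
have Es : E s.
  split; first by rewrite (ltW us) (le_trans (ltW sr) rv).
  move=> t /andP[st tv]; have [rt|tr] := ltP r t; first by apply: ra; rewrite rt tv.
  have [->//|tnr] := eqVneq t r.
  have tr' : (t < r)%R by rewrite lt_neqAle tnr tr.
  have hb : (`|r - t| < e)%R by rewrite ger0_norm; rewrite /s in st; lra.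
  by rewrite -arv (he t hb tr').1.
have : (r <= s)%R by apply: ge_inf => //; exists u.
by rewrite leNgt sr.
Qed.

Variables (alpha : R) (g s : bool -> R).
Hypotheses (alpha_gt0 : (0 < alpha)%R) (g0 : forall b, (0 <= g b)%R) (s0 : forall b, (0 <= s b)%R).
Hypothesis gs : forall b, (g b <= s (~~ b) + g (~~ b))%R.

Definition switching_cost (u v : R) : \bar R :=
  \esum_(t in switches `&` `[u, v[) (discount alpha t * s (~~ a t))%:E.

(** By induction on the number of switchings, the last one being removed: after it
    the potential disc t * g (a t) loses exactly the integral of
    disc t * alpha * g, and at a switching it loses at most its cost. *)
Lemma switching_bound (u v : R) : (0 <= u)%R -> (u <= v)%R ->
  (forall t, (u < t <= v)%R -> \forall s \near t^'-, a s = a t) ->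
  measurable_fun `]u, v[ a -> finite_set (switches `&` `[u, v[) ->
  (discount alpha u * g (a u))%:E <= switching_cost u v +
    ((discount alpha v * g (a v))%:E +
     \int[leb]_(t in `]u, v[) (discount alpha t * (alpha * g (a t)))%:E).
Proof.
move=> u0 + + + /finite_seqP[S SE].
have : forall t, (switches `&` `[u, v[) t -> t \in S by move=> t; rewrite SE.
have [n] := ubnP (size S); elim: n S v {SE} => // n IH S v.
rewrite ltnS => Sn St uv lc ma.
have [r [/andP[ur rv] ra rcase]] := last_switch uv lc.
have mg (D : set R) : measurable D -> D `<=` `]u, v[ ->
    measurable_fun D (fun t => (discount alpha t * (alpha * g (a t)))%:E : \bar R).
  move=> mD Duv; apply/measurable_EFinP; apply: measurable_funM.
    exact: measurable_funTS (measurable_discount alpha).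
  apply: measurable_funM; first exact: measurable_cst.
  have := measurable_funS (measurable_itv _) Duv ma.
  exact: (measurableT_comp (@measurable_bool_fun _ _ setT g)).
have f0 t : 0 <= (discount alpha t * (alpha * g (a t)))%:E.
  by rewrite lee_fin !mulr_ge0 ?discount_ge0// ltW.
have r0 : (0 <= r)%R by exact: le_trans ur.
have tail : (discount alpha v * g (a v))%:E +
    \int[leb]_(t in `]r, v[) (discount alpha t * (alpha * g (a t)))%:E =
    (discount alpha r * g (a v))%:E.
  have -> : \int[leb]_(t in `]r, v[) (discount alpha t * (alpha * g (a t)))%:E =
      (g (a v))%:E * \int[leb]_(t in `]r, v]) (alpha * expR (- (alpha * t)))%:E.
    have mexp : measurable_fun [set: R] (fun s : R => alpha * expR (- (alpha * s)))%R.
      apply: measurable_funM => //; apply: measurableT_comp => //.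
      by apply: measurableT_comp => //; exact: measurable_funM.
    rewrite -integral_itv_bndo_bndc; last first.
      by apply/measurable_EFinP; exact: measurable_funTS.
    rewrite -ge0_integralZl_EFin; [|exact: measurable_itv| | |exact: g0].
    - apply: eq_integral => t /set_mem; rewrite /= in_itv/= => /andP[rt tv].
      rewrite (ra t) ?rt ?(ltW tv)// -EFinM; congr _%:E.
      by rewrite /discount mulNr; ring.
    - by move=> t _; rewrite lee_fin mulr_ge0 ?expR_ge0// ltW.
    - by apply/measurable_EFinP; exact: measurable_funTS.
  rewrite integral_exp_itvoc// -EFinM -EFinD /discount !mulNr; congr _%:E.
  by ring.
have sc0 x y : 0 <= switching_cost x y.
  by apply: esum_ge0 => t _; rewrite lee_fin mulr_ge0 ?discount_ge0.
case: rcase => [[rE auv]|[rv' arv]].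
  by rewrite -rE tail rE auv leeDr.
have rsw : switches r.
  split=> //; near=> t.
  rewrite arv negbK; apply: ra; apply/andP; split.
    by near: t; exact: nbhs_right_gt.
  by apply: ltW; near: t; exact: nbhs_right_lt.
have rS : r \in S by apply: St; split => //=; rewrite in_itv/= ur rv'.
have rI : `[u, v[%classic r by rewrite /= in_itv/= ur rv'.
have sub : `]u, r[ `<=` `]u, v[ by apply: subset_itvl; rewrite bnd_simp ltW.
have sub' : `]r, v[ `<=` `]u, v[ by apply: subset_itvr; rewrite bnd_simp.
have {}IH := IH (rem r S) r _ _ ur _ _.
have {}IH : (discount alpha u * g (a u))%:E <= switching_cost u r +
    ((discount alpha r * g (a r))%:E +
     \int[leb]_(t in `]u, r[) (discount alpha t * (alpha * g (a t)))%:E).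
  apply: IH.
  - rewrite size_rem//; apply: leq_trans Sn.
    by rewrite prednK//; case: (S) rS.
  - move=> t [tsw]; rewrite /= in_itv/= => /andP[ut tr].
    apply: rem_mem; first by rewrite lt_eqF.
    by apply: St; split => //=; rewrite in_itv/= ut (lt_trans tr).
  - by move=> t /andP[ut tr]; apply: lc; rewrite ut (le_trans tr).
  - exact: measurable_funS ma.
have split_cost : switching_cost u v = (discount alpha r * s (~~ a r))%:E + switching_cost u r.
  rewrite /switching_cost (esumID [set r]); last first.
    by move=> t _; rewrite lee_fin mulr_ge0 ?discount_ge0.
  congr (_ + _).
    rewrite (_ : _ `&` _ = [set r]) ?esum_set1 ?lee_fin ?mulr_ge0 ?discount_ge0//.
    apply/seteqP; split => [t []//|t ->].
    by do 2?split.
  congr esum; apply/seteqP; split => [t [[tsw]]|t [tsw]]; rewrite /= !in_itv/= => /andP[ut tv].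
    move=> /eqP tr; split => //; rewrite ?in_itv/= ut ltNge le_eqVlt negb_or eq_sym tr/=.
    apply/negP => rt; have [_ ts] := tsw.
    have tc : \forall x \near t^'+, a x = a t.
      near=> x; rewrite (ra t) ?rt ?(ltW tv)//; apply: ra; apply/andP; split.
        by apply: (lt_trans rt); near: x; exact: nbhs_right_gt.
      by apply: ltW; near: x; exact: nbhs_right_lt.
    have [x [xs xc]] := @filter_ex _ _ (at_right_proper_filter t) _ (filterI ts tc).
    by move: xs; rewrite xc; case: (a t).
  split; first by split => //; rewrite ?in_itv/= ut (lt_trans tv).
  by move=> tr; move: tv; rewrite tr ltxx.
have split_int : \int[leb]_(t in `]u, r[) (discount alpha t * (alpha * g (a t)))%:E +
    \int[leb]_(t in `]r, v[) (discount alpha t * (alpha * g (a t)))%:E <=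
    \int[leb]_(t in `]u, v[) (discount alpha t * (alpha * g (a t)))%:E.
  rewrite -ge0_integral_setU//=; first last.
  - apply/disj_setPS => t [/=]; rewrite !in_itv/= => /andP[_ tr] /andP[rt _].
    by move: (lt_trans tr rt); rewrite ltxx.
  - apply: mg; first exact: measurableU.
    by rewrite subUset.
  - apply: ge0_subset_integral => //; [exact: measurableU|exact: mg|].
    by rewrite subUset.
rewrite split_cost.
have jumpr : (discount alpha r * g (a r))%:E <=
    (discount alpha r * s (~~ a r))%:E + (discount alpha r * g (a v))%:E.
  rewrite -EFinD lee_fin -mulrDr ler_wpM2l ?discount_ge0//.
  by rewrite (_ : a v = ~~ a r) ?gs// arv negbK.
rewrite -tail in jumpr.
apply: (le_trans IH).
apply: (le_trans (leeD2l _ (leeD2r _ jumpr))).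
have alg (x y c f k h : \bar R) : f + h <= k -> x + (y + (c + f) + h) <= y + x + (c + k).
  by move=> fh; rewrite -(addeA y) -(addeA c) (addeA x) (addeC x y) leeD// leeD.
by apply: alg; rewrite addeC.
Unshelve. all: by end_near. Qed.

End switching.

(** * Regular paths and their discounted cost *)

Section regular_path.
Context {R : realType} (M : queue R) (pi : decision_rule R) (z : state) (w : path R).
Local Notation leb := (@lebesgue_measure R).
Local Notation T := (jump_time w).
Local Notation hist n := (history_of z w n).
Local Notation act := (action pi z w).
Local Notation count n := (current_state (hist n)).1.

(** Properties that hold for almost every path: sojourns have positive length and
    states record the action in force at the jump. *)
Definition regular_path : Prop := forall n,
  (0 < (w n).1)%R /\ (w n).2.2 = pi (hist n) (w n).1.

Hypothesis pol : policy pi.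
Hypothesis reg : regular_path.

Lemma jump_time_lt n : (T n < T n.+1)%R.
Proof. by rewrite jump_timeS ltrDl (reg n).1. Qed.

Lemma jump_time_le m n : (m <= n)%N -> (T m <= T n)%R.
Proof.
move=> /subnK <-; elim: (n - m)%N => // k IH.
by rewrite addSn (le_trans IH)// ltW// jump_time_lt.
Qed.

Lemma jump_time_ge0 n : (0 <= T n)%R.
Proof. by rewrite -(jump_time0 w); exact: jump_time_le. Qed.

Lemma sojourn_le m n t : (T m < t)%R -> (t <= T n.+1)%R -> (m <= n)%N.
Proof.
move=> mt tn; rewrite leqNgt; apply/negP => /jump_time_le h.
have := lt_le_trans mt (le_trans tn h).
by rewrite ltxx.
Qed.

Lemma sojourn_lt m n t : (T m <= t)%R -> (t < T n.+1)%R -> (m <= n)%N.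
Proof.
move=> mt tn; rewrite leqNgt; apply/negP => /jump_time_le h.
have := le_lt_trans mt (lt_le_trans tn h).
by rewrite ltxx.
Qed.

Lemma sojourn_unique m n t : (T m < t <= T m.+1)%R -> (T n < t <= T n.+1)%R -> m = n.
Proof.
move=> /andP[m1 m2] /andP[n1 n2]; apply/eqP; rewrite eqn_leq.
by rewrite (sojourn_le m1 n2) (sojourn_le n1 m2).
Qed.

Lemma sojourn_uniqueo m n t : (T m <= t < T m.+1)%R -> (T n <= t < T n.+1)%R -> m = n.
Proof.
move=> /andP[m1 m2] /andP[n1 n2]; apply/eqP; rewrite eqn_leq.
by rewrite (sojourn_lt m1 n2) (sojourn_lt n1 m2).
Qed.

Lemma action_in n t : (T n < t <= T n.+1)%R -> act t = pi (hist n) (t - T n)%R.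
Proof.
move=> tn; have t0 : (0 < t)%R.
  by case/andP: tn => tn _; exact: le_lt_trans (jump_time_ge0 n) tn.
rewrite /action leNgt t0 /=; apply/idP/idP.
  by move=> /asboolP[m [tm h]]; rewrite (sojourn_unique tn tm).
by move=> h; apply/asboolP; exists n.
Qed.

Lemma action_jump n : act (T n) = (current_state (hist n)).2.
Proof.
case: n => [|n]; first by rewrite current_state0 /action jump_time0 lexx.
rewrite (@action_in n) ?lexx ?jump_time_lt//.
by rewrite jump_timeS addrC addKr current_stateS (reg n).2.
Qed.

Lemma customers_in n t : (T n <= t < T n.+1)%R -> customers z w t = count n.
Proof.
move=> tn; apply: xget_unique; first by exists n.
by move=> k [m [tm ->]]; rewrite (sojourn_uniqueo tn tm).
Qed.

Lemma action_left n t : (T n < t <= T n.+1)%R -> \forall s \near t^'-, act s = act t.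
Proof.
move=> /andP[nt tn].
have := pol.2 n (hist n) (t - T n)%R; rewrite subr_gt0 => /(_ nt) [e /= e0 he].
have near_e : \forall s \near t^'-, (t - e < s)%R by apply: nbhs_left_gt; rewrite ltrBlDr ltrDl.
have near_n : \forall s \near t^'-, (T n < s)%R by exact: nbhs_left_gt.
have near_t : \forall s \near t^'-, (s < t)%R by exact: nbhs_left_lt.
near=> s.
have es : (t - e < s)%R by near: s.
have ns : (T n < s)%R by near: s.
have st : (s < t)%R by near: s.
rewrite (@action_in n s) ?ns ?(le_trans (ltW st))// (@action_in n t) ?nt//.
have hb : (`|(t - T n) - (s - T n)| < e)%R by rewrite ger0_norm; lra.
have lt' : (s - T n < t - T n)%R by lra.
exact: (he _ hb lt').
Unshelve. all: by end_near. Qed.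

Lemma measurable_action n : measurable_fun `]T n, T n.+1[ act.
Proof.
have m : measurable_fun [set: R] (fun t : R => pi (hist n) (t - T n)%R).
  have := measurableT_comp (pol.1 n) (pair1_measurable (hist n)).
  move=> mp; have := measurableT_comp mp (measurable_shift (- T n)%R).
  exact.
have := measurable_funTS m (D := `]T n, T n.+1[%classic).
apply: eq_measurable_fun => t /set_mem; rewrite /= in_itv/= => /andP[nt tn].
by rewrite (@action_in n)// nt ltW.
Qed.

Variables (alpha : R).
Local Notation disc := (discount alpha).

Lemma sojourn_integral (rho : nat -> bool -> R) n : (forall i a, (0 <= rho i a)%R) ->
  \int[leb]_(t in `]T n, T n.+1[) (disc t * rho (count n) (act t))%:E =
  (disc (T n))%:E * running pi alpha rho (hist n) (w n).1.
Proof.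
move=> r0.
rewrite (@integral_shift _ (T n)); first last.
- by move=> t; rewrite lee_fin mulr_ge0 ?discount_ge0.
- apply/measurable_EFinP; apply: measurable_funM.
    exact: measurable_funTS (measurable_discount alpha).
  have := @measurable_action n.
  exact: (measurableT_comp (@measurable_bool_fun _ _ setT (rho (count n)))).
rewrite subrr jump_timeS addrC addKr /running -ge0_integralZl_EFin ?discount_ge0//.
- apply: eq_integral => s /set_mem; rewrite /= in_itv/= => /andP[s0 st].
  rewrite (@action_in n); last first.
    by rewrite ltrDr s0 /= jump_timeS addrC lerD2l ltW.
  by rewrite addrK -EFinM /discount mulrDr expRD; congr _%:E; ring.
- by move=> s _; rewrite lee_fin mulr_ge0 ?discount_ge0.
- apply/measurable_EFinP; apply: measurable_funTS.
  have := measurableT_comp (@measurable_running_integrand _ _ alpha pol.1 n rho) (pair1_measurable (hist n)).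
  exact.
Qed.

Definition holding_rate (i : nat) (a : bool) : R :=
  (holding_cost M * i%:R + running_cost M * a%:R)%R.

Hypothesis T_oo : forall x : R, exists n, (x < T n)%R.
Hypotheses (h_ge0 : (0 <= holding_cost M)%R) (c_ge0 : (0 <= running_cost M)%R).
Hypotheses (s_ge0 : forall b, (0 <= switch_cost M b)%R).

Lemma holding_rate_ge0 i a : (0 <= holding_rate i a)%R.
Proof. by rewrite addr_ge0// mulr_ge0. Qed.

Lemma sojourn_cover : `[0%R, +oo[%classic = \bigcup_n `[T n, T n.+1[%classic :> set R.
Proof.
apply/seteqP; split => [t|t [n _]]; rewrite /= !in_itv/= ?andbT; last first.
  by move=> /andP[nt _]; exact: le_trans (jump_time_ge0 n) nt.
move=> t0; pose Q n := (t < T n)%R.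
have exQ : exists n, Q n by exact: T_oo.
have := ex_minnP exQ => -[[|n] Qn Qmin].
  by move: Qn; rewrite /Q jump_time0 ltNge t0.
exists n => //=; rewrite in_itv/=; apply/andP; split; last exact: Qn.
rewrite leNgt.
by apply/negP => /Qmin; rewrite ltnn.
Qed.

Lemma sojourn_trivIset : trivIset setT (fun n => `[T n, T n.+1[%classic : set R).
Proof.
apply/trivIsetP => i j _ _ /eqP ij; apply/seteqP; split => // t [/=].
by rewrite !in_itv/= => ti tj; apply: ij; exact: sojourn_uniqueo ti tj.
Qed.

(** The sojourn intervals, closed on the left, partition the half-line of times when
    the path does not explode. *)
Lemma discounted_cost_sojourns :
  discounted_cost M pi z alpha w = \sum_(n <oo)
    ((disc (T n))%:E * running pi alpha holding_rate (hist n) (w n).1 +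
     switching_cost act alpha (switch_cost M) (T n) (T n.+1)).
Proof.
pose f t := (disc t * holding_rate (customers z w t) (act t))%:E.
have f0 t : 0 <= f t by rewrite lee_fin mulr_ge0 ?discount_ge0 ?holding_rate_ge0.
have fE n t : t \in `]T n, T n.+1[%classic -> f t = (disc t * holding_rate (count n) (act t))%:E.
  move=> /set_mem; rewrite /= in_itv/= => /andP[nt tn].
  by rewrite /f (@customers_in n)// (ltW nt).
have mfo n : measurable_fun `]T n, T n.+1[ f.
  have : measurable_fun `]T n, T n.+1[ (fun t => (disc t * holding_rate (count n) (act t))%:E).
    apply/measurable_EFinP; apply: measurable_funM.
      exact: measurable_funTS (measurable_discount alpha).
    have := @measurable_action n.
    exact: (measurableT_comp (@measurable_bool_fun _ _ setT (holding_rate (count n)))).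
  by apply: eq_measurable_fun => t /fE.
have mf n : measurable_fun `[T n, T n.+1[ f.
  by apply/emeasurable_fun_itv_obnd_cbndP; exact: mfo.
have sw0 n : 0 <= switching_cost act alpha (switch_cost M) (T n) (T n.+1).
  by apply: esum_ge0 => t _; rewrite lee_fin mulr_ge0 ?discount_ge0.
rewrite nneseriesD; first last.
- by move=> n _ _; exact: sw0.
- move=> n _ _; rewrite mule_ge0 ?lee_fin ?discount_ge0//; apply: running_ge0.
  exact: holding_rate_ge0.
rewrite /discounted_cost; congr (_ + _).
  rewrite sojourn_cover ge0_integral_bigcup//; first last.
  - exact: sojourn_trivIset.
  - by move=> t _; exact: f0.
  - have mU : measurable_fun (\bigcup_n `[T n, T n.+1[%classic) f.
      by apply/measurable_fun_bigcup => n; [exact: measurable_itv|exact: mf].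
    exact: mU.
  apply: eq_eseriesr => n _.
  rewrite -sojourn_integral; last exact: holding_rate_ge0.
  rewrite -integral_itv_obnd_cbnd; last exact: mfo.
  by apply: eq_integral => t tn; rewrite -(fE n t tn).
rewrite nneseries_esumT// /switching_cost -esum_bigcupT; first last.
- by move=> t; rewrite lee_fin mulr_ge0 ?discount_ge0.
- apply/trivIsetP => i j _ _ ij; have /trivIsetP/(_ i j Logic.I Logic.I ij) := sojourn_trivIset.
  by move=> e; rewrite setIACA setIid e setI0.
congr esum; rewrite -setI_bigcupr -sojourn_cover.
apply/seteqP; split => [t [t0 ta]|t [[]]//].
by split; [split|rewrite /= in_itv/= t0].
Qed.

End regular_path.

(** * The lower bound for an arbitrary policy *)

Section almost_every_path.
Context {R : realType} (M : queue R) (pi : decision_rule R) (alpha : R) (z : state).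
Local Notation leb := (@lebesgue_measure R).
Hypotheses (lambda_gt0 : (0 < arrival_rate M)%R) (mu_ge0 : (0 <= service_rate M)%R).
Hypothesis alpha_gt0 : (0 < alpha)%R.
Hypothesis pol : policy pi.
Variable P : probability (path R) R.
Hypothesis lawP : is_path_law M pi z P.
Local Notation disc := (discount alpha).
Local Notation hist w n := (history_of z w n).
Let mpi := pol.1.

(** The kernel of the next jump charges only regular outcomes, so the indicator of
    the others has mean 0. *)
Lemma ae_regular_path : {ae P, forall w, regular_path pi z w}.
Proof.
apply: ae_foralln => n.
pose b (p : history R n * (R * state)) := ~~ ((0 < p.2.1)%R && (p.2.2.2 == pi p.1 p.2.1)).
pose f (p : history R n * (R * state)) : \bar R := (if b p then 1 else 0)%:E.
have mb : measurable_fun [set: history R n * (R * state)] b.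
  have ms : measurable_fun [set: history R n * (R * state)] (fun p => p.2.1).
    exact: (measurableT_comp measurable_fst measurable_snd).
  apply: (measurableT_comp (@measurable_bool_fun _ _ setT negb)).
  apply: measurable_and.
    by apply: measurable_fun_ltr; [exact: measurable_cst|exact: ms].
  have mq : measurable_fun [set: history R n * (R * state)] (fun p => pi p.1 p.2.1).
    have mg : measurable_fun [set: history R n * (R * state)] (fun p => (p.1, p.2.1)).
      by apply: measurable_fun_pair; [exact: measurable_fst|exact: ms].
    have h := measurableT_comp (pol.1 n) mg.
    exact: h.
  have mx : measurable_fun [set: history R n * (R * state)] (fun p => p.2.2.2).
    exact: (measurableT_comp (@measurable_state_fun _ _ setT snd) (measurableT_comp measurable_snd measurable_snd)).
  have -> : (fun p : history R n * (R * state) => p.2.2.2 == pi p.1 p.2.1) =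
      fun p => if p.2.2.2 then pi p.1 p.2.1 else ~~ pi p.1 p.2.1.
    by apply/funext => p; case: (p.2.2.2); case: (pi _ _).
  apply: measurable_fun_ifT => //.
  exact: (measurableT_comp (@measurable_bool_fun _ _ setT negb) mq).
have nf : nnmeas f.
  split=> [p|]; first by rewrite lee_fin /f; case: ifP.
  apply/measurable_EFinP; apply: measurable_fun_ifT => //; exact: measurable_cst.
have mbw : measurable [set w : path R | b (hist w n, w n)].
  have := measurableT_comp mb (@measurable_next R z n).
  move=> /(_ measurableT [set true]); rewrite setTI; apply => //.
exists [set w : path R | b (hist w n, w n)]; split => //.
  transitivity (\int[P]_w f (hist w n, w n)).
    have := integral_indic P measurableT mbw; rewrite setIT => <-; apply: eq_integral => w _.
    rewrite indicE /f; case: ifPn => h; first by rewrite mem_set.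
    by rewrite memNset//; exact/negP.
  rewrite (is_path_law_mean lambda_gt0 mu_ge0 mpi lawP nf).
  apply: integral0_eq => w _.
  rewrite jump_meanE//; last first.
    by split=> [x|]; [exact: nf.1|exact: (measurableT_comp nf.2 (pair1_measurable (hist w n)))].
  apply: integral0_eq => t; rewrite /= in_itv/= andbT => t0.
  by rewrite /f /b /jump_outcome /= t0 eqxx /= !mule0 adde0.
move=> w nreg; apply: contrapT => nb; apply: nreg.
have : (0 < (w n).1)%R && ((w n).2.2 == pi (hist w n) (w n).1).
  by apply/negPn/negP => nbw; apply: nb.
by move=> /andP[t0 /eqP e].
Qed.

(** If all jumps occur before k, then at every jump the discount is at least
    exp (- alpha k), and the level is at least 1.  So the probability of this event
    is at most exp (alpha k) times the expected discounted level, which tends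
    to 0. *)
Lemma ae_nonexplosive : {ae P, forall w : path R, forall x : R, exists n, (x < jump_time w n)%R}.
Proof.
have main (k : nat) : {ae P, forall w : path R, exists n, (k%:R < jump_time w n)%R}.
  pose A := \bigcap_n [set w : path R | (jump_time w n <= k%:R)%R].
  have mA1 n : measurable [set w : path R | (jump_time w n <= k%:R)%R].
    rewrite (_ : mkset _ = setT `&` (fun w : path R => jump_time w n) @^-1` `]-oo, k%:R]%classic).
      exact: (@measurable_jump_time R n measurableT _ (measurable_itv _)).
    by rewrite setTI; apply/seteqP; split => w /=; rewrite in_itv.
  have mA : measurable A by exact: bigcapT_measurable.
  exists A; split => //; last first.
    move=> w /= nex n _ /=; rewrite leNgt; apply/negP => kn; apply: nex; by exists n.
  pose c := expR (alpha * k%:R).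
  have l0 (y : state) : (0 <= level M alpha y.1)%R by exact/ltW/level_gt0.
  have c0 : (0 <= c)%R by exact: expR_ge0.
  have PA n : P A <= c%:E * @jump_value R alpha z P (fun y => level M alpha y.1) n.
    rewrite -jump_valueZ//; have := integral_indic P measurableT mA; rewrite setIT => <-.
    apply: le_integral_lower => w; first by rewrite lee_fin.
    rewrite lee_fin indicE; have [/set_mem Aw|_] := boolP (w \in A); last first.
      exact: (mulr_ge0 (discount_ge0 _ _) (mulr_ge0 c0 (l0 _))).
    have := Aw n Logic.I; rewrite /= => Tk.
    have h1 : (1 <= disc (jump_time w n) * c)%R.
      rewrite /c /discount -expRD -[X in (X <= _)%R]expR0 ler_expR mulNr addrC subr_ge0.
      by rewrite ler_wpM2l// ltW.
    rewrite mulrA -[X in (X <= _)%R]mulr1 ler_pM// level_ge1//.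
  have cv : c%:E * @jump_value R alpha z P (fun y => level M alpha y.1) n @[n --> \oo] --> c%:E * 0.
    by apply: cvgeMl => //; exact: (jump_value_level_cvg0 lambda_gt0 mu_ge0 alpha_gt0 mpi lawP).
  apply/eqP; rewrite eq_le measure_ge0 andbT -(mule0 c%:E).
  by apply: (lee_cvg_to (cvg_cst _) cv); apply: nearW => n; exact: PA.
have := ae_foralln main; apply: filterS => w hw x.
have [n hn] := hw (Num.trunc x).+1.
exists n; apply: lt_trans hn; exact: truncnS_gt.
Qed.

Hypotheses (h_ge0 : (0 <= holding_cost M)%R) (c_ge0 : (0 <= running_cost M)%R).
Hypotheses (s_ge0 : forall b, (0 <= switch_cost M b)%R).
Variable W : state -> R.
Hypotheses (W0 : forall y, (0 <= W y)%R).
Hypothesis Ws : forall i b, (W (i, b) <= switch_cost M (~~ b) + W (i, ~~ b))%R.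

(** [switching_bound] on each sojourn, with the potential W (i, .) for the constant
    number i of customers. *)
Lemma pathwise_bound (w : path R) N : regular_path pi z w ->
  (forall x : R, exists n, (x < jump_time w n)%R) ->
  (forall k : nat, finite_set (switch_epochs pi z w `&` `[0%R, k%:R])) ->
  \sum_(n < N) ((disc (jump_time w n) * W (current_state (hist w n)))%:E +
     sojourn_reward pi alpha z (fun _ _ => 0%R) (holding_rate M) n w) <=
  discounted_cost M pi z alpha w +
  \sum_(n < N) sojourn_reward pi alpha z (fun i y => W (i, y.2)) (fun i a => alpha * W (i, a))%R n w.
Proof.
move=> reg Too fin.
have aW0 i a : (0 <= alpha * W (i, a))%R by rewrite mulr_ge0// ltW.
pose act := action pi z w; pose T := jump_time w.
pose sc n := switching_cost act alpha (switch_cost M) (T n) (T n.+1).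
have sc0 n : 0 <= sc n by apply: esum_ge0 => t _; rewrite lee_fin mulr_ge0 ?discount_ge0.
have run0 n : 0 <= (disc (T n))%:E * running pi alpha (holding_rate M) (hist w n) (w n).1.
  by rewrite mule_ge0 ?lee_fin ?discount_ge0//; apply: running_ge0 => i a; exact: holding_rate_ge0.
have each n : (disc (T n) * W (current_state (hist w n)))%:E <= sc n +
    sojourn_reward pi alpha z (fun i y => W (i, y.2)) (fun i a => alpha * W (i, a))%R n w.
  have Tn0 := jump_time_ge0 reg n; have Tnn := jump_time_lt reg n.
  pose i := (current_state (hist w n)).1.
  have fsn : finite_set (switches act `&` `[T n, T n.+1[).
    have [k hk] : exists k : nat, (T n.+1 <= k%:R)%R.
      by exists (Num.truncn (T n.+1)).+1; apply: ltW; exact: truncnS_gt.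
    apply: sub_finite_set (fin k) => t [tsw]; rewrite /= in_itv/= => /andP[nt tn].
    split => //; rewrite /= in_itv/= (le_trans Tn0 nt)/=.
    by apply: ltW; exact: lt_le_trans tn hk.
  have := @switching_bound R act alpha (fun b => W (i, b)) (switch_cost M) alpha_gt0
    (fun b => W0 (i, b)) s_ge0 (Ws i) (T n) (T n.+1) Tn0 (ltW Tnn)
    (fun t => action_left pol reg (n := n) (t := t)) (measurable_action pol reg (n := n)) fsn.
  rewrite /act (action_jump reg n) (action_jump reg n.+1) -surjective_pairing.
  move=> /le_trans; apply; apply: leeD => //.
  have rn0 : 0 <= running pi alpha (fun i a => alpha * W (i, a))%R (hist w n) (w n).1.
    by apply: running_ge0.
  have e : (disc (T n.+1) * W (i, (current_state (hist w n.+1)).2))%:E =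
      (disc (T n))%:E * (disc (w n).1 * W (i, (w n).2.2))%:E.
    by rewrite -EFinM current_stateS /T jump_timeS /discount mulrDr expRD mulrA.
  rewrite e (sojourn_integral pol reg alpha n aW0) /sojourn_reward.
  rewrite [leRHS]ge0_muleDr; [exact: lexx| |exact: rn0].
  by rewrite lee_fin; apply: mulr_ge0; [exact: discount_ge0|exact: W0].
rewrite (discounted_cost_sojourns pol reg alpha Too h_ge0 c_ge0 s_ge0).
apply: (@le_trans _ _ (\sum_(n < N) ((disc (T n))%:E * running pi alpha (holding_rate M) (hist w n) (w n).1 + sc n) +
   \sum_(n < N) sojourn_reward pi alpha z (fun i y => W (i, y.2)) (fun i a => alpha * W (i, a))%R n w)).
  rewrite -big_split /=; apply: lee_sum => n _.
  rewrite {1}/sojourn_reward mulr0 add0e addeC -addeA leeD2l//; exact: each.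
apply: leeD2r.
rewrite -(big_mkord xpredT (fun n => (disc (T n))%:E * running pi alpha (holding_rate M) (hist w n) (w n).1 + sc n)).
apply: nneseries_lim_ge => n _ _; exact: adde_ge0.
Qed.

End almost_every_path.

Section lower_bound.
Context {R : realType} (M : queue R) (alpha : R).
Hypotheses (lambda_gt0 : (0 < arrival_rate M)%R) (mu_ge0 : (0 <= service_rate M)%R).
Hypothesis alpha_gt0 : (0 < alpha)%R.
Hypotheses (h_ge0 : (0 <= holding_cost M)%R) (c_ge0 : (0 <= running_cost M)%R).
Hypotheses (s_ge0 : forall b, (0 <= switch_cost M b)%R).

Lemma path_law_is (pi : decision_rule R) (z : state) : policy pi ->
  is_path_law M pi z (path_law M pi z).
Proof.
move=> pol; rewrite /path_law; case: pselect => [e|]; first exact: (projT2 (cid e)).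
by case; exact: (path_law_exists z lambda_gt0 mu_ge0 pol.1).
Qed.

Lemma discounted_cost_ge0 pi z w : 0 <= discounted_cost M pi z alpha w.
Proof.
apply: adde_ge0.
  by apply: integral_ge0 => t _; rewrite lee_fin mulr_ge0 ?expR_ge0// addr_ge0// mulr_ge0.
by apply: esum_ge0 => t _; rewrite lee_fin mulr_ge0 ?expR_ge0.
Qed.

Lemma holding_rate_le i a :
  (holding_rate M i a <= (holding_cost M + running_cost M) * level M alpha i)%R.
Proof.
rewrite mulrDl; apply: lerD; first rewrite ler_wpM2l//.
  by rewrite lerDl (le_trans ler01)// level_shift_ge1.
by rewrite ler_wpM2l//; case: a => //=; rewrite ?level_ge1//; exact/ltW/level_gt0.
Qed.

(** The hypotheses on W hold for the fixed point of the Bellman operator and do not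
    refer to the policy. *)
Lemma policy_value_ge (W : state -> R) (C : R) (pi : decision_rule R) (z : state) :
  (forall y, (0 <= W y)%R) -> (forall y, (W y <= C * level M alpha y.1)%R) ->
  (forall i b, (W (i, b) <= switch_cost M (~~ b) + W (i, ~~ b))%R) ->
  (forall i a, ((alpha + total_rate M i a) * W (i, a) <=
     outcome_rate M (fun _ => W) i a + holding_rate M i a)%R) ->
  policy pi -> (W z)%:E <= policy_value M pi z alpha.
Proof.
move=> W0 WC Ws Wr pol; rewrite /policy_value; case: ifPn => [_|]; first exact: leey.
move=> /asboolPn/forallNP fin.
have finP t : {ae path_law M pi z, forall w, finite_set (switch_epochs pi z w `&` `[0%R, t])}.
  by apply: contrapT; exact: fin.
have law := path_law_is z pol.
apply: (verification_bound lambda_gt0 mu_ge0 alpha_gt0 pol.1 law W0 WC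
  (holding_rate_ge0 h_ge0 c_ge0) holding_rate_le Wr).
  by move=> w; exact: discounted_cost_ge0.
move=> N; have reg := ae_regular_path lambda_gt0 mu_ge0 pol law.
have nex := ae_nonexplosive lambda_gt0 mu_ge0 alpha_gt0 pol law.
have finN := ae_foralln (fun k : nat => finP k%:R).
apply: filterS3 reg nex finN => w reg nex finw.
exact: pathwise_bound.
Qed.

End lower_bound.

(** * Paths of a stationary policy *)

Section stationary_paths.
Context {R : realType} (M : queue R) (phi : state -> bool) (z : state).
Local Notation pi := (@stationary R phi).

Lemma policy_stationary : policy pi.
Proof.
split=> [n|n h t t0]; last exact: nearW.
exact: (measurableT_comp (@measurable_state_fun _ _ setT phi)
  (measurableT_comp (@measurable_current_state R n) measurable_fst)).
Qed.

Variable w : path R.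
Hypothesis reg : regular_path pi z w.
Local Notation T := (jump_time w).
Local Notation hist n := (history_of z w n).
Local Notation act := (action pi z w).

Lemma stationary_action_right n t : (T n <= t < T n.+1)%R ->
  \forall s \near t^'+, act s = phi (current_state (hist n)).
Proof.
move=> /andP[nt tn]; near=> s; rewrite (@action_in _ _ _ _ reg n)//.
apply/andP; split; first by apply: (le_lt_trans nt); near: s; exact: nbhs_right_gt.
by apply: ltW; near: s; exact: nbhs_right_lt.
Unshelve. all: by end_near. Qed.

(** The action of a stationary policy is constant on a sojourn after its initial
    instant, so switchings occur at jump epochs. *)
Lemma stationary_switch n t : (T n <= t < T n.+1)%R ->
  switches act t <-> t = T n /\ phi (current_state (hist n)) != (current_state (hist n)).2.
Proof.
move=> tn; have right_t := stationary_action_right tn; split=> [[t0 ts]|[tE ne]].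
  have [s [es ec]] := @filter_ex _ _ (at_right_proper_filter t) _ (filterI ts right_t).
  case/andP: tn; rewrite le_eqVlt => /predU1P[nt|nt] tn; last first.
    by move: es; rewrite ec (@action_in _ _ _ _ reg n t) ?nt ?(ltW tn)// /stationary; case: (phi _).
  split=> //; rewrite -ec es -nt (action_jump reg).
  by case: (current_state _).2.
split; first by rewrite tE (jump_time_ge0 reg).
apply: filterS right_t => s ->; rewrite tE (action_jump reg).
by move: ne; case: (phi _); case: (current_state _).2.
Qed.

Lemma stationary_switching_cost alpha (s : bool -> R) n : (forall b, (0 <= s b)%R) ->
  switching_cost act alpha s (T n) (T n.+1) =
  (discount alpha (T n) * (`|(phi (current_state (hist n)))%:R - (current_state (hist n)).2%:R| *
     s (phi (current_state (hist n)))))%:E.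
Proof.
move=> s0; rewrite /switching_cost.
have Tn := jump_time_lt reg n.
have [e|ne] := eqVneq (phi (current_state (hist n))) (current_state (hist n)).2.
  rewrite e subrr normr0 mul0r mulr0 (_ : _ `&` _ = set0) ?esum_set0//.
  apply/seteqP; split => // t [ts]; rewrite /= in_itv/= => tn.
  by have [_] := (stationary_switch tn).1 ts; rewrite e eqxx.
have tn : (T n <= T n < T n.+1)%R by rewrite lexx.
rewrite (_ : _ `&` _ = [set T n]).
  rewrite esum_set1 ?lee_fin ?mulr_ge0 ?discount_ge0// (action_jump reg).
  move: ne; case: (phi _); case: (current_state _).2 => //= _.
    by rewrite subr0 normr1 mul1r.
  by rewrite sub0r normrN normr1 mul1r.
apply/seteqP; split => [t [ts]|t ->].
  by rewrite /= in_itv/= => tn'; have [] := (stationary_switch tn').1 ts.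
by split; [exact: (stationary_switch tn).2|rewrite /= in_itv].
Qed.

Lemma stationary_finite_switches t : (forall x : R, exists n, (x < T n)%R) ->
  finite_set (switch_epochs pi z w `&` `[0%R, t]).
Proof.
move=> Too; have [N tN] := Too t.
apply: (@sub_finite_set _ _ (T @` `I_N)); last exact/finite_image/finite_II.
move=> x [xs]; rewrite /= in_itv/= => /andP[x0 xt].
have : `[0%R, +oo[%classic x by rewrite /= in_itv/= x0.
rewrite (sojourn_cover reg Too) => -[n _]; rewrite /= in_itv/= => xn.
exists n; last by have [] := (stationary_switch xn).1 xs.
rewrite /= ltnNge; apply/negP => Nn.
have := le_trans (jump_time_le reg Nn) (proj1 (andP xn)).
by rewrite leNgt (le_lt_trans xt tN).
Qed.

End stationary_paths.

Local Close Scope ereal_scope.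

(** * The value of a stationary policy *)

Section action_value.
Context {R : realType} (M : queue R) (alpha : R).

(** Cost of the action a until the next jump, where v is then paid. *)
Definition action_value (v : state -> R) (y : state) (a : bool) : R :=
  stage_cost M alpha y a +
  outcome_rate M (fun _ => v) y.1 a / (alpha + total_rate M y.1 a).

Hypotheses (lambda_gt0 : 0 < arrival_rate M) (mu_ge0 : 0 <= service_rate M).
Hypothesis alpha_gt0 : 0 < alpha.
Hypotheses (h_ge0 : 0 <= holding_cost M) (c_ge0 : 0 <= running_cost M).
Hypotheses (s_ge0 : forall b, 0 <= switch_cost M b).

Lemma discounted_rate_gt0 i a : 0 < alpha + total_rate M i a.
Proof. by rewrite addr_gt0// (lt_le_trans lambda_gt0)// total_rate_ge. Qed.

Lemma stage_costE y a : stage_cost M alpha y a =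
  `|a%:R - y.2%:R| * switch_cost M a +
  holding_rate M y.1 a / (alpha + total_rate M y.1 a).
Proof. by rewrite /stage_cost /holding_rate (mulrC a%:R). Qed.

Lemma stage_cost_ge0 y a : 0 <= stage_cost M alpha y a.
Proof.
rewrite stage_costE; apply: addr_ge0; first exact: mulr_ge0.
by rewrite divr_ge0 ?holding_rate_ge0// ltW// discounted_rate_gt0.
Qed.

Lemma action_value_ge0 v y a : (forall x, 0 <= v x) -> 0 <= action_value v y a.
Proof.
move=> v0; rewrite addr_ge0 ?stage_cost_ge0// divr_ge0 ?outcome_rate_ge0//.
exact/ltW/discounted_rate_gt0.
Qed.

Lemma le_action_value v u y a : (forall x, v x <= u x) ->
  action_value v y a <= action_value u y a.
Proof.
move=> vu; rewrite lerD2l ler_wpM2r ?invr_ge0 ?(ltW (discounted_rate_gt0 _ _))//.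
by rewrite lerD// ler_wpM2l// rate_ge0.
Qed.

End action_value.

Local Open Scope ereal_scope.

Section stationary_value.
Context {R : realType} (M : queue R) (alpha : R) (phi : state -> bool) (z : state).
Hypotheses (lambda_gt0 : (0 < arrival_rate M)%R) (mu_ge0 : (0 <= service_rate M)%R).
Hypothesis alpha_gt0 : (0 < alpha)%R.
Hypotheses (h_ge0 : (0 <= holding_cost M)%R) (c_ge0 : (0 <= running_cost M)%R).
Hypotheses (s_ge0 : forall b, (0 <= switch_cost M b)%R).

Local Notation pi := (@stationary R phi).
Local Notation P := (path_law M pi z).
Local Notation disc := (discount alpha).
Local Notation hist w n := (history_of z w n).
Local Notation jv := (jump_value alpha z P).
Local Notation dv := (dwell_value M pi alpha z P).
Let pol := @policy_stationary R phi.
Let mpi := pol.1.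
Let lawP := path_law_is lambda_gt0 mu_ge0 z pol.
Let stage y := stage_cost M alpha y (phi y).
Let stage0 y : (0 <= stage y)%R := stage_cost_ge0 lambda_gt0 mu_ge0 alpha_gt0 h_ge0 c_ge0 s_ge0 y (phi y).

Lemma jump_valueD (k l : state -> R) n : (forall y, (0 <= k y)%R) -> (forall y, (0 <= l y)%R) ->
  jv (fun y => k y + l y)%R n = jv k n + jv l n.
Proof.
move=> k0 l0; have [kk mk] := nnmeas_jump_value alpha z n k0; have [ll ml] := nnmeas_jump_value alpha z n l0.
by rewrite -ge0_integralD//; apply: eq_integral => w _; rewrite mulrDr EFinD.
Qed.

(** The rate is constant on a sojourn, so [dwell_mean_balanced] applies. *)
Lemma stationary_dwell_value (rho : nat -> bool -> R) n : (forall i a, (0 <= rho i a)%R) ->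
  dv rho n = jv (fun y => rho y.1 (phi y) / (alpha + total_rate M y.1 (phi y)))%R n.
Proof.
move=> r0; apply: eq_integral => w _; rewrite EFinM; congr (_ * _).
set y := current_state (hist w n).
have q0 := discounted_rate_gt0 lambda_gt0 mu_ge0 alpha_gt0 y.1 (phi y).
have k0 (i : nat) : (0 <= rho y.1 (phi y) / (alpha + total_rate M y.1 (phi y)))%R.
  by rewrite divr_ge0// ltW.
rewrite -(@dwell_mean_balanced _ _ _ _ lambda_gt0 mu_ge0 alpha_gt0 mpi n _ (hist w n) k0).
apply: eq_integral => t _; congr (_ * _)%:E.
by rewrite /stationary -/y mulrCA divff ?gt_eqF// mulr1.
Qed.

Lemma stage_jump_value (v : state -> R) n : (forall y, (0 <= v y)%R) ->
  jv stage n + jv v n.+1 = jv (fun y => action_value M alpha v y (phi y)) n.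
Proof.
move=> v0; rewrite (jump_valueS alpha lambda_gt0 mu_ge0 mpi lawP)//.
have o0 i a := @outcome_rate_ge0 _ M lambda_gt0 mu_ge0 (fun _ => v) i a (fun _ => v0).
rewrite stationary_dwell_value// -jump_valueD// => y.
by rewrite divr_ge0// ltW// discounted_rate_gt0.
Qed.

(** Switching costs are paid at the jumps and running costs during the sojourns; the
    sum of both over the n-th sojourn has mean the discounted stage cost. *)
Lemma stationary_policy_value :
  policy_value M pi z alpha = \sum_(n <oo) jv stage n.
Proof.
have reg := ae_regular_path lambda_gt0 mu_ge0 pol lawP.
have nex := ae_nonexplosive lambda_gt0 mu_ge0 alpha_gt0 pol lawP.
rewrite /policy_value; case: ifPn => [/asboolP[t]|_].
  case; apply: filterS2 reg nex => w rw nw; exact: stationary_finite_switches.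
have hr0 := holding_rate_ge0 h_ge0 c_ge0.
pose sw y := (`|(phi y)%:R - y.2%:R| * switch_cost M (phi y))%R.
have sw0 y : (0 <= sw y)%R by rewrite mulr_ge0.
pose g n w := sojourn_reward pi alpha z (fun _ _ => 0%R) (holding_rate M) n w +
  (disc (jump_time w n) * sw (current_state (hist w n)))%:E.
have nng n : nnmeas (g n).
  apply: nnmeasD; last exact: nnmeas_jump_value.
  exact: (nnmeas_sojourn_reward alpha z mpi (fun _ _ => lexx (0%R : R)) hr0 n).
have gE n : \int[P]_w g n w = jv stage n.
  have r1 := nnmeas_sojourn_reward alpha z mpi (fun _ _ => lexx (0%R : R)) hr0 n.
  have r2 := nnmeas_jump_value alpha z n sw0.
  rewrite ge0_integralD//; [|by move=> w _; exact: r1.1|exact: r1.2|by move=> w _; exact: r2.1|exact: r2.2].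
  rewrite (integral_sojourn_reward alpha lambda_gt0 mu_ge0 mpi lawP (fun _ _ => lexx (0%R : R)) hr0).
  rewrite [X in dv X](_ : _ = holding_rate M); last first.
    by apply/funext => i; apply/funext => a; rewrite /outcome_rate !mulr0 !add0r.
  rewrite stationary_dwell_value// addeC -jump_valueD//; last first.
    by move=> y; rewrite divr_ge0 ?hr0// ltW// discounted_rate_gt0.
  by congr (jump_value _ _ _ _ _); apply/funext => y; rewrite /stage stage_costE.
under [RHS]eq_eseriesr do rewrite -gE.
rewrite -integral_nneseries//; [|by move=> n; exact: (nng n).2|by move=> n w _; exact: (nng n).1].
apply: ge0_ae_integral_eq.
- by move=> w; exact: (discounted_cost_ge0 alpha h_ge0 c_ge0 s_ge0).
- split=> [w|]; first by apply: nneseries_ge0 => n _ _; exact: (nng n).1.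
  by apply: ge0_emeasurable_sum => [n w _ _|n _]; [exact: (nng n).1|exact: (nng n).2].
apply: filterS2 reg nex => w rw nw.
rewrite (discounted_cost_sojourns pol rw alpha nw h_ge0 c_ge0 s_ge0).
apply: eq_eseriesr => n _; rewrite (stationary_switching_cost rw alpha n s_ge0).
by rewrite /g /sojourn_reward mulr0 add0e.
Qed.

(** The partial costs plus the discounted value of v at the last jump are
    nonincreasing in the number of jumps. *)
Lemma stationary_value_le (v : state -> R) : (forall y, (0 <= v y)%R) ->
  (forall y, (action_value M alpha v y (phi y) <= v y)%R) ->
  policy_value M pi z alpha <= (v z)%:E.
Proof.
move=> v0 vT; rewrite stationary_policy_value.
have av0 y : (0 <= action_value M alpha v y (phi y))%R by exact: action_value_ge0.
have partial N : \sum_(0 <= n < N) jv stage n + jv v N <= (v z)%:E.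
  elim: N => [|N IH]; first by rewrite big_geq// add0e jump_value0.
  rewrite big_nat_recr//= -addeA stage_jump_value//; apply: le_trans IH.
  by rewrite leeD2l// le_jump_value.
apply: lime_le; first by apply: is_cvg_nneseries => n _ _; exact: jump_value_ge0.
apply: nearW => N; apply: le_trans (partial N).
by rewrite leeDl// jump_value_ge0.
Qed.

(** The partial costs plus the discounted value of v at the last jump are now
    nondecreasing, so they are bounded below by what they are after the first jump.
    The second term tends to 0 as v grows at most linearly. *)
Lemma stationary_value_ge (v : state -> R) C : (forall y, (0 <= v y)%R) ->
  (forall y, (v y <= C * level M alpha y.1)%R) ->
  (forall y, (v y <= action_value M alpha v y (phi y))%R) ->
  (action_value M alpha v z (phi z))%:E <= policy_value M pi z alpha.
Proof.
move=> v0 vC vT; rewrite stationary_policy_value.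
have partial N : (action_value M alpha v z (phi z))%:E <= \sum_(n <oo) jv stage n + jv v N.+1.
  apply: (@le_trans _ _ (\sum_(0 <= n < N.+1) jv stage n + jv v N.+1)); last first.
    by rewrite leeD2r//; apply: nneseries_lim_ge => n _ _; exact: jump_value_ge0.
  elim: N => [|N IH]; first by rewrite big_nat1 stage_jump_value// jump_value0.
  rewrite big_nat_recr//= -addeA stage_jump_value//; apply: (le_trans IH).
  by rewrite leeD2l// le_jump_value.
have S0 : 0 <= \sum_(n <oo) jv stage n by apply: nneseries_ge0 => n _ _; exact: jump_value_ge0.
case: (ltP (\sum_(n <oo) jv stage n) +oo) => [cfin|]; last by rewrite leye_eq => /eqP ->; rewrite leey.
have cv : \sum_(n <oo) jv stage n + jv v N.+1 @[N --> \oo] --> \sum_(n <oo) jv stage n + 0.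
  apply: cvgeD; [by rewrite fin_num_adde_defl|exact: cvg_cst|].
  rewrite (cvg_shiftS (jv v)).
  exact: (jump_value_cvg0 lambda_gt0 mu_ge0 alpha_gt0 mpi lawP v0 vC).
rewrite -[leRHS]adde0; apply: (lee_cvg_to (cvg_cst _) cv).
by apply: nearW => N; exact: partial.
Qed.

End stationary_value.

Local Close Scope ereal_scope.

(** * The optimality equation *)

Section optimality_equation.
Context {R : realType} (M : queue R) (alpha : R).
Hypotheses (lambda_gt0 : 0 < arrival_rate M) (mu_gt0 : 0 < service_rate M).
Hypothesis alpha_gt0 : 0 < alpha.
Hypotheses (h_ge0 : 0 <= holding_cost M) (c_ge0 : 0 <= running_cost M).
Hypotheses (s_ge0 : forall b, 0 <= switch_cost M b).
Let mu_ge0 := ltW mu_gt0.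
Local Notation av := (action_value M alpha).

Definition supersolution (v : state -> R) : Prop :=
  (forall y, 0 <= v y) /\ forall y, Num.min (av v y true) (av v y false) <= v y.

(** The cost of staying on for ever: each customer present costs h / (mu + alpha),
    and those arriving later cost lambda / alpha times as much. *)
Definition always_on_value (y : state) : R :=
  (1 - y.2%:R) * startup_cost M + holding_cost M * y.1%:R / (service_rate M + alpha) +
  holding_cost M * arrival_rate M / (alpha * (service_rate M + alpha)) +
  running_cost M / alpha.

Lemma always_on_valueE y : av always_on_value y true = always_on_value y.
Proof.
case: y => i d; rewrite /action_value stage_costE /outcome_rate rate_up rate_down /=.
rewrite /holding_rate /always_on_value /= !mulr1 !mul1r subrr mul0r !add0r.
have -> : `|1 - d%:R| = 1 - d%:R :> R by case: d; rewrite ?subrr ?normr0 ?subr0 ?normr1.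
have a0 := alpha_gt0; have l0 := lambda_gt0; have m0 := mu_gt0.
(* in R rather than nat, and also true for i = 0 *)
have iE : i%:R * (i.-1)%:R = i%:R * (i%:R - 1) :> R.
  by case: i => [|i]; rewrite ?mul0r// -natr1 addrK.
have i0 : 0 <= i%:R :> R by [].
move: iE i0; rewrite -natr1; move: (i%:R) (i.-1%:R) => x x1 xE x0.
have q0 : alpha + (arrival_rate M + x * service_rate M) != 0.
  by rewrite gt_eqF// addr_gt0// ltr_wpDr// mulr_ge0// ltW.
have q1 : service_rate M + alpha != 0 by rewrite gt_eqF// addr_gt0.
have q2 : alpha != 0 by rewrite gt_eqF.
have split_down : x * service_rate M * (holding_cost M * x1 / (service_rate M + alpha) +
     holding_cost M * arrival_rate M / (alpha * (service_rate M + alpha)) + running_cost M / alpha) =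
   x * service_rate M * (holding_cost M * (x - 1) / (service_rate M + alpha) +
     holding_cost M * arrival_rate M / (alpha * (service_rate M + alpha)) + running_cost M / alpha).
  transitivity (x * x1 * service_rate M * holding_cost M / (service_rate M + alpha) +
    x * service_rate M * (holding_cost M * arrival_rate M / (alpha * (service_rate M + alpha)) + running_cost M / alpha)).
    by ring.
  by rewrite xE; ring.
rewrite split_down; field.
by rewrite q2 q0 q1.
Qed.

Lemma always_on_value_ge0 y : 0 <= always_on_value y.
Proof.
have s0 : 0 <= startup_cost M := s_ge0 true.
have a0 := ltW alpha_gt0; have l0 := ltW lambda_gt0.
have d0 : 0 <= 1 - y.2%:R :> R by case: (y.2); rewrite ?subrr ?subr0.
have ma0 : 0 <= service_rate M + alpha by exact: addr_ge0.
apply: addr_ge0; last exact: divr_ge0.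
apply: addr_ge0; last by apply: divr_ge0; exact: mulr_ge0.
by apply: addr_ge0; [exact: mulr_ge0|apply: divr_ge0 => //; exact: mulr_ge0].
Qed.

Lemma supersolution_always_on : supersolution always_on_value.
Proof.
split=> y; first exact: always_on_value_ge0.
by rewrite ge_min always_on_valueE lexx.
Qed.

Definition least_supersolution (y : state) : R := inf [set v y | v in supersolution].
Local Notation W := least_supersolution.

Lemma least_supersolution_le v y : supersolution v -> W y <= v y.
Proof.
move=> sv; apply: ge_inf; last by exists v.
by exists 0 => _ [u [u0 _] <-].
Qed.

Lemma le_least_supersolution x y : (forall v, supersolution v -> x <= v y) -> x <= W y.
Proof.
move=> h; apply: lb_le_inf => [|_ [v sv <-]]; last exact: h.
by exists (always_on_value y), always_on_value => //; exact: supersolution_always_on.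
Qed.

Lemma least_supersolution_ge0 y : 0 <= W y.
Proof. by apply: le_least_supersolution => v [v0 _]. Qed.

(** Knaster-Tarski: T W <= W by monotonicity, so T W is a supersolution as well, and
    then W <= T W by minimality. *)
Lemma least_supersolution_fixed y : W y = Num.min (av W y true) (av W y false).
Proof.
have mono v u x : (forall x, v x <= u x) ->
    Num.min (av v x true) (av v x false) <= Num.min (av u x true) (av u x false).
  move=> vu; rewrite le_min !ge_min.
  by rewrite !(le_action_value lambda_gt0 mu_ge0 alpha_gt0 _ _ vu) orbT.
have TW x : Num.min (av W x true) (av W x false) <= W x.
  apply: le_least_supersolution => v sv.
  apply: le_trans (sv.2 x); apply: mono => {}x; exact: least_supersolution_le.
apply/eqP; rewrite eq_le TW andbT.
apply: (@least_supersolution_le (fun x => Num.min (av W x true) (av W x false))).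
split=> x; last by apply: mono => {}x; exact: TW.
by rewrite le_min !action_value_ge0//; exact: least_supersolution_ge0.
Qed.

Lemma least_supersolution_le_action y a : W y <= av W y a.
Proof. by rewrite [leLHS]least_supersolution_fixed ge_min; case: a; rewrite lexx ?orbT. Qed.

Lemma stage_cost_stay i b : stage_cost M alpha (i, b) b =
  holding_rate M i b / (alpha + total_rate M i b).
Proof. by rewrite stage_costE /= subrr normr0 mul0r add0r. Qed.

Lemma stage_cost_switch i b : stage_cost M alpha (i, ~~ b) b =
  switch_cost M b + holding_rate M i b / (alpha + total_rate M i b).
Proof.
rewrite stage_costE /=; congr (_ + _).
by case: b; rewrite /= ?subr0 ?sub0r ?normrN normr1 mul1r.
Qed.

(** W (i, ~~ b) is attained by one of the two actions.  If it is ~~ b, then starting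
    from b costs one switching more; if it is b, then starting from b costs at most as much. *)
Lemma least_supersolution_switch i b : W (i, b) <= switch_cost M (~~ b) + W (i, ~~ b).
Proof.
have change a : av W (i, ~~ a) a = switch_cost M a + av W (i, a) a.
  by rewrite /action_value stage_cost_switch stage_cost_stay addrA.
have [->|->] : W (i, ~~ b) = av W (i, ~~ b) (~~ b) \/ W (i, ~~ b) = av W (i, ~~ b) b.
  rewrite least_supersolution_fixed /Num.min.
  by case: ifP => _; case: b; by [left|right].
- by rewrite -change negbK; exact: least_supersolution_le_action.
- apply: (le_trans (least_supersolution_le_action (i, b) b)).
  by rewrite change addrA lerDr addr_ge0.
Qed.

(** The action a is available in the state (i, a) and costs no switching there. *)
Lemma least_supersolution_rate i a : (alpha + total_rate M i a) * W (i, a) <=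
  outcome_rate M (fun _ => W) i a + holding_rate M i a.
Proof.
have q0 := discounted_rate_gt0 lambda_gt0 mu_ge0 alpha_gt0 i a.
rewrite mulrC -ler_pdivlMr// mulrDl addrC -stage_cost_stay.
exact: least_supersolution_le_action.
Qed.

Lemma least_supersolution_level :
  exists C, forall y, W y <= C * level M alpha y.1.
Proof.
pose K := startup_cost M + holding_cost M * arrival_rate M / (alpha * (service_rate M + alpha)) +
  running_cost M / alpha.
exists (holding_cost M / (service_rate M + alpha) + K) => -[i d].
apply: (le_trans (least_supersolution_le _ supersolution_always_on)) => /=.
have s0 : 0 <= startup_cost M := s_ge0 true.
have H0 : 0 <= holding_cost M / (service_rate M + alpha).
  by rewrite divr_ge0// addr_ge0// ltW.
have K0 : 0 <= K.
  by rewrite !addr_ge0 ?divr_ge0 ?mulr_ge0 ?addr_ge0 ?(ltW alpha_gt0) ?(ltW lambda_gt0).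
have -> : always_on_value (i, d) =
    holding_cost M / (service_rate M + alpha) * i%:R + (K - d%:R * startup_cost M).
  by rewrite /always_on_value /K /=; ring.
apply: (@le_trans _ _ (holding_cost M / (service_rate M + alpha) * i%:R + K)).
  by rewrite lerD2l gerBl; exact: mulr_ge0.
rewrite mulrDl.
apply: lerD; first by rewrite ler_wpM2l// lerDl (le_trans ler01)// level_shift_ge1.
by rewrite ler_peMr// level_ge1.
Qed.

(** An action attaining the minimum in each state gives a stationary policy whose
    value is at most W, and W is a lower bound for all policies. *)
Lemma value_least_supersolution z : value M alpha z = (W z)%:E.
Proof.
have [C WC] := least_supersolution_level.
have W0 := least_supersolution_ge0.
pose phi y := av W y true <= av W y false.
have phiE y : av W y (phi y) <= W y.
  by rewrite [leRHS]least_supersolution_fixed /phi; case: (leP (av W y true)) => _; exact: lexx.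
apply/eqP; rewrite eq_le; apply/andP; split.
  apply: (@le_trans _ _ (policy_value M (stationary phi) z alpha)).
    by apply: ereal_inf_lbound; exists (stationary phi) => //; exact: policy_stationary.
  exact: (stationary_value_le z lambda_gt0 mu_ge0 alpha_gt0 h_ge0 c_ge0 s_ge0 W0 phiE).
apply: le_ereal_inf_tmp => _ [pi pol <-].
exact: (policy_value_ge lambda_gt0 mu_ge0 alpha_gt0 h_ge0 c_ge0 s_ge0 z W0 WC
  least_supersolution_switch least_supersolution_rate pol).
Qed.

Lemma bellman_least_supersolution y a : bellman M alpha y a = (av W y a)%:E.
Proof.
case: y => i d; rewrite /bellman; cbv zeta; rewrite ![(i, d).1]/=.
have up : value_int M alpha (i%:Z + 1) a = (W (i.+1, a))%:E.
  by rewrite -PoszD addn1 /= value_least_supersolution.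
have down : ((rate M (i%:Z - 1) i a / (alpha + total_rate M i a))%:E *
    value_int M alpha (i%:Z - 1) a)%E =
    (rate M (i%:Z - 1) i a / (alpha + total_rate M i a) * W (i.-1, a))%:E.
  case: i {up} => [|i]; first by rewrite rate_down mulr0 !mul0r mul0e.
  have -> : (i.+1%:Z - 1 = i%:Z)%R by lia.
  by rewrite /= value_least_supersolution.
rewrite up down -EFinM -!EFinD; congr _%:E.
by rewrite /action_value /outcome_rate /=; ring.
Qed.

(** If the policy has value W, then W >= T_phi W by [stationary_value_ge], as
    W <= T_phi W in any case. *)
Lemma discount_optimal_stationary phi : discount_optimal M alpha (stationary phi) <->
  forall y, W y = av W y (phi y).
Proof.
have [C WC] := least_supersolution_level.
have W0 := least_supersolution_ge0.
have Wav y : W y <= av W y (phi y) by exact: least_supersolution_le_action.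
split=> [[_ opt] y|fixed].
  apply/eqP; rewrite eq_le Wav -lee_fin -value_least_supersolution -opt.
  exact: (stationary_value_ge y lambda_gt0 mu_ge0 alpha_gt0 h_ge0 c_ge0 s_ge0 W0 WC Wav).
split=> [|y]; first exact: policy_stationary.
apply/eqP; rewrite eq_le; apply/andP; split.
  rewrite value_least_supersolution.
  apply: (stationary_value_le y lambda_gt0 mu_ge0 alpha_gt0 h_ge0 c_ge0 s_ge0 W0).
  by move=> x; rewrite -fixed.
by apply: ereal_inf_lbound; exists (stationary phi) => //; exact: policy_stationary.
Qed.

End optimality_equation.

Theorem theorem1 (R : realType) (lambda mu h c s0 s1 alpha : R)
    (lambda_gt0 : 0 < lambda) (mu_gt0 : 0 < mu) (h_gt0 : 0 < h) (c_gt0 : 0 < c)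
    (s0_ge0 : 0 <= s0) (s1_ge0 : 0 <= s1) (s01_gt0 : 0 < s0 + s1)
    (alpha_gt0 : 0 < alpha) :
  let M := Queue lambda mu h c s0 s1 in
  let V := value M alpha in
  let Vint := value_int M alpha in
  [/\ (forall (i : nat) (d : bool),
         (V (i, d) <= ((1 - d%:R) * s1 + h * i%:R / (mu + alpha) +
                       h * lambda / (alpha * (mu + alpha)) + c / alpha)%:E)%E),
      (forall (i : nat) (d : bool),
         V (i, d) = \big[mine/+oo%E]_(a : bool) bellman M alpha (i, d) a /\
         \big[mine/+oo%E]_(a : bool) bellman M alpha (i, d) a =
         mine
           (((1 - d%:R) * s1 + (h * i%:R + c) / (alpha + lambda + i%:R * mu))%:E
            + (lambda / (alpha + lambda + i%:R * mu))%:E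
                * Vint (i%:Z + 1)%R true
            + (i%:R * mu / (alpha + lambda + i%:R * mu))%:E
                * Vint (i%:Z - 1)%R true)%E
           ((d%:R * s0 + h * i%:R / (alpha + lambda))%:E
            + (lambda / (alpha + lambda))%:E * Vint (i%:Z + 1)%R false)%E) &
      (exists phi : nat * bool -> bool,
         discount_optimal M alpha (stationary phi)) /\
      (forall phi : nat * bool -> bool,
         discount_optimal M alpha (stationary phi) <->
         (forall (i : nat) (d : bool),
            V (i, d) = bellman M alpha (i, d) (phi (i, d))))].
Proof.
move=> M V Vint.
have h_ge0 := ltW h_gt0; have c_ge0 := ltW c_gt0.
have s_ge0 b : 0 <= switch_cost M b by case: b.
have VE y : V y = (least_supersolution M alpha y)%:E.
  exact: (@value_least_supersolution R M alpha lambda_gt0 mu_gt0 alpha_gt0 h_ge0 c_ge0 s_ge0).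
have BE y a : bellman M alpha y a = (action_value M alpha (least_supersolution M alpha) y a)%:E.
  exact: (@bellman_least_supersolution R M alpha lambda_gt0 mu_gt0 alpha_gt0 h_ge0 c_ge0 s_ge0).
have WE y := @least_supersolution_fixed R M alpha lambda_gt0 mu_gt0 alpha_gt0 h_ge0 c_ge0 s_ge0 y.
have opt phi : discount_optimal M alpha (stationary phi) <->
    forall y, least_supersolution M alpha y =
      action_value M alpha (least_supersolution M alpha) y (phi y).
  exact: (@discount_optimal_stationary R M alpha lambda_gt0 mu_gt0 alpha_gt0 h_ge0 c_ge0 s_ge0).
split.
- move=> i d; rewrite VE lee_fin.
  have sup := @supersolution_always_on R M alpha lambda_gt0 mu_gt0 alpha_gt0 h_ge0 c_ge0 s_ge0.
  exact: (least_supersolution_le (i, d) sup).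
- move=> i d.
  have minE : \big[mine/+oo%E]_(a : bool) bellman M alpha (i, d) a =
      mine (bellman M alpha (i, d) true) (bellman M alpha (i, d) false).
    by rewrite big_bool.
  split; first by rewrite minE !BE VE WE EFin_min.
  rewrite minE; congr (mine _ _).
    rewrite /bellman /= rate_up rate_down /= addrA !mul1r /stage_cost /=.
    rewrite mul1r addrA (_ : `|1 - d%:R| = 1 - d%:R)//.
    rewrite -!addeA; congr (_ + _)%E.
    by rewrite addeC.
    by case: d {minE}; rewrite ?subrr ?normr0 ?subr0 ?normr1.
  rewrite /bellman /= rate_up rate_down /= !mul0r mul0e adde0.
  rewrite /stage_cost /= mul0r addr0 sub0r normrN.
  by rewrite (_ : `|d%:R| = d%:R)//; case: d {minE}; rewrite ?normr1 ?normr0.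
split.
  exists (fun y => action_value M alpha (least_supersolution M alpha) y true <=
    action_value M alpha (least_supersolution M alpha) y false).
  apply/opt => y; rewrite {1}WE /=.
  by case: (leP (action_value M alpha _ y true)).
move=> phi; split=> [/opt fixed i d|fixed].
  by rewrite VE BE -fixed.
by apply/opt => -[i d]; apply: EFin_inj; rewrite -VE -BE.
Qed.
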